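(* Let $K$ be an algebraically closed field, $n\geq 2$, $\underline{x}=(x_1,\ldots,x_n)$, and let $P\in K[\underline{x}]$ be a non-constant polynomial which is not a monomial (up to a constant) and is not a pure power in $K[\underline{x}]$. (1) If $P$ is homogeneous in two monomials, then, given a maximal $(m_1,m_2)$-homogeneous decomposition $P=h(m_1,m_2)$ of degree $\delta$ with $m_1$ and $m_2$ monomials, the reducibility monomial sites of $P$ are all sets of monomials of the form $m_1^km_2^{\delta-k}$, $0\leq k\leq\delta$, of degree $\leq\deg(P)$. (That is, an admissible set $\{Q_1,\ldots,Q_\ell\}$ of monomials is a reducibility monomial site of $P$ if and only if every $Q_i$ is of this form.) (2) If $P$ is not homogeneous in two monomials, then the only possible reducibility monomial sites of $P$ are singletons ($\ell=1$) of the form $\{m^d\}$ with $m$ a monomial relatively prime to $P$ and $d\geq 2$. Furthermore the following should hold: $P=h(m,\psi)$ with $h\in K[u,v]$ homogeneous of degree $d$, $\psi\in K[\underline{x}]$ not a monomial, and $\deg(P)>\max(\deg(m),\deg(\psi))$; one may also impose that $\psi+\lambda m$ is irreducible in $\overline{K(\lambda)}[\underline{x}]$.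
   Context: A monomial is a polynomial $x_1^{a_1}\cdots x_n^{a_n}$ with $a_i\in\mathbb{N}$ (possibly all $0$); ''$\psi$ is not a monomial'' is understood up to non-zero constants. A polynomial $R\in K[\underline{x}]$ is a pure power if $R=S^e$ with $S\in K[\underline{x}]$, $e>1$. $\overline{k}$ denotes an algebraic closure of a field $k$, and $\lambda,\lambda_1,\lambda_2,\ldots$ are independent indeterminates. Admissible sets and reducibility monomial sites: a set $\{Q_1,\ldots,Q_\ell\}$ ($\ell\geq 1$) of monomials is admissible for $P$ if $\deg(Q_i)\leq\deg(P)$ for all $i$, the polynomials $P,Q_1,\ldots,Q_\ell$ are pairwise distinct up to multiplicative constants, and $P,Q_1,\ldots,Q_\ell$ are relatively prime (no non-constant polynomial divides all of them). An admissible set is a reducibility monomial site of $P$ if $P+\lambda_1Q_1+\cdots+\lambda_\ell Q_\ell$ is reducible in $\overline{K(\lambda_1,\ldots,\lambda_\ell)}[\underline{x}]$. Homogeneous decompositions: given relatively prime $\phi,\psi\in K[\underline{x}]$ with $\deg(P)>\max(\deg(\phi),\deg(\psi))$, a $(\phi,\psi)$-homogeneous decomposition of $P$ of degree $d$ is an identity $P=h(\phi,\psi)$ with $h\in K[u,v]$ homogeneous of degree $d$; it is maximal if $\phi+\lambda\psi$ is irreducible in $\overline{K(\lambda)}[\underline{x}]$. $P$ is homogeneous in two monomials if it has an $(m_1,m_2)$-homogeneous decomposition for some monomials $m_1,m_2$ (which are thus relatively prime with $\deg(P)>\max(\deg(m_1),\deg(m_2))$). *)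

(* Defs.v *)
From HB Require Import structures.
From mathcomp Require Import all_boot all_order all_algebra.
From mathcomp Require Import mpoly.

Set Implicit Arguments.
Unset Strict Implicit.
Unset Printing Implicit Defensive.

Import GRing.Theory.
Local Open Scope ring_scope.

(* MathComp has no algebraic closure of an arbitrary field; this is the type of
   all algebraic closures of F. *)
Record algClosure (F : fieldType) := AlgClosure {
  closure_field :> closedFieldType;
  closure_emb : {rmorphism F -> closure_field};
  closure_alg : forall z : closure_field, algebraicOver closure_emb z
}.

(* The rational function field K(lambda_1, ..., lambda_l). *)
Definition ratfun (K : fieldType) (l : nat) : fieldType :=
  {fraction {mpoly K[l]}}.

Section Polynomials.
Variables (K : fieldType) (n : nat).
Implicit Types p q r : {mpoly K[n]}.

(* [msize p] is [deg p + 1], and 0 if p = 0. *)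
Definition nonconstant p : Prop := (1 < msize p)%N.

Definition mreducible p : Prop :=
  exists q r, [/\ nonconstant q, nonconstant r & p = q * r].

Definition mirreducible p : Prop := nonconstant p /\ ~ mreducible p.

Definition pure_power p : Prop :=
  exists (q : {mpoly K[n]}) (e : nat), (1 < e)%N /\ p = q ^+ e.

Definition eq_upto_const p q : Prop := exists2 c : K, c != 0 & p = c *: q.

Definition monomial_upto_const p : Prop :=
  exists m : 'X_{1..n}, eq_upto_const p 'X_[m].

Definition mdivides r p : Prop := exists q, p = q * r.

Definition relatively_prime (s : seq {mpoly K[n]}) : Prop :=
  forall r, (forall p, p \in s -> mdivides r p) -> ~ nonconstant r.

Definition hom_decomposition p phi psi (d : nat) (h : {mpoly K[2]}) : Prop :=
  [/\ relatively_prime [:: phi; psi],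
      (maxn (msize phi) (msize psi) < msize p)%N,
      h \is d.-homog
    & p = h \mPo [tuple phi; psi]].

Definition hom_in_two_monomials p : Prop :=
  exists (m1 m2 : 'X_{1..n}) (d : nat) (h : {mpoly K[2]}),
    hom_decomposition p 'X_[m1] 'X_[m2] d h.

(* A set {Q_1, ..., Q_l} of monomials is given by the tuple of its exponents;
   the monomials are pairwise distinct by the fourth condition. *)
Definition admissible p (l : nat) (Q : l.-tuple 'X_{1..n}) : Prop :=
  [/\ (0 < l)%N,
      forall i, (msize ('X_[tnth Q i] : {mpoly K[n]}) <= msize p)%N,
      forall i, ~ eq_upto_const p 'X_[tnth Q i],
      forall i j, i != j -> ~ eq_upto_const 'X_[tnth Q i] 'X_[tnth Q j]
    & relatively_prime (p :: [seq 'X_[m] | m <- Q])].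

End Polynomials.

Section OverClosure.
Variables (K : fieldType) (n l : nat) (L : algClosure (ratfun K l)).

Definition const_in_closure (c : K) : L :=
  closure_emb L (tofrac (c%:MP : {mpoly K[l]})).

Definition lambda (i : 'I_l) : L :=
  closure_emb L (tofrac ('X_i : {mpoly K[l]})).

Definition to_closure (p : {mpoly K[n]}) : {mpoly L[n]} :=
  map_mpoly const_in_closure p.

Definition reducibility_monomial_site (p : {mpoly K[n]})
    (Q : l.-tuple 'X_{1..n}) : Prop :=
  admissible p Q /\
  mreducible (to_closure p + \sum_(i < l) lambda i *: 'X_[tnth Q i]).

End OverClosure.

Definition generically_irreducible (K : fieldType) (n : nat)
    (L : algClosure (ratfun K 1%N)) (phi psi : {mpoly K[n]}) : Prop :=
  mirreducible (to_closure L phi + lambda L ord0 *: to_closure L psi).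

Definition maximal_hom_decomposition (K : fieldType) (n : nat)
    (L : algClosure (ratfun K 1%N)) (p phi psi : {mpoly K[n]}) (d : nat)
    (h : {mpoly K[2]}) : Prop :=
  hom_decomposition p phi psi d h /\ generically_irreducible L phi psi.

(* Main.v *)
Require Import Defs.
From HB Require Import structures.
From mathcomp Require Import all_boot all_order all_algebra.
From mathcomp Require Import qfpoly.
From mathcomp Require Import mpoly.
From mathcomp Require Import zify ring.
From Stdlib Require Import Classical.

Set Implicit Arguments.
Unset Strict Implicit.
Unset Printing Implicit Defensive.

Import GRing.Theory.
Local Open Scope ring_scope.

(** The statement is a monomial version of the theorem of Bertini and Krull, and
    the proof studies the reducible family [P + lambda_1 Q_1 + ... + lambda_l Q_l]
    at a generic point.

    Let [x] be a generic point of affine space and [k] the field generated over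
    [K] by [x] and by all parameters but the first one, to which the value is
    given for which the hypersurface passes through [x]. The parameters obtained in
    this way are still algebraically independent, since [P] has a term that
    differs from the first monomial ([spec_params_inj]); hence the member of the
    family through [x] remains reducible over an algebraic closure of [k]. The
    point is rational over [k], and it is smooth because [P] is not a pure power
    and the admissible set is relatively prime to it ([exists_separating]). The
    smallest factor through a smooth rational point has no conjugates; it is
    therefore rational up to inseparability, which linear algebra over [k] removes
    ([rational_factor]). So the family factors over [k] itself ([family_factor]).

    With one parameter, [k] is the field of rational functions of [x]. A
    non-constant ratio of coefficients of the factor, written as a reduced fraction
    [phi / psi], describes it: by Gordan's version of the theorem of Lueroth the
    factor is the generic member of the pencil of [phi] and [psi]
    ([pencil_generator]), and specializing [x] shows that [P] and the monomial are
    forms of the same degree in [phi] and [psi] ([pencil_composition],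
    [one_parameter]).

    With more parameters, the member through [x] is affine in the remaining ones,
    so that one factor does not contain them, and divides the minors
    [q0(x) p(z) - p(x) q0(z)] for [p] among [P] and the other monomials
    ([parameter_free_factor]). For a weight that takes the same value on two of the
    monomials, this factor is homogeneous; if some exponent had a different weight,
    the factor would divide a polynomial over [K], hence be defined over [K] and be a
    common divisor of [P] and the monomials. All exponents therefore lie on a line
    ([site_same_weight]).

    The theorem follows from a study of forms in two polynomials. If [P] is a form
    in monomials [m1] and [m2], then so are the members of the family for
    monomials [m1^k m2^(delta-k)], and forms split over an algebraically closed
    field ([form_site]); conversely a site has the weights of [P] for all weights
    that agree on [m1] and [m2] ([site_weights]), and the maximality of the
    decomposition makes the direction of the line primitive, which leaves only the
    points of the segment ([monomial_site_segment]). If [P] is not homogeneous in two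
    monomials, exponents on a line are excluded, either because they make [P] a
    form in two monomials or because the family is an irreducible binomial
    ([several_site]); for a single monomial, its linear factors in the pencil must
    all be proportional ([single_site]). *)

(** * Unique factorization *)

Definition divides (R : comNzRingType) (a b : R) : Prop := exists c, b = c * a.

Section Dvd.
Variable R : comNzRingType.
Implicit Types a b c : R.

Lemma dvd_refl a : divides a a. Proof. by exists 1; rewrite mul1r. Qed.

Lemma dvd0 a : divides a 0. Proof. by exists 0; rewrite mul0r. Qed.

Lemma dvd_trans b a c : divides a b -> divides b c -> divides a c.
Proof. by move=> [x ->] [y ->]; exists (y * x); rewrite mulrA. Qed.

Lemma dvdMl a b c : divides a b -> divides a (c * b).
Proof. by move=> [x ->]; exists (c * x); rewrite mulrA. Qed.

Lemma dvdMr a b c : divides a b -> divides a (b * c).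
Proof. by rewrite mulrC; apply: dvdMl. Qed.

Lemma dvd_mulr a b : divides a (a * b).
Proof. exact/dvdMr/dvd_refl. Qed.

Lemma dvd_mull a b : divides a (b * a).
Proof. exact/dvdMl/dvd_refl. Qed.

Lemma dvdD a b c : divides a b -> divides a c -> divides a (b + c).
Proof. by move=> [x ->] [y ->]; exists (x + y); rewrite mulrDl. Qed.

Lemma dvdN a b : divides a b -> divides a (- b).
Proof. by move=> [x ->]; exists (- x); rewrite mulNr. Qed.

Lemma dvdB a b c : divides a b -> divides a c -> divides a (b - c).
Proof. by move=> ab /dvdN; apply: dvdD. Qed.

Lemma dvd_sum (I : Type) (r : seq I) (P : pred I) (F : I -> R) a :
  (forall i, P i -> divides a (F i)) -> divides a (\sum_(i <- r | P i) F i).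
Proof. by move=> aF; apply: big_ind => //; [exact: dvd0 | exact: dvdD]. Qed.

End Dvd.

Lemma dvd_rmorph (R S : comNzRingType) (f : {rmorphism R -> S}) a b :
  divides a b -> divides (f a) (f b).
Proof. by move=> [c ->]; exists (f c); rewrite rmorphM. Qed.

Definition prime_elt (R : idomainType) (p : R) : Prop :=
  [/\ p != 0, p \isn't a GRing.unit
    & forall a b, divides p (a * b) -> divides p a \/ divides p b].

(** The index counts the prime factors, so that removing one of them is a
    terminating process. *)
Inductive prime_product (R : idomainType) : nat -> R -> Prop :=
| PPunit u of u \is a GRing.unit : prime_product 0 u
| PPmul k p a of prime_elt p & prime_product k a :
    prime_product k.+1 (p * a).

Definition factorial_ring (R : idomainType) : Prop :=
  forall a : R, a != 0 -> exists k, prime_product k a.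

Section PrimeProducts.
Variable R : idomainType.
Implicit Types a b c f g h p : R.

Lemma prime_productUM k u a :
  u \is a GRing.unit -> prime_product k a -> prime_product k (u * a).
Proof.
move=> Uu; elim=> [v Uv|{}k p {}a pp _ IH].
  by apply: PPunit; rewrite unitrM Uu.
by rewrite mulrCA; apply: PPmul.
Qed.

Lemma prime_productM k l a b :
  prime_product k a -> prime_product l b -> prime_product (k + l) (a * b).
Proof.
elim=> [u Uu|{}k p {}a pp _ IH] ppb; first exact: prime_productUM.
by rewrite -mulrA; apply: PPmul pp (IH ppb).
Qed.

Lemma prime_product_rem k a p : prime_product k a -> prime_elt p -> divides p a ->
  exists l b, [/\ k = l.+1, a = b * p & prime_product l b].
Proof.
move=> ppa pp; have [p0 pU pM] := pp.
elim: ppa => [u Uu [c cE]|{}k q {}a qq ppa IH].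
  by case/negP: pU; move: Uu; rewrite cE unitrM => /andP[].
have [q0 qU qM] := qq.
case/pM => [[c cE]|/IH[l [b [-> -> ppb]]]]; last first.
  by exists l.+1, (q * b); split; rewrite ?mulrA //; apply: PPmul.
have [[d dE]|[d dE]] : divides q c \/ divides q p by apply: qM; rewrite -cE; apply: dvd_refl.
  case/negP: pU; apply/unitrPr; exists d; apply: (mulfI q0).
  by rewrite mulr1 [RHS]cE dE; ring.
have Uc : c \is a GRing.unit.
  apply/unitrPr; exists d; apply: (mulIf p0); rewrite mul1r.
  by rewrite -mulrA mulrCA -cE -dE.
exists k, (c * a); split=> //; last exact: prime_productUM.
by rewrite cE mulrAC.
Qed.

(** Every prime factor of [c] divides one of the two factors of the right-hand
    side, so that [c] can be cancelled step by step.  This is the form in which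
    Gauss's lemma and Euclid's lemma are used below. *)
Lemma prime_product_split k c f g h : prime_product k c -> c * f = g * h ->
  exists a b g' h', [/\ c = a * b, g = a * g', h = b * h' & f = g' * h'].
Proof.
move=> ppc; elim: ppc f g h => [u Uu|{}k p {}c pp _ IH] f g h E.
  exists u, 1, (u^-1 * g), h; rewrite mulr1 mul1r mulVKr //; split=> //.
  by rewrite -mulrA -E mulKr.
have [p0 _ pM] := pp; have : divides p (g * h).
  by rewrite -E -mulrA mulrC; apply: dvd_mull.
case/pM => [[x xE]|[x xE]].
  have /IH[a [b [g' [h' [-> xE' -> ->]]]]] : c * f = x * h.
    by apply: (mulfI p0); rewrite mulrA E xE; ring.
  by exists (p * a), b, g', h'; split=> //; rewrite ?xE ?xE'; ring.
have /IH[a [b [g' [h' [-> -> xE' ->]]]]] : c * f = g * x.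
  by apply: (mulfI p0); rewrite mulrA E xE; ring.
by exists a, (p * b), g', h'; split=> //; rewrite ?xE ?xE'; ring.
Qed.

(** The prime factors of [a] are distributed over [b] and [c]; those that go
    to [c] make up a common divisor of [a] and [c]. *)
Lemma factorial_Euclid : factorial_ring R -> forall a b c, a != 0 ->
  (forall d, divides d a -> divides d c -> d \is a GRing.unit) ->
  divides a (b * c) -> divides a b.
Proof.
move=> fR a b c a0 cop [x xE]; have [k ppa] := fR a a0.
have E : a * x = b * c by rewrite xE mulrC.
have [a1 [a2 [b' [c' [aE -> cE _]]]]] := prime_product_split ppa E.
have Ua2 : a2 \is a GRing.unit.
  by apply: cop; [rewrite aE; apply: dvd_mull | rewrite cE; apply: dvd_mulr].
exists (a2^-1 * b'); rewrite aE; transitivity (a2^-1 * a2 * (a1 * b')); last by ring.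
by rewrite mulVr // mul1r.
Qed.

Lemma factorial_irreducible_prime : factorial_ring R -> forall a, a != 0 ->
  a \isn't a GRing.unit ->
  (forall b c, a = b * c -> b \is a GRing.unit \/ c \is a GRing.unit) ->
  prime_elt a.
Proof.
move=> fR a a0 Ua irr; have [k ppa] := fR a a0.
case: ppa a0 Ua irr => [u Uu _ /negP//|{}k p {}a pp ppa pa0 Upa irr].
have [p0 pU pM] := pp.
have Ua : a \is a GRing.unit by case: (irr _ _ erefl) => // Up; case/negP: pU.
have paE b : divides p b -> divides (p * a) b.
  move=> [c ->]; exists (c * a^-1); rewrite -mulrA [a^-1 * _]mulrC -mulrA.
  by rewrite mulrV // mulr1.
split=> // b c [x xE]; have : divides p (b * c).
  by rewrite xE mulrA mulrAC; apply: dvd_mull.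
by case/pM => /paE; [left | right].
Qed.

End PrimeProducts.

Section RingIso.
Variables (R S : idomainType) (f : {rmorphism R -> S}) (g : {rmorphism S -> R}).
Hypotheses (fK : cancel f g) (gK : cancel g f).

Lemma unit_iso a : (f a \is a GRing.unit) = (a \is a GRing.unit).
Proof.
apply/idP/idP => [|Ua]; last exact: rmorph_unit.
by move=> Ufa; rewrite -[a]fK; apply: rmorph_unit.
Qed.

Lemma prime_iso a : prime_elt a -> prime_elt (f a).
Proof.
move=> [a0 aU aM]; split.
- by rewrite -(rmorph0 f) (inj_eq (can_inj fK)).
- by rewrite unit_iso.
move=> b c /(dvd_rmorph g); rewrite fK rmorphM => /aM[] /(dvd_rmorph f).
  by rewrite gK; left.
by rewrite gK; right.
Qed.

Lemma prime_product_iso k a : prime_product k a -> prime_product k (f a).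
Proof.
elim=> [u Uu|{}k p {}a pp _ IH]; first by apply: PPunit; rewrite unit_iso.
by rewrite rmorphM; apply: PPmul => //; apply: prime_iso.
Qed.

Lemma factorial_iso : factorial_ring R -> factorial_ring S.
Proof.
move=> fR a a0; have /fR[k ppk] : g a != 0.
  by rewrite -(rmorph0 g) (inj_eq (can_inj gK)).
by exists k; rewrite -[a]gK; apply: prime_product_iso.
Qed.

End RingIso.

Section GaussPoly.
Variable R : idomainType.
Implicit Types f g h : {poly R}.

Lemma dvd_polyC (a : R) f : divides a%:P f <-> forall i, divides a f`_i.
Proof.
split=> [[g ->] i|]; first by rewrite mulrC coefCM; apply: dvd_mulr.
elim/poly_ind: f => [|f c IH] af; first exact: dvd0.
apply: dvdD; last first.
  by apply: (dvd_rmorph (@polyC R)); move: (af 0); rewrite coefD coefMX coefC add0r.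
apply/dvdMr/IH => i; move: (af i.+1).
by rewrite coefD coefMX coefC /= addr0.
Qed.

(** A prime that divides a product of two polynomials divides one of their
    constant terms; this term can be dropped and the factor divided by the
    variable, which makes the product smaller. *)
Lemma prime_polyC (p : R) : prime_elt p -> prime_elt p%:P.
Proof.
move=> [p0 pU pM]; split; rewrite ?polyC_eq0 //.
  by apply: contra pU; rewrite poly_unitE size_polyC p0 coefC.
suff H N f g : (size f + size g < N)%N -> divides p%:P (f * g) ->
    divides p%:P f \/ divides p%:P g by move=> f g; apply: (H _ _ _ (leqnn _)).
elim: N f g => // N IH f g.
have shrink f1 c g1 : (size (f1 * 'X + c%:P)%R + size g1 < N.+1)%N ->
    divides p c -> divides p%:P ((f1 * 'X + c%:P) * g1) ->
    divides p%:P (f1 * 'X + c%:P) \/ divides p%:P g1.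
  move=> szf pc pfg; have [f10|f10] := eqVneq f1 0.
    by left; rewrite f10 mul0r add0r; apply: (dvd_rmorph (@polyC R)).
  have szf1 : (size f1 < size (f1 * 'X + c%:P)%R)%N.
    by rewrite size_MXaddC (negPf f10).
  have pcP : divides p%:P c%:P by apply: (dvd_rmorph (@polyC R)).
  have : divides p%:P (f1 * g1).
    apply/dvd_polyC => i; move/dvd_polyC: (dvdB pfg (dvdMr g1 pcP)) => /(_ i.+1).
    by rewrite mulrDl addrK mulrAC coefMX.
  case/IH; [by lia | by move=> pf1; left; apply: dvdD => //; apply: dvdMr
    | by right].
elim/poly_ind: f => [|f c _]; first by left; apply: dvd0.
elim/poly_ind: g => [|g d _] ltN pfg; first by right; apply: dvd0.
have : divides p (c * d).
  move/dvd_polyC: (pfg) => /(_ 0).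
  by rewrite coefM big_ord1 !coefD !coefMX !coefC /= !add0r.
case/pM => [pc|pd]; first exact: shrink.
by rewrite mulrC in pfg; case: (shrink g d _ _ pd pfg); [rewrite addnC | right | left].
Qed.

Lemma prime_product_polyC k (c : R) :
  prime_product k c -> prime_product k c%:P.
Proof.
elim=> [u Uu|{}k p a pp _ IH]; first by apply: PPunit; apply: rmorph_unit.
by rewrite polyCM; apply: PPmul => //; apply: prime_polyC.
Qed.

Definition primitive_poly f := forall p : R, prime_elt p -> ~ divides p%:P f.

(** A prime that divides [f] divides its leading coefficient, so that only
    finitely many primes can be taken out. *)
Lemma primitive_part k f : prime_product k (lead_coef f) ->
  exists c f1, [/\ c != 0, f = c%:P * f1 & primitive_poly f1].
Proof.
elim: k f => [|k IH] f ppf.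
  exists 1, f; split; rewrite ?oner_neq0 ?mul1r // => p pp /dvd_polyC pf.
  by have [l [b []]] := prime_product_rem ppf pp (pf _).
have [pf|/not_ex_all_not npf] :=
  classic (exists p : R, prime_elt p /\ divides p%:P f); last first.
  exists 1, f; split; rewrite ?oner_neq0 ?mul1r // => p pp pf.
  by apply: (npf p).
have [p [pp [g gE]]] := pf; have [p0 _ _] := pp.
have lE : lead_coef f = lead_coef g * p by rewrite gE lead_coefM lead_coefC.
have [|l [b [[kl] bE ppb]]] := prime_product_rem ppf pp; first by exists (lead_coef g).
have /IH[c [f1 [c0 gE1 prf]]] : prime_product k (lead_coef g).
  rewrite kl; by move: bE; rewrite lE => /(mulIf p0) ->.
exists (p * c), f1; split=> //; first exact: mulf_neq0.
by rewrite gE gE1 polyCM; ring.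
Qed.

Hypothesis fR : factorial_ring R.

Lemma dvd_polyC_const (c : R) f : c != 0 -> divides f c%:P -> exists2 b, b != 0 & f = b%:P.
Proof.
move=> c0 fc; have [g gE] : exists g : {poly R}, c%:P = g * f by [].
have cP0 : c%:P != 0 by rewrite polyC_eq0.
have [g0 f0] : g != 0 /\ f != 0.
  by apply/andP; rewrite -negb_or -mulf_eq0 -gE.
have: size (g * f) = 1%N by rewrite -gE size_polyC c0.
rewrite size_mul // => sz1.
have /size_poly1P[b b0 ->] : size f == 1%N.
  have szg : (0 < size g)%N by rewrite size_poly_gt0.
  have szf : (0 < size f)%N by rewrite size_poly_gt0.
  by apply/eqP; lia.
by exists b.
Qed.

Lemma primitive_const (b : R) f : b != 0 -> primitive_poly f -> divides b%:P f ->
  b \is a GRing.unit.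
Proof.
move=> b0 prf bf; have [k ppb] := fR b0.
case: ppb bf => // {}k p a pp _ pf; case: (prf p pp).
by apply: dvd_trans pf; rewrite polyCM; apply: dvd_mulr.
Qed.

(** [f] divides a constant multiple of [g]. The primes of the constant do not
    divide the primitive [f], hence they divide the quotient and can be
    cancelled. *)
Lemma primitive_dvdp f g : primitive_poly f -> (f %| g)%R -> divides f g.
Proof.
move=> prf /Pdiv.Idomain.dvdpP[[c q] /= c0 E].
have [k ppc] := fR c0.
have {}E : c%:P * g = q * f by rewrite mul_polyC.
have [a [b [q' [f' [cE qE fE gE]]]]] :=
  prime_product_split (prime_product_polyC ppc) E.
have /(dvd_polyC_const c0)[b' b'0 bE] : divides b c%:P by rewrite cE; apply: dvd_mull.
have Ub : b' \is a GRing.unit.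
  by apply: (primitive_const b'0 prf); rewrite fE -bE; apply: dvd_mulr.
exists (q' * (b'^-1)%:P); rewrite gE fE bE -mulrA [_^-1%:P * _]mulrA -polyCM.
by rewrite mulVr // mul1r.
Qed.

(** Gauss: a primitive polynomial that has no factorization over the field of
    fractions is prime, and otherwise it splits into factors of smaller degree. *)
Lemma factorial_poly : factorial_ring {poly R}.
Proof.
suff H N f : (size f < N)%N -> f != 0 -> exists k, prime_product k f.
  by move=> f; apply: H (leqnn _).
elim: N f => // N IH f szf f0.
have [k ppl] : exists k, prime_product k (lead_coef f).
  by apply: fR; rewrite lead_coef_eq0.
have [c [f1 [c0 fE prf]]] := primitive_part ppl.
have [l ppc] := fR c0.
suff [m ppf1] : exists m, prime_product m f1.
  exists (l + m)%N; rewrite fE; apply: prime_productM => //.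
  exact: prime_product_polyC.
have f10 : f1 != 0 by apply: contraNneq f0 => f10; rewrite fE f10 mulr0.
have szE : size f = size f1 by rewrite fE size_Cmul.
have [sz1|sz1] := leqP (size f1) 1%N.
  have [b bE] : exists b, f1 = b%:P by exists f1`_0; apply: size1_polyC.
  have b0 : b != 0 by rewrite bE polyC_eq0 in f10.
  exists 0%N; apply: PPunit; rewrite bE; apply: rmorph_unit.
  by apply: (primitive_const b0 prf); rewrite bE; apply: dvd_refl.
have [[d [g [h [d0 szg szh E]]]]|noE] := classic (exists d g h,
    [/\ d != 0, (1 < size g)%N, (1 < size h)%N & d%:P * f1 = g * h]).
  have [k' ppd] := fR d0.
  have [a [b [g' [h' [dE gE hE f1E]]]]] :=
    prime_product_split (prime_product_polyC ppd) E.
  have /(dvd_polyC_const d0)[a' a'0 aE] : divides a d%:P by rewrite dE; apply: dvd_mulr.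
  have /(dvd_polyC_const d0)[b' b'0 bE] : divides b d%:P by rewrite dE; apply: dvd_mull.
  have szg' : size g' = size g by rewrite gE aE size_Cmul.
  have szh' : size h' = size h by rewrite hE bE size_Cmul.
  have g'0 : g' != 0 by rewrite -size_poly_gt0; lia.
  have h'0 : h' != 0 by rewrite -size_poly_gt0; lia.
  have szM : size f1 = (size g + size h).-1 by rewrite f1E size_mul // szg' szh'.
  have [kg ppg] : exists k, prime_product k g' by apply: IH => //; lia.
  have [kh pph] : exists k, prime_product k h' by apply: IH => //; lia.
  by exists (kg + kh)%N; rewrite f1E; apply: prime_productM.
have primef1 : prime_elt f1.
  split=> //.
    by rewrite poly_unitE; apply/negP => /andP[/eqP sz _]; rewrite sz in sz1.
  move=> a b [x xE].
  have f1ab : (f1 %| a * b)%R by rewrite xE; apply: dvdp_mull.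
  have /Pdiv.Idomain.dvdpP[[d q] /= d0 E] := dvdp_gcdl f1 a.
  have g0 : gcdp f1 a != 0 by rewrite gcdp_eq0 negb_and f10.
  have [szg|szg] := leqP (size (gcdp f1 a)) 1%N.
    right; apply: primitive_dvdp => //; rewrite -(Gauss_dvdpr _ (q := a)) //.
    by rewrite coprimep_def eqn_leq szg size_poly_gt0.
  left; apply: primitive_dvdp => //; apply: dvdp_trans (dvdp_gcdr f1 a).
  have [szq|szq] := leqP (size q) 1%N; last first.
    by case: noE; exists d, q, (gcdp f1 a); split=> //; rewrite mul_polyC.
  have q0 : q != 0.
    apply: contraNneq f10 => q0; rewrite -size_poly_eq0 -(size_scale f1 d0) E.
    by rewrite q0 mul0r size_poly0.
  have qE : q = (q`_0)%:P by apply: size1_polyC.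
  apply/Pdiv.Idomain.dvdpP; exists (q`_0, d%:P); last first.
    by rewrite /= mul_polyC E -mul_polyC -qE.
  by apply: contraNneq q0 => /= q00; rewrite qE q00.
by exists 1%N; rewrite -[f1]mulr1; apply: PPmul => //; apply: PPunit; apply: unitr1.
Qed.

End GaussPoly.

Section MpolyMorphisms.

Lemma mpoly_rmorph_ext n (R S : comNzRingType)
    (f g : {rmorphism {mpoly R[n]} -> S}) :
  (forall c, f c%:MP = g c%:MP) -> (forall i, f 'X_i = g 'X_i) -> f =1 g.
Proof.
move=> fgC fgX p; rewrite (mpolyE p) !rmorph_sum; apply: eq_bigr => m _.
rewrite -mul_mpolyC !rmorphM fgC; congr (_ * _).
rewrite mpolyXE_id !rmorph_prod; apply: eq_bigr => i _.
by rewrite !rmorphXn fgX.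
Qed.

Lemma muniX_widen n (R : comNzRingType) (i : 'I_n) :
  muni ('X_(widen_ord (leqnSn n) i) : {mpoly R[n.+1]}) = ('X_i)%:P.
Proof.
rewrite /muni mmapX mmap1U; case: splitP => [j /= ij|k /= iE].
  by congr ('X_ _)%:P; apply/val_inj.
by have := ltn_ord i; rewrite iE -ltn_subRL subnn.
Qed.

Lemma muniX_max n (R : comNzRingType) :
  muni ('X_ord_max : {mpoly R[n.+1]}) = 'X.
Proof.
rewrite /muni mmapX mmap1U; case: splitP => // j /= jE.
by have := ltn_ord j; rewrite -jE ltnn.
Qed.

(** The inverse of [muni]. *)
Definition mmulti_eval n (R : comNzRingType) (p : {poly {mpoly R[n]}}) :
    {mpoly R[n.+1]} := horner_eval 'X_ord_max (map_poly (@mwiden n R) p).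

HB.instance Definition _ n (R : comNzRingType) :=
  GRing.RMorphism.copy (@mmulti_eval n R)
    (horner_eval 'X_ord_max \o map_poly (@mwiden n R)).

Lemma mmulti_evalC n (R : comNzRingType) (p : {mpoly R[n]}) :
  mmulti_eval p%:P = mwiden p.
Proof. by rewrite /mmulti_eval map_polyC /horner_eval hornerC. Qed.

Lemma mmulti_evalX n (R : comNzRingType) :
  mmulti_eval ('X : {poly {mpoly R[n]}}) = 'X_ord_max.
Proof. by rewrite /mmulti_eval map_polyX /horner_eval hornerX. Qed.

Lemma muni_can n (R : comNzRingType) : cancel (@muni n R) (@mmulti_eval n R).
Proof.
apply: (mpoly_rmorph_ext (f := @mmulti_eval n R \o @muni n R) (g := idfun)) => [c|i] /=.
  by rewrite muniC mmulti_evalC mwidenC.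
have [lt_in|ge_in] := ltnP i n.
  have -> : i = widen_ord (leqnSn n) (Ordinal lt_in) by apply: val_inj.
  by rewrite muniX_widen mmulti_evalC mwidenX mnmwiden1.
have -> : i = ord_max by apply: val_inj; apply/eqP; rewrite eqn_leq ge_in -ltnS ltn_ord.
by rewrite muniX_max mmulti_evalX.
Qed.

Lemma mmulti_eval_can n (R : comNzRingType) : cancel (@mmulti_eval n R) (@muni n R).
Proof.
move=> p; elim/poly_ind: p => [|p c IH]; first by rewrite !rmorph0.
rewrite 2!rmorphD 2!rmorphM /= mmulti_evalX muniX_max.
rewrite IH mmulti_evalC; congr (_ + _).
suff H : @muni n R \o @mwiden n R =1 @polyC _ by apply: H.
apply: (mpoly_rmorph_ext (f := @muni n R \o @mwiden n R)) => [d|i] /=.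
  by rewrite mwidenC muniC.
by rewrite mwidenX mnmwiden1 muniX_widen.
Qed.

End MpolyMorphisms.

Lemma factorial_mpoly (R : idomainType) n :
  factorial_ring R -> factorial_ring {mpoly R[n]}.
Proof.
move=> fR; elim: n => [|n IH].
  by apply: (factorial_iso (f := @mpolyC 0 R) (g := @mcoeff 0 R 0%MM));
    [exact: mpolyCK | exact: mpolyKC | exact: fR].
have H := @factorial_iso {poly {mpoly R[n]}} {mpoly R[n.+1]} (@mmulti_eval n R)
  (@muni n R) (@mmulti_eval_can n R) (@muni_can n R).
by apply: H; apply: factorial_poly.
Qed.

Lemma prime_mpolyC (R : idomainType) n (p : R) :
  prime_elt p -> prime_elt (p%:MP : {mpoly R[n]}).
Proof.
move=> pp; elim: n => [|n IH].
  by apply: (prime_iso (f := @mpolyC 0 R) (g := @mcoeff 0 R 0%MM)) pp;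
    [exact: mpolyCK | exact: mpolyKC].
have E : @mmulti_eval n R (p%:MP)%:P = p%:MP by rewrite mmulti_evalC mwidenC.
rewrite -E; apply: (@prime_iso {poly {mpoly R[n]}} {mpoly R[n.+1]} (@mmulti_eval n R)
  (@muni n R) (@mmulti_eval_can n R) (@muni_can n R)).
exact: prime_polyC.
Qed.

Lemma prime_product_mpolyC (R : idomainType) n k (c : R) :
  prime_product k c -> prime_product k (c%:MP : {mpoly R[n]}).
Proof.
elim=> [u Uu|{}k p a pp _ IH]; first by apply: PPunit; apply: rmorph_unit.
by rewrite mpolyCM; apply: PPmul => //; apply: prime_mpolyC.
Qed.

Lemma factorial_field (F : fieldType) : factorial_ring F.
Proof. by move=> a a0; exists 0%N; apply: PPunit; rewrite unitfE. Qed.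

(** * Polynomials over a field and field extensions *)

Section FieldMpoly.
Variables (F : fieldType) (n : nat).
Implicit Types p q r : {mpoly F[n]}.

Lemma msize_gt0 p : (0 < msize p)%N = (p != 0).
Proof. by rewrite lt0n msize_poly_eq0. Qed.

Lemma msize_mulE p q : p != 0 -> q != 0 ->
  [/\ (0 < msize p)%N, (0 < msize q)%N & (msize (p * q) = (msize p + msize q).-1)%N].
Proof. by move=> p0 q0; rewrite !msize_gt0 msizeM. Qed.

Lemma mulf_neq0E p q : p * q != 0 -> p != 0 /\ q != 0.
Proof. by rewrite mulf_eq0 negb_or => /andP. Qed.

Lemma mpoly_unitE p : (p \is a GRing.unit) = (msize p == 1%N).
Proof.
apply/idP/eqP => [/unitrPr[q E]|/eqP/msize_poly1P[c c0 ->]]; last first.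
  by apply: rmorph_unit; rewrite unitfE.
have {}E : p * (q : {mpoly F[n]}) = 1 by [].
have /mulf_neq0E[p0 q0] : p * q != 0 by rewrite E oner_neq0.
by have [] := msize_mulE p0 q0; rewrite E msize1; lia.
Qed.

Lemma nonconstantE p : nonconstant p <-> p != 0 /\ p \isn't a GRing.unit.
Proof.
rewrite mpoly_unitE -msize_gt0 /nonconstant; split=> [|[]]; last by lia.
by move=> h; split; lia.
Qed.

Lemma nonconstant_neq0 p : nonconstant p -> p != 0.
Proof. by case/nonconstantE. Qed.

Lemma msize_dvd p q : q != 0 -> divides p q -> (msize p <= msize q)%N.
Proof.
move=> q0 [r E]; have {}E : q = (r : {mpoly F[n]}) * p by [].
have /mulf_neq0E[r0 p0] : r * p != 0 by rewrite -E.
by have [] := msize_mulE r0 p0; rewrite -E; lia.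
Qed.

Lemma msize_mul_lt p q : nonconstant q -> p != 0 -> (msize p < msize (p * q)%R)%N.
Proof.
move=> qn p0; have [] := msize_mulE p0 (nonconstant_neq0 qn).
by move: qn; rewrite /nonconstant; lia.
Qed.

Lemma mirreducible_prime p : mirreducible p -> prime_elt p.
Proof.
move=> [/nonconstantE[p0 pU] irr].
apply: factorial_irreducible_prime => //.
  exact/factorial_mpoly/factorial_field.
move=> b c E; apply: NNPP => /not_or_and[/negP bU /negP cU].
have /mulf_neq0E[b0 c0] : b * c != 0 by rewrite -E.
by apply: irr; exists b, c; split=> //; apply/nonconstantE.
Qed.

Lemma mpoly_Euclid p q r : p != 0 -> (forall d, divides d p -> divides d r -> ~ nonconstant d) ->
  divides p (q * r) -> divides p q.
Proof.
move=> p0 cop; apply: factorial_Euclid => //.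
  exact/factorial_mpoly/factorial_field.
move=> d dp dr; apply: NNPP => /negP dU; apply: (cop d) => //.
by apply/nonconstantE; split=> //; apply: contraNneq p0 => d0;
  case: dp => x ->; rewrite d0 mulr0.
Qed.

Lemma dvdZ c p q : c != 0 -> divides p q -> divides (c *: p) q.
Proof.
by move=> c0 [r ->]; exists (c^-1 *: r); rewrite -scalerAl -scalerAr scalerA mulVf // scale1r.
Qed.

Lemma dvd_msize_scale p q : q != 0 -> divides p q -> (msize q <= msize p)%N ->
  exists2 c, c != 0 & q = c *: p.
Proof.
move=> q0 [r E] sz; have {}E : q = (r : {mpoly F[n]}) * p by [].
have /mulf_neq0E[r0 p0] : r * p != 0 by rewrite -E.
have [szr szp szq] := msize_mulE r0 p0.
have /msize_poly1P[c c0 rE] : msize (r : {mpoly F[n]}) == 1%N.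
  by rewrite -E in szq; apply/eqP; lia.
by exists c => //; rewrite E rE mul_mpolyC.
Qed.

End FieldMpoly.

Section FieldMap.
Variables (k M : fieldType) (i : {rmorphism k -> M}) (n : nat).
Implicit Types p q : {mpoly k[n]}.

Lemma map_mpoly_inj : injective (map_mpoly i : {mpoly k[n]} -> {mpoly M[n]}).
Proof.
move=> p q /mpolyP E; apply/mpolyP => m; move: (E m).
by rewrite !mcoeff_map_mpoly => /fmorph_inj.
Qed.

Lemma msize_map_mpoly p : msize (map_mpoly i p) = msize p.
Proof.
by rewrite !mmeasureE; apply/perm_big/msupp_map_mpoly/fmorph_inj.
Qed.

Lemma map_mpoly_eq0 p : (map_mpoly i p == 0) = (p == 0).
Proof. by rewrite -!msize_poly_eq0 msize_map_mpoly. Qed.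

Lemma nonconstant_map p : nonconstant (map_mpoly i p) <-> nonconstant p.
Proof. by rewrite /nonconstant msize_map_mpoly. Qed.

Lemma meval_map p (v : 'I_n -> k) : (map_mpoly i p).@[fun j => i (v j)] = i p.@[v].
Proof.
pose f := meval (fun j => i (v j)) \o map_mpoly i; pose g := i \o meval v.
apply: (mpoly_rmorph_ext (f := f) (g := g)) => [c|j]; rewrite /f /g /=.
  by rewrite map_mpolyC !mevalC.
by rewrite map_mpolyX !mevalXU.
Qed.

(** The cokernel of [P] is defined over [k], so that membership in its row
    space is a system of equations over [k], in which the independent
    coefficients can be separated. *)
Lemma submx_descend (s r N : nat) (c : 'rV[M]_s) (v : 'M[k]_(s, N)) (P : 'M[k]_(r, N)) :
  (forall e : 'cV[k]_s, c *m map_mx i e = 0 -> e = 0) ->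
  (c *m map_mx i v <= map_mx i P)%MS -> (v <= P)%MS.
Proof.
move=> indep; rewrite !submxE -map_cokermx -mulmxA -map_mxM => /eqP E.
apply/eqP/matrixP => a b; set w := v *m _ in E *.
have /indep/matrixP/(_ a 0) : c *m map_mx i (col b w) = 0.
  by rewrite colE map_mxM mulmxA E mul0mx.
by rewrite !mxE.
Qed.

(** The solution space of a linear system over [k] is defined over [k]; here
    the system compares coefficients up to a bound on the degrees. *)
Lemma span_descend (J : finType) (p : J -> {mpoly k[n]}) (s : nat)
    (a : 'I_s -> {mpoly k[n]}) (c : 'I_s -> M) (b : J -> M) :
  (forall e : 'I_s -> k, \sum_l c l * i (e l) = 0 -> forall l, e l = 0) ->
  \sum_l c l *: map_mpoly i (a l) = \sum_j b j *: map_mpoly i (p j) ->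
  forall l, exists b', a l = \sum_j b' j *: p j.
Proof.
move=> indep E.
pose d := (\sum_l msize (a l) + \sum_j msize (p j))%N.
have szp j : (msize (p j) <= d)%N.
  by apply: leq_trans (leq_addl _ _); rewrite (bigD1 j) //= leq_addr.
have sza l : (msize (a l) <= d)%N.
  by apply: leq_trans (leq_addr _ _); rewrite (bigD1 l) //= leq_addr.
pose N := #|{: 'X_{1..n < d}}|.
pose v := \matrix_(l < s, x < N) (a l)@_(val (enum_val x)).
pose P := \matrix_(j < #|J|, x < N) (p (enum_val j))@_(val (enum_val x)).
have /row_subP vP : (v <= P)%MS.
  apply: (@submx_descend _ _ _ (\row_l c l)) => [e|].
    move=> /rowP/(_ 0); rewrite !mxE => ce.
    have /indep e0 : \sum_l c l * i (e l 0) = 0.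
      by rewrite -[RHS]ce; apply: eq_bigr => l _; rewrite !mxE.
    by apply/colP => l; rewrite e0 mxE.
  apply/submxP; exists (\row_j b (enum_val j)); apply/rowP => x.
  have /mpolyP/(_ (val (enum_val x))) := E; rewrite !raddf_sum /= => Ex.
  rewrite !mxE; transitivity (\sum_l (c l *: map_mpoly i (a l))@_(val (enum_val x))).
    by apply: eq_bigr => l _; rewrite !mxE mcoeffZ mcoeff_map_mpoly.
  rewrite Ex (reindex _ (onW_bij _ (enum_val_bij _))) /=.
  by apply: eq_bigr => j _; rewrite !mxE mcoeffZ mcoeff_map_mpoly.
move=> l; have /submxP[D DE] := vP l.
exists (fun j => D 0 (enum_rank j)); apply/mpolyP => m; rewrite raddf_sum /=.
have [lt_m|ge_m] := ltnP (mdeg m) d; last first.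
  rewrite memN_msupp_eq0 ?big1 // => [j _|]; last exact/msize_mdeg_ge/(leq_trans (sza l)).
  by rewrite mcoeffZ memN_msupp_eq0 ?mulr0 //; apply/msize_mdeg_ge/(leq_trans (szp j)).
move/rowP/(_ (enum_rank (BMultinom lt_m))): DE; rewrite !mxE enum_rankK /= => ->.
rewrite [RHS](reindex _ (onW_bij _ (enum_val_bij _))) /=.
by apply: eq_bigr => j _; rewrite !mxE mcoeffZ enum_rankK enum_valK.
Qed.

Lemma mul_mpolyw (A H : {mpoly M[n]}) d : (msize H <= d)%N ->
  H * A = \sum_(m : 'X_{1..n < d}) H@_m *: (A * 'X_[m]).
Proof.
move=> szH; rewrite {1}(mpolywE szH) mulr_suml.
by apply: eq_bigr => m _; rewrite -scalerAl mulrC.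
Qed.

(** The multiples of [A] up to a given degree form a space that is spanned
    over [k]. *)
Lemma dvd_descend_sum (s : nat) (A : {mpoly k[n]})
    (a : 'I_s -> {mpoly k[n]}) (c : 'I_s -> M) :
  (forall e : 'I_s -> k, \sum_l c l * i (e l) = 0 -> forall l, e l = 0) ->
  divides (map_mpoly i A) (\sum_l c l *: map_mpoly i (a l)) -> forall l, divides A (a l).
Proof.
move=> indep [H E] l.
pose p (m : 'X_{1..n < msize H}) := A * 'X_[m].
have [|b' ->] := @span_descend _ p _ a c (fun m => H@_m) indep _ l.
  rewrite E (mul_mpolyw _ (leqnn _)); apply: eq_bigr => m _.
  by rewrite rmorphM /= map_mpolyX.
by apply: dvd_sum => m _; exists (b' m *: 'X_[m]); rewrite /p mulrC scalerAl.
Qed.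

Lemma dvd_descend (A B : {mpoly k[n]}) :
  divides (map_mpoly i A) (map_mpoly i B) -> divides A B.
Proof.
move=> AB; apply: (@dvd_descend_sum 1%N A (fun=> B) (fun=> 1) _ _ 0).
  move=> e; rewrite big_ord1 mul1r => /eqP; rewrite fmorph_eq0 => /eqP e0 l.
  by rewrite ord1.
by rewrite big_ord1 scale1r.
Qed.

(** The coefficients [1] and [- t] are independent over [k]. *)
Lemma dvd_descend_pair t (A B C : {mpoly k[n]}) : (forall e, t != i e) ->
  divides (map_mpoly i A) (map_mpoly i B - t *: map_mpoly i C) -> divides A B /\ divides A C.
Proof.
move=> tN ABC.
have H := @dvd_descend_sum 2%N A (fun l => if l == 0 then B else C)
  (fun l => if l == 0 then 1 else - t) _ _.
split; [apply: (H _ _ 0) | apply: (H _ _ 1)] => [e||e|];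
  rewrite ?big_ord_recl ?big_ord0 /= ?scale1r ?addr0 ?scaleNr //.
all: rewrite mul1r mulNr => /eqP; rewrite subr_eq0 => /eqP E.
all: have e1 : e (lift ord0 ord0) = 0 by
  apply: contraNeq (tN (e ord0 / e (lift ord0 ord0))) => e1;
  rewrite fmorph_div E mulfK // fmorph_eq0.
all: move: E; rewrite e1 rmorph0 mulr0 => /eqP; rewrite fmorph_eq0 => /eqP e0.
all: by case=> [[|[|//]]] lt_l; [rewrite -[RHS]e0 | rewrite -[RHS]e1]; congr e; apply: val_inj.
Qed.

End FieldMap.

(** * Extending field embeddings *)

Lemma fracE (R : idomainType) (x : {fraction R}) :
  exists a b, b != 0 /\ x = tofrac a / tofrac b.
Proof.
rewrite -[x]reprK; set r := repr x; exists (frac r).1, (frac r).2.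
have d0 : (frac r).2 != 0 by apply: denom_ratioP.
split=> //; apply: (canRL (mulfK _)); first by rewrite tofrac_eq0.
unlock FracField.tofrac; rewrite -[LHS]FracField.pi_mul; apply/eqP.
rewrite FracField.equivf_def /FracField.mulf /=.
by rewrite !numden_Ratio ?oner_neq0 ?mulr1 ?mulf_neq0 // mulrC.
Qed.

Lemma frac_lift (R : idomainType) (M : fieldType) (f : {rmorphism R -> M}) :
  injective f -> exists g : {rmorphism {fraction R} -> M}, forall a, g (tofrac a) = f a.
Proof.
move=> f_inj; have f0 a : a != 0 -> f a != 0 by rewrite -(rmorph0 f) (inj_eq f_inj).
pose g (x : {fraction R}) := f (frac (repr x)).1 / f (frac (repr x)).2.
have gE a b : b != 0 -> g (tofrac a / tofrac b) = f a / f b.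
  move=> b0; set x := tofrac a / tofrac b.
  have d0 : (frac (repr x)).2 != 0 by apply: denom_ratioP.
  have xE : x = tofrac (frac (repr x)).1 / tofrac (frac (repr x)).2.
    rewrite -[LHS]reprK; apply: (canRL (mulfK _)); first by rewrite tofrac_eq0.
    unlock FracField.tofrac; rewrite -[LHS]FracField.pi_mul; apply/eqP.
    rewrite FracField.equivf_def /FracField.mulf /=.
    by rewrite !numden_Ratio ?oner_neq0 ?mulr1 ?mulf_neq0 // mulrC.
  apply/eqP; rewrite /g eqr_div ?f0 // -!rmorphM; apply/eqP; congr (f _).
  apply/eqP; rewrite -tofrac_eq !rmorphM -eqr_div ?tofrac_eq0 //.
  by rewrite -xE.
have gB : zmod_morphism g.
  move=> x y; have [a [b [b0 ->]]] := fracE x; have [c [d [d0 ->]]] := fracE y.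
  rewrite -mulNr addf_div ?tofrac_eq0 // -!rmorphN -!rmorphM -rmorphD !gE ?mulf_neq0 //.
  by rewrite rmorphD !rmorphM rmorphN -addf_div ?f0 // mulNr.
have gM : monoid_morphism g.
  split=> [|x y].
    by rewrite -[1](mulfV (oner_neq0 _)) -(rmorph1 (@tofrac R)) gE ?oner_neq0 // rmorph1 divr1.
  have [a [b [b0 ->]]] := fracE x; have [c [d [d0 ->]]] := fracE y.
  by rewrite mulf_div -!rmorphM !gE ?mulf_neq0 // !rmorphM mulf_div.
pose gA := GRing.isZmodMorphism.Build _ _ g gB.
pose gMM := GRing.isMonoidMorphism.Build _ _ g gM.
pose G : {rmorphism {fraction R} -> M} := HB.pack g gA gMM.
by exists G => a; rewrite -[tofrac a]divr1 -(rmorph1 (@tofrac R)) /= gE ?oner_neq0 // rmorph1 divr1.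
Qed.

Section MinPoly.
Variables (E L : fieldType) (j : {rmorphism E -> L}).

Lemma algebraic_min_poly (a : L) : algebraicOver j a ->
  exists p : {poly E}, [/\ p \is monic, irreducible_poly p, root (map_poly j p) a
    & forall q, root (map_poly j q) a -> p %| q].
Proof.
move=> [p0 p0N0 p0a].
have [N [p [p_neq0 pa szp] minN]] : exists2 N, (exists p : {poly E},
    [/\ p != 0, root (map_poly j p) a & size p = N]) &
  forall q : {poly E}, q != 0 -> root (map_poly j q) a -> (N <= size q)%N.
  have [N] := ubnP (size p0); elim: N p0 p0N0 p0a => // N IH p0 p0N0 p0a ltN.
  have [[q [q0 qa ltq]]|noq] := classic (exists q : {poly E},
      [/\ q != 0, root (map_poly j q) a & (size q < size p0)%N]).
    by apply: (IH q) => //; apply: leq_trans ltq _.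
  exists (size p0); first by exists p0.
  by move=> q q0 qa; rewrite leqNgt; apply/negP => ltq; apply: noq; exists q.
wlog mp : p p_neq0 pa szp / p \is monic.
  have lc0 : (lead_coef p)^-1 != 0 by rewrite invr_eq0 lead_coef_eq0.
  move=> H; apply: (H ((lead_coef p)^-1 *: p)); last first.
  - by rewrite monicE lead_coefZ mulVf // lead_coef_eq0.
  - by rewrite size_scale.
  - by rewrite /root map_polyZ hornerZ (rootP pa) mulr0.
  - by rewrite -size_poly_eq0 size_scale // size_poly_eq0.
have dvdpq q : root (map_poly j q) a -> p %| q.
  move=> qa; rewrite /dvdp; apply/contraT => r0.
  have := minN _ r0; rewrite leqNgt -szp ltn_modp p_neq0; apply.
  move: qa; rewrite {1}(divp_eq q p) /root rmorphD rmorphM hornerD hornerM.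
  by rewrite (rootP pa) mulr0 add0r.
exists p; split=> //; split.
  rewrite ltnNge; apply/negP => sz1; move: (pa).
  rewrite (size1_polyC sz1) map_polyC rootC fmorph_eq0 => /eqP p00.
  by move: p_neq0; rewrite (size1_polyC sz1) p00 eqxx.
move=> q szq qp; have [r pE] : exists r : {poly E}, p = r * q by apply/dvdpP.
have /andP[r0 q0] : (r != 0) && (q != 0) by rewrite -negb_or -mulf_eq0 -pE.
have := pa; rewrite pE rmorphM rootM => /orP[ra|qa]; last first.
  by rewrite /eqp -pE dvdpq // pE dvdp_mull.
have := minN _ r0 ra; rewrite -szp pE size_mul //.
have szr0 : (0 < size r)%N by rewrite size_poly_gt0.
have szq0 : (0 < size q)%N by rewrite size_poly_gt0.
have szq1 : size q <> 1%N by apply/eqP; exact: szq.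
have arith (x y : nat) : ((x + y).-1 <= x)%N -> (0 < x)%N -> (0 < y)%N -> y <> 1%N ->
  False by lia.
by move=> h; case: (arith _ _ h szr0 szq0 szq1).
Qed.

Lemma qfpoly_eval (p : {poly E}) (pI : monic_irreducible_poly p) a :
  root (map_poly j p) a -> exists J : {rmorphism {poly %/ p with pI} -> L},
    forall q, J (in_qpoly p q) = (map_poly j q).[a].
Proof.
move=> pa; pose J (x : {poly %/ p with pI}) := (map_poly j (val x)).[a].
have JE q : (map_poly j (Pdiv.CommonRing.rmodp q (mk_monic p))).[a] = (map_poly j q).[a].
  rewrite mk_monicE // [in RHS](Pdiv.RingMonic.rdivp_eq (snd pI) q).
  by rewrite rmorphD rmorphM hornerD hornerM (rootP pa) mulr0 add0r.
have JB : zmod_morphism J.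
  move=> x y; rewrite /J (_ : val (x - y) = (val x : {poly E}) - val y) //.
  by rewrite rmorphB hornerD hornerN.
have JM : monoid_morphism J.
  split=> [|x y]; last by rewrite /J /= JE rmorphM hornerM.
    transitivity (map_poly j 1%:P).[a]; first by [].
    by rewrite map_polyC hornerC; exact: rmorph1.
pose JA := GRing.isZmodMorphism.Build _ _ J JB.
pose JMM := GRing.isMonoidMorphism.Build _ _ J JM.
pose JJ : {rmorphism {poly %/ p with pI} -> L} := HB.pack J JA JMM.
by exists JJ => q /=; rewrite /J /= JE.
Qed.

End MinPoly.

(** Both embeddings extend to the field [E[X] / (p)], in which the class of
    [X] goes to either of the given roots. *)
Lemma hom_step (E L M : fieldType) (j : {rmorphism E -> L}) (i : {rmorphism E -> M})
    (p : {poly E}) a b : p \is monic -> irreducible_poly p ->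
  root (map_poly j p) a -> root (map_poly i p) b ->
  exists (E1 : fieldType) (e : {rmorphism E -> E1}) (j1 : {rmorphism E1 -> L})
      (i1 : {rmorphism E1 -> M}) (x : E1),
    [/\ forall c, j1 (e c) = j c, forall c, i1 (e c) = i c, j1 x = a & i1 x = b].
Proof.
move=> mp ip pa pb; pose pI : monic_irreducible_poly p := (ip, mp).
have [J JE] := qfpoly_eval pI pa; have [I IE] := qfpoly_eval pI pb.
pose e : {rmorphism E -> {poly %/ p with pI}} := in_qpoly p \o polyC.
exists {poly %/ p with pI}, e, J, I, (in_qpoly p 'X); rewrite /e /=; split=> [c|c||].
- by rewrite JE map_polyC hornerC.
- by rewrite IE map_polyC hornerC.
- by rewrite JE map_polyX hornerX.
- by rewrite IE map_polyX hornerX.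
Qed.

(** The elements are adjoined one at a time, the root of the minimal
    polynomial in [M] being chosen freely; the tower that results plays the
    role of the field generated by [s]. *)
Lemma hom_extend (L : fieldType) (M : closedFieldType) (s : seq L)
    (E : fieldType) (j : {rmorphism E -> L}) (i : {rmorphism E -> M}) :
  (forall a, a \in s -> algebraicOver j a) ->
  exists (E1 : fieldType) (e : {rmorphism E -> E1}) (j1 : {rmorphism E1 -> L})
      (i1 : {rmorphism E1 -> M}),
    [/\ forall c, j1 (e c) = j c, forall c, i1 (e c) = i c
      & forall a, a \in s -> exists x, j1 x = a].
Proof.
elim: s E j i => [|a s IH] E j i alg; first by exists E, idfun, j, i; split.
have [p [mp ip pa _]] := algebraic_min_poly (alg a (mem_head a s)).
have [b pb] : exists b, root (map_poly i p) b.
  by apply/closed_rootP; rewrite size_map_poly; case: ip => /gtn_eqF ->.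
have [E1 [e [j1 [i1 [x [jE iE xa _]]]]]] := hom_step mp ip pa pb.
have alg1 a' : a' \in s -> algebraicOver j1 a'.
  move=> a's; have [|q q0 qa] := alg a'; first by rewrite inE a's orbT.
  exists (map_poly e q); first by rewrite map_poly_eq0.
  by rewrite -map_poly_comp (eq_map_poly (g := j)).
have [E2 [e2 [j2 [i2 [jE2 iE2 im2]]]]] := IH E1 j1 i1 alg1.
exists E2, (e2 \o e), j2, i2; split=> [c|c|a'] /=.
- by rewrite jE2 jE.
- by rewrite iE2 iE.
rewrite inE => /predU1P[->|/im2//]; exists (e2 x); by rewrite jE2.
Qed.

Lemma lift_mpoly (E L : fieldType) (j : {rmorphism E -> L}) n (A : {mpoly L[n]}) :
  (forall m, exists x, j x = A@_m) -> exists A', map_mpoly j A' = A.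
Proof.
move=> liftA; rewrite [A]mpolyE; apply: (big_ind (fun q => exists A', map_mpoly j A' = q)) => [|p q [p' <-] [q' <-]|m _].
- by exists 0; rewrite rmorph0.
- by exists (p' + q'); rewrite rmorphD.
have [x <-] := liftA m; exists (x *: 'X_[m]).
by rewrite map_mpolyZ map_mpolyX.
Qed.

Lemma map_mpoly_map (A B C : comNzRingType) (f : {rmorphism A -> B})
    (g : {rmorphism B -> C}) (h : {rmorphism A -> C}) n (p : {mpoly A[n]}) :
  (forall c, g (f c) = h c) -> map_mpoly g (map_mpoly f p) = map_mpoly h p.
Proof. by move=> fgh; apply/mpolyP => m; rewrite !mcoeff_map_mpoly; exact: fgh. Qed.

(** The finitely many coefficients of the two factors lie in an algebraic
    extension of [E], which embeds into [M]. *)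
Lemma factorization_transfer (E L : fieldType) (M : closedFieldType) n
    (j : {rmorphism E -> L}) (i : {rmorphism E -> M}) (F : {mpoly E[n]})
    (A B : {mpoly L[n]}) :
  (forall a, algebraicOver j a) -> map_mpoly j F = A * B ->
  exists (E1 : fieldType) (e : {rmorphism E -> E1}) (j1 : {rmorphism E1 -> L})
      (i1 : {rmorphism E1 -> M}) (A1 B1 : {mpoly E1[n]}),
    [/\ (forall c, j1 (e c) = j c) /\ (forall c, i1 (e c) = i c),
      map_mpoly j1 A1 = A, map_mpoly j1 B1 = B
    & map_mpoly i F = map_mpoly i1 A1 * map_mpoly i1 B1].
Proof.
move=> alg FE.
pose s := [seq A@_m | m <- msupp A] ++ [seq B@_m | m <- msupp B].
have [E1 [e [j1 [i1 [jE iE im]]]]] := hom_extend i (s := s) (fun a _ => alg a).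
have [A1 A1E] : exists A1, map_mpoly j1 A1 = A.
  apply: lift_mpoly => m; have [mA|/memN_msupp_eq0 ->] := boolP (m \in msupp A).
    by apply: im; rewrite mem_cat (map_f (fun m => A@_m)).
  by exists 0; rewrite rmorph0.
have [B1 B1E] : exists B1, map_mpoly j1 B1 = B.
  apply: lift_mpoly => m; have [mB|/memN_msupp_eq0 ->] := boolP (m \in msupp B).
    by apply: im; rewrite mem_cat (map_f (fun m => B@_m)) ?orbT.
  by exists 0; rewrite rmorph0.
exists E1, e, j1, i1, A1, B1; split=> //.
rewrite -rmorphM -(map_mpoly_map F iE); congr (map_mpoly i1 _).
by apply: (@map_mpoly_inj _ _ j1); rewrite rmorphM /= A1E B1E (map_mpoly_map F jE).
Qed.

Lemma reducible_transfer (E L : fieldType) (M : closedFieldType) n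
    (j : {rmorphism E -> L}) (i : {rmorphism E -> M}) (F : {mpoly E[n]}) :
  (forall a, algebraicOver j a) ->
  mreducible (map_mpoly j F) -> mreducible (map_mpoly i F).
Proof.
move=> alg [A [B [nA nB FE]]].
have [E1 [e [j1 [i1 [A1 [B1 [_ AE BE ->]]]]]]] := factorization_transfer i alg FE.
exists (map_mpoly i1 A1), (map_mpoly i1 B1); split=> //; apply/nonconstant_map.
  by apply/(nonconstant_map j1); rewrite AE.
by apply/(nonconstant_map j1); rewrite BE.
Qed.

(** * Coefficients of factors are algebraic *)

Definition kronecker_exp n N (m : 'X_{1..n}) : nat := \sum_(i < n) m i * N ^ i.

Definition kronecker (R : comNzRingType) n N : {mpoly R[n]} -> {poly R} :=
  mmap (@polyC R) (fun i : 'I_n => 'X^(N ^ i)).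

HB.instance Definition _ (R : comNzRingType) n N :=
  GRing.RMorphism.copy (@kronecker R n N) (mmap (@polyC R) (fun i : 'I_n => 'X^(N ^ i))).

Lemma digits_inj N n (a b : 'I_n -> nat) :
  (forall i, a i < N)%N -> (forall i, b i < N)%N ->
  (\sum_(i < n) a i * N ^ i = \sum_(i < n) b i * N ^ i)%N -> a =1 b.
Proof.
elim: n a b => [|n IH] a b aN bN E i; first by case: i.
move: E; rewrite !big_ord_recl /= !expn0 !muln1.
have shift (c : 'I_n.+1 -> nat) : (\sum_(i < n) c (lift ord0 i) * N ^ bump 0 i =
    (\sum_(i < n) c (lift ord0 i) * N ^ i) * N)%N.
  by rewrite big_distrl; apply: eq_bigr => j _; rewrite /bump add1n expnSr mulnA.
rewrite !shift => E.
have E0 : a ord0 = b ord0.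
  by move/(congr1 (modn^~ N)): (E); rewrite ![(_ + _ * N)%N]addnC !modnMDl !modn_small.
have E1 : (\sum_(i < n) a (lift ord0 i) * N ^ i = \sum_(i < n) b (lift ord0 i) * N ^ i)%N.
  have N0 : (0 < N)%N by apply: leq_ltn_trans (aN ord0).
  by move: E; rewrite E0 => /addnI /eqP; rewrite eqn_pmul2r // => /eqP.
case: (unliftP ord0 i) => [j ->|-> //].
by apply: (IH (a \o lift ord0) (b \o lift ord0)) => // l; [apply: aN | apply: bN].
Qed.

Lemma kronecker_exp_inj n N (m m' : 'X_{1..n}) :
  (mdeg m < N)%N -> (mdeg m' < N)%N -> kronecker_exp N m = kronecker_exp N m' -> m = m'.
Proof.
have le_mdeg (l : 'X_{1..n}) i : (l i <= mdeg l)%N by rewrite mdegE (bigD1 i) //= leq_addr.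
move=> ltm ltm' E; apply/mnmP; apply: digits_inj E => i.
  exact: leq_ltn_trans (le_mdeg m i) ltm.
exact: leq_ltn_trans (le_mdeg m' i) ltm'.
Qed.

Lemma kronecker_coef (R : comNzRingType) n N (p : {mpoly R[n]}) (m : 'X_{1..n}) :
  (msize p <= N)%N -> (mdeg m < N)%N -> (kronecker N p)`_(kronecker_exp N m) = p@_m.
Proof.
move=> szp ltm; rewrite /kronecker /mmap coef_sum.
have XE m' : mmap1 (fun i : 'I_n => 'X^(N ^ i) : {poly R}) m' = 'X^(kronecker_exp N m').
  rewrite /mmap1 /kronecker_exp.
  by elim/big_rec2: _ => [|i k q _ ->]; rewrite ?expr0 // -exprM exprD mulnC.
under eq_bigr => m' _ do rewrite XE coefCM coefXn.
have ltN m' : m' \in msupp p -> (mdeg m' < N)%N by move/msize_mdeg_lt/leq_trans; apply.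
have [mp|mNp] := boolP (m \in msupp p).
  rewrite (bigD1_seq m) ?msupp_uniq //= eqxx mulr1 big_seq_cond big1 ?addr0 //.
  move=> m' /andP[m'p /eqP mm']; case: eqP => [E|_]; last by rewrite mulr0.
  by case: mm'; apply: (kronecker_exp_inj (ltN _ m'p) ltm); rewrite E.
rewrite (memN_msupp_eq0 mNp) big_seq_cond big1 // => m' /andP[m'p _].
case: eqP => [E|_]; last by rewrite mulr0.
by case/negP: mNp; rewrite (kronecker_exp_inj ltm (ltN _ m'p) E).
Qed.

Section KroneckerAlgebraic.
Variables (k : fieldType) (M : closedFieldType) (i : {rmorphism k -> M}) (n : nat).

Lemma algebraic_prod_XsubC (r : seq M) : (forall z, z \in r -> algebraicOver i z) ->
  forall l, algebraicOver i (\prod_(z <- r) ('X - z%:P))`_l.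
Proof.
elim: r => [|z r IH] alg l.
  by rewrite big_nil coef1; case: (l == 0%N); [exact: algebraic1 | exact: algebraic0].
have {}IH := IH (fun w wr => alg w (mem_behead (s := z :: r) wr)).
rewrite big_cons mulrBl coefB coefXM coefCM; apply: algebraic_sub.
  by case: (l == 0%N); [exact: algebraic0 | exact: IH].
by apply: algebraic_mul (IH l); apply: alg; apply: mem_head.
Qed.

(** The roots of a polynomial over [k] are algebraic over [k], hence so are
    the coefficients of its monic factors; the substitution
    [X_i := X^(N ^ i)], which only relabels the monomials of small degree,
    reduces the case of several variables to this one. *)
Lemma factor_coef_algebraic (f : {mpoly k[n]}) (A : {mpoly M[n]}) :
  f != 0 -> divides A (map_mpoly i f) ->
  exists2 c, c != 0 & forall m, algebraicOver i (c * A@_m).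
Proof.
move=> f0 Af; pose f' := map_mpoly i f.
have f'0 : f' != 0 by rewrite map_mpoly_eq0.
have A0 : A != 0 by apply: contraNneq f'0 => A0; case: Af => x E; rewrite /f' E A0 mulr0.
pose N := (msize A + msize f)%N.
pose K (p : {mpoly M[n]}) := kronecker N p.
have K0 p : p != 0 -> (msize p <= N)%N -> K p != 0.
  move=> p0 szp; apply: contraTneq p0 => Kp0; rewrite negbK; apply/eqP/mpolyP => m.
  rewrite mcoeff0; have [ltm|gem] := ltnP (mdeg m) N.
    by rewrite -(kronecker_coef szp ltm) -/(K p) Kp0 coef0.
  by apply: memN_msupp_eq0; apply: msize_mdeg_ge; apply: leq_trans gem.
have szA : (msize A <= N)%N by apply: leq_addr.
have szf : (msize f' <= N)%N by rewrite msize_map_mpoly leq_addl.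
have Kf'E : K f' = map_poly i (kronecker N f).
  pose g1 := @kronecker M n N \o map_mpoly i.
  pose g2 := map_poly i \o @kronecker k n N.
  apply: (mpoly_rmorph_ext (f := g1) (g := g2)) => [c|l] /=.
    by rewrite map_mpolyC /kronecker !mmapC map_polyC.
  by rewrite map_mpolyX /kronecker !mmapX !mmap1U map_polyXn.
have Kf0 : kronecker N f != 0 by rewrite -(map_poly_eq0 i) -Kf'E K0.
have KAf : divides (K A) (K f') by apply: dvd_rmorph.
have [r rE] := closed_field_poly_normal (K A).
have lc0 : lead_coef (K A) != 0 by rewrite lead_coef_eq0 K0.
exists (lead_coef (K A))^-1; first by rewrite invr_eq0.
move=> m; have [ltm|gem] := ltnP (mdeg m) N; last first.
  rewrite memN_msupp_eq0 ?mulr0; first exact: algebraic0.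
  by apply: msize_mdeg_ge; apply: leq_trans gem.
rewrite -(kronecker_coef szA ltm) -/(K A) rE coefZ.
rewrite lead_coefZ (monicP (monic_prod_XsubC _ _ _)) mulr1 mulKf //.
apply: algebraic_prod_XsubC => z zr; exists (kronecker N f) => //.
rewrite -Kf'E; case: KAf => q ->; rewrite rootM; apply/orP; right.
by rewrite rE rootZ // root_prod_XsubC.
Qed.

End KroneckerAlgebraic.

(** * Factors through a smooth rational point *)

Lemma exists_minimal (T : Type) (m : T -> nat) (P : T -> Prop) x0 : P x0 ->
  exists2 x, P x & forall y, P y -> (m x <= m y)%N.
Proof.
have [N] := ubnP (m x0); elim: N x0 => // N IH x0 ltN Px0.
have [[y [Py lty]]|noy] := classic (exists y, P y /\ (m y < m x0)%N).
  by apply: (IH y) => //; apply: leq_trans lty _.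
by exists x0 => // y Py; rewrite leqNgt; apply/negP => lty; apply: noy; exists y.
Qed.

Lemma prime_power_cancel (R : idomainType) (p : R) j h b g :
  prime_elt p -> ~ divides p b -> p ^+ j * h = b * g -> divides b h.
Proof.
move=> pp npb; have [p0 _ pM] := pp.
elim: j g => [|j IH] g; first by rewrite expr0 mul1r => ->; apply: dvd_mulr.
rewrite exprS -mulrA => E; have : divides p (b * g) by rewrite -E; apply: dvd_mulr.
case/pM => // [[x xE]]; apply: (IH x); apply: (mulfI p0).
by rewrite E xE; ring.
Qed.

Section PurelyInseparable.
Variables (k : fieldType) (M : fieldType) (i : {rmorphism k -> M}).

(** Let [N = q * u] with [q] a power of the characteristic exponent and [u]
    invertible. The polynomial is [(Y - c ^+ q) ^+ u] at [Y = X ^+ q], and its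
    coefficient at [Y ^+ (u - 1)] is [- u * c ^+ q]. *)
Lemma purely_inseparable (p : {poly k}) (c : M) N :
  map_poly i p = ('X - c%:P) ^+ N -> (0 < N)%N ->
  exists q, [pchar M].-nat q /\ exists d, i d = c ^+ q.
Proof.
move=> pE N0; set q := (N`_[pchar M])%N; set u := (N`_[pchar M]^')%N.
have NE : N = (q * u)%N by rewrite /q /u partnC.
have qn : [pchar M].-nat q by apply: part_pnat.
have q0 : (0 < q)%N by apply: part_gt0.
have u0 : (0 < u)%N by apply: part_gt0.
have uM : u%:R != 0 :> M by rewrite natf_neq0_pchar part_pnat.
have qn' : [pchar {poly M}].-nat q.
  by apply: sub_in_pnat qn => x _; rewrite pchar_poly.
have E : map_poly i p = (('X - (c ^+ q)%:P) ^+ u) \Po 'X^q.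
  have XE := exprDn_pchar ('X - c%:P) c%:P qn'.
  rewrite pE NE exprM rmorphXn /= comp_polyB comp_polyX comp_polyC; congr (_ ^+ u).
  by rewrite subrK in XE; rewrite XE rmorphXn addrK.
exists q; split=> //.
have /(congr1 (fun r : {poly M} => r`_(u.-1 * q))) := E.
rewrite coef_map coef_comp_poly_Xn // dvdn_mull // mulnK //.
have := @coefPn_prod_XsubC M (nseq u (c ^+ q)).
rewrite size_nseq !big_nseq iter_mulr_1 iter_addr_0 => ->; last by rewrite -lt0n.
rewrite -mulr_natl => Ed.
exists (- p`_(u.-1 * q) / u%:R).
by rewrite fmorph_div rmorphN /= Ed opprK rmorph_nat mulrC mulKf.
Qed.

End PurelyInseparable.

Lemma mlead_map_mpoly (k M : fieldType) (i : {rmorphism k -> M}) n (p : {mpoly k[n]}) :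
  mlead (map_mpoly i p) = mlead p.
Proof.
have [->|p0] := eqVneq p 0; first by rewrite rmorph0 !mlead0.
have suppE := perm_mem (msupp_map_mpoly p (@fmorph_inj _ _ i)).
apply/eqP; rewrite Order.POrderTheory.eq_le; apply/andP; split; apply: msupp_le_mlead.
  by rewrite -suppE mlead_supp // map_mpoly_eq0.
by rewrite suppE mlead_supp.
Qed.

Lemma mderiv_map_mpoly (k M : fieldType) (i : {rmorphism k -> M}) n (p : {mpoly k[n]}) j :
  (map_mpoly i p)^`M(j) = map_mpoly i p^`M(j).
Proof.
by apply/mpolyP => m; rewrite mcoeff_map_mpoly !mcoeff_deriv mcoeff_map_mpoly; symmetry; exact: rmorphMn.
Qed.

Section SmoothPoint.
Variables (k : fieldType) (M : closedFieldType) (i : {rmorphism k -> M}).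
Hypothesis alg : forall a, algebraicOver i a.
Variables (n : nat) (f : {mpoly k[n]}) (x : 'I_n -> k).
Hypotheses (fx0 : f.@[x] = 0) (fx_smooth : exists j, f^`M(j).@[x] != 0).

Let f' := map_mpoly i f.
Let x' j := i (x j).

(** Two factors through the point would make all derivatives vanish there, by
    the Leibniz rule. *)
Lemma smooth_point_unique (A B : {mpoly M[n]}) : f' = A * B -> A.@[x'] = 0 -> B.@[x'] != 0.
Proof.
move=> fAB Ax0; have [j fj] := fx_smooth; apply: contra fj => /eqP Bx0.
rewrite -(fmorph_eq0 i) -meval_map -mderiv_map_mpoly -/f' fAB mderivM mevalD !mevalM.
by rewrite -/x' Ax0 Bx0 mulr0 mul0r addr0.
Qed.

Let through (A : {mpoly M[n]}) : Prop := A.@[x'] = 0 /\ exists B, f' = A * B.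

Lemma f_neq0 : f != 0.
Proof.
by have [j] := fx_smooth; apply: contraNneq => ->; rewrite mderiv0 meval0.
Qed.

Let f'0 : f' != 0. Proof. by rewrite map_mpoly_eq0 f_neq0. Qed.

Lemma through_neq0 A : through A -> A != 0.
Proof. by move=> [_ [B E]]; apply: contraNneq f'0 => A0; rewrite E A0 mul0r. Qed.

Lemma minimal_through_irreducible A : through A ->
  (forall A', through A' -> (msize A <= msize A')%N) -> mirreducible A.
Proof.
move=> thA minA; have [Ax [B fAB]] := thA; have A0 := through_neq0 thA.
split.
  rewrite /nonconstant ltnNge; apply/negP => sz1.
  have [c AE] : exists c, A = c%:MP by exists A@_0; apply: msize1_polyC.
  by move: A0; rewrite AE mpolyC_eq0; move: Ax; rewrite AE mevalC => ->; rewrite eqxx.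
move=> [C [D [nC nD AE]]].
have: C.@[x'] * D.@[x'] == 0 by rewrite -mevalM -AE Ax.
have C0 := nonconstant_neq0 nC; have D0 := nonconstant_neq0 nD.
rewrite mulf_eq0 => /orP[] /eqP E.
  have : through C by split=> //; exists (D * B); rewrite mulrA -AE.
  by move/minA; rewrite leqNgt AE msize_mul_lt.
have : through D by split=> //; exists (C * B); rewrite mulrCA mulrA -AE.
by move/minA; rewrite leqNgt AE mulrC msize_mul_lt.
Qed.

(** The irreducible [A] divides [A'] or its cofactor, but by smoothness the
    latter does not pass through the point. *)
Lemma minimal_through_unique A A' : through A ->
  (forall C, through C -> (msize A <= msize C)%N) -> through A' ->
  msize A' = msize A -> mleadc A = 1 -> mleadc A' = 1 -> A' = A.
Proof.
move=> thA minA thA' szE lA lA'.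
have pA := mirreducible_prime (minimal_through_irreducible thA minA).
have [Ax [B fAB]] := thA; have [A'x [B' fA'B']] := thA'.
have [_ _ pM] := pA; have : divides A (A' * B') by rewrite -fA'B' fAB; apply: dvd_mulr.
case/pM => [|[C B'E]]; last first.
  have /negP[] := smooth_point_unique fA'B' A'x.
  by apply/eqP; rewrite B'E mevalM Ax mulr0.
case/(dvd_msize_scale (through_neq0 thA')); first by rewrite szE.
move=> c c0 A'E; move: lA'; rewrite A'E mleadcZE lA mulr1 => ->.
by rewrite scale1r.
Qed.

(** A conjugate of the minimal factor through the rational point [x] is again
    such a factor, so that its coefficients have no other conjugates. *)
Lemma minimal_through_conjugate A : through A ->
  (forall C, through C -> (msize A <= msize C)%N) -> mleadc A = 1 ->
  forall m (p : {poly k}) b, p \is monic -> irreducible_poly p ->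
  root (map_poly i p) A@_m -> root (map_poly i p) b -> b = A@_m.
Proof.
move=> thA minA lA m p b mp ip pa pb; have [Ax [B fAB]] := thA.
have [E1 [e [j1 [i1 [y [jE iE yA yb]]]]]] := hom_step mp ip pa pb.
have alg1 a : algebraicOver j1 a.
  have [q q0 qa] := alg a; exists (map_poly e q); first by rewrite map_poly_eq0.
  by rewrite -map_poly_comp (eq_map_poly (g := i)).
have fE1 : map_mpoly j1 (map_mpoly e f) = A * B by rewrite (map_mpoly_map f jE) -/f'.
have [E2 [e2 [j2 [i2 [A2 [B2 [[jE2 iE2] A2E _ fE2]]]]]]] :=
  factorization_transfer i1 alg1 fE1.
have {}fE2 : f' = map_mpoly i2 A2 * map_mpoly i2 B2 by rewrite -fE2 (map_mpoly_map f iE).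
pose x2 l := e2 (e (x l)).
have A2x : A2.@[x2] = 0.
  apply/eqP; rewrite -(fmorph_eq0 j2) -meval_map A2E -[X in _ == X]Ax; apply/eqP.
  by apply: meval_eq => l; rewrite /x2 jE2 jE.
have thA2 : through (map_mpoly i2 A2).
  split; last by exists (map_mpoly i2 B2).
  rewrite -[RHS](rmorph0 i2) -A2x -meval_map; apply: meval_eq => l.
  by rewrite /x2 iE2 iE.
have A2m : A2@_m = e2 y.
  by apply: (fmorph_inj j2); rewrite jE2 yA -A2E mcoeff_map_mpoly.
rewrite -yb -iE2 -A2m -mcoeff_map_mpoly; congr (_@_m).
apply: minimal_through_unique => //; first by rewrite -A2E !msize_map_mpoly.
rewrite mlead_map_mpoly mcoeff_map_mpoly -[RHS](rmorph1 i2); congr (i2 _).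
by apply: (fmorph_inj j2); rewrite rmorph1 -lA -A2E mlead_map_mpoly mcoeff_map_mpoly.
Qed.

(** A coefficient of [A] is the only root of its minimal polynomial, so that a
    power of it with exponent a power of the characteristic lies in [k]. *)
Lemma minimal_through_power A : through A ->
  (forall C, through C -> (msize A <= msize C)%N) -> mleadc A = 1 ->
  exists q (A0 : {mpoly k[n]}), (0 < q)%N /\ map_mpoly i A0 = A ^+ q.
Proof.
move=> thA minA lA.
have coef_pow m : exists q, [pchar M].-nat q /\ exists d, i d = A@_m ^+ q.
  have [p [mp ip pa _]] := algebraic_min_poly (alg A@_m).
  have [r rE] := closed_field_poly_normal (map_poly i p).
  have rr b : b \in r -> b = A@_m.
    move=> br; apply: (minimal_through_conjugate thA minA lA mp ip pa).
    by rewrite rE rootZ ?root_prod_XsubC // lead_coef_eq0 map_poly_eq0 monic_neq0.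
  have pE : map_poly i p = ('X - (A@_m)%:P) ^+ size r.
    rewrite rE lead_coef_map (monicP mp) rmorph1 scale1r.
    elim: {rE} r rr => [|b r IH] rr; first by rewrite big_nil.
    rewrite big_cons (rr b) ?mem_head // IH ?exprS // => b' b'r.
    by apply: rr; rewrite inE b'r orbT.
  apply: (purely_inseparable pE); rewrite lt0n.
  apply: contraPneq ip => sz0 [sz1 _]; move: sz1.
  by rewrite -(size_map_poly i) pE sz0 expr0 size_poly1.
have [q [qn qA]] : exists q, [pchar M].-nat q /\
    forall m, m \in msupp A -> exists d, i d = A@_m ^+ q.
  elim: (msupp A) => [|m s [q [qn IH]]]; first by exists 1%N.
  have [q' [q'n [d' d'E]]] := coef_pow m.
  exists (q * q')%N; split; first by rewrite pnatM qn.
  move=> m'; rewrite inE => /predU1P[->|/IH[d dE]].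
    by exists (d' ^+ q); rewrite mulnC exprM -d'E rmorphXn.
  by exists (d ^+ q'); rewrite exprM -dE rmorphXn.
have qn' : [pchar {mpoly M[n]}].-nat q.
  by apply: sub_in_pnat qn => y _; rewrite pchar_lalg.
have q0 : (0 < q)%N by case/andP: qn.
suff [A0 A0E] : exists A0, map_mpoly i A0 = (\sum_(m <- msupp A) A@_m *: 'X_[m]) ^+ q.
  by exists q, A0; split; rewrite // A0E -mpolyE.
elim: (msupp A) qA => [|m s IH] qA.
  by exists 0; rewrite big_nil rmorph0 expr0n -(prednK q0).
have [|A0 A0E] := IH; first by move=> m' m's; apply: qA; rewrite inE m's orbT.
have [d dE] := qA m (mem_head _ _).
exists (d *: 'X_[m] ^+ q + A0).
by rewrite big_cons exprDn_pchar // rmorphD /= A0E map_mpolyZ rmorphXn /= map_mpolyX dE exprZn.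
Qed.

(** The cofactor [B] of the minimal factor [A] spans the solutions [h] of
    [f * g = A ^+ q * h]; since this system has its coefficients in [k], a
    multiple of [B] is defined over [k].  This disposes of inseparability. *)
Lemma rational_factor : mreducible f' ->
  exists A B : {mpoly k[n]},
    [/\ f = A * B, nonconstant A, nonconstant B, A.@[x] = 0 & mirreducible (map_mpoly i A)].
Proof.
move=> [A0 [B0 [nA0 nB0 f'E]]].
have f'x : f'.@[x'] = 0 by rewrite meval_map fx0 rmorph0.
have [A1 thA1 szA1] : exists2 A1, through A1 & (msize A1 < msize f')%N.
  have /eqP := f'x; rewrite f'E mevalM mulf_eq0 => /orP[] /eqP E.
    exists A0; first by split=> //; exists B0.
    by rewrite msize_mul_lt // nonconstant_neq0.
  exists B0; first by split=> //; exists A0; rewrite f'E mulrC.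
  by rewrite mulrC msize_mul_lt // nonconstant_neq0.
have [A2 thA2 minA2] := exists_minimal (fun A : {mpoly M[n]} => msize A) thA1.
have lc0 : mleadc A2 != 0 by rewrite mleadc_eq0 through_neq0.
pose A := (mleadc A2)^-1 *: A2.
have szA : msize A = msize A2 by rewrite msizeZ // invr_eq0.
have thA : through A.
  have [A2x [B2 E2]] := thA2; split; first by rewrite mevalZ A2x mulr0.
  by exists (mleadc A2 *: B2); rewrite -scalerAr -scalerAl scalerA mulfV // scale1r.
have minA C : through C -> (msize A <= msize C)%N by rewrite szA; apply: minA2.
have lA : mleadc A = 1 by rewrite mleadcZE mulVf.
have irrA := minimal_through_irreducible thA minA.
have pA := mirreducible_prime irrA.
have [Ax [B fAB]] := thA; have A_neq0 := through_neq0 thA.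
have /mulf_neq0E[_ B_neq0] : A * B != 0 by rewrite -fAB.
have nAB : ~ divides A B.
  move=> [C BE]; have /negP[] := smooth_point_unique fAB Ax.
  by apply/eqP; rewrite BE mevalM Ax mulr0.
have nB : nonconstant B.
  have [szA_ szB_ szM] := msize_mulE A_neq0 B_neq0.
  have ltA : (msize A < msize f')%N by rewrite szA (leq_ltn_trans (minA2 _ thA1)).
  have arith (a b : nat) : (a < (a + b).-1)%N -> (1 < b)%N by lia.
  by apply: (arith (msize A)); rewrite -szM -fAB.
have [q [Aq [q0 AqE]]] := minimal_through_power thA minA lA.
pose m0 := mlead B; pose B1 := B - B@_m0 *: 'X_[m0].
have ltm0 : (mdeg m0 < msize B)%N by rewrite -(mlead_deg B_neq0).
(* the unknowns are the coefficients of [g] and [h]; that of [h] at the leading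
   monomial of [B] is normalized to 1 and moved to the other side *)
pose J := ('X_{1..n < msize (A ^+ q.-1)} + 'X_{1..n < msize B})%type.
pose p (j : J) := match j with
  | inl m => f * 'X_[m] | inr m => if m == m0 :> 'X_{1..n} then 0 else Aq * 'X_[m] end.
pose b (j : J) := match j with
  | inl m => (A ^+ q.-1)@_m | inr m => - B@_m end.
have bE : \sum_(l < 1) B@_m0 *: map_mpoly i (Aq * 'X_[m0]) =
    \sum_j b j *: map_mpoly i (p j).
  rewrite big_ord1 big_sumType /=.
  under eq_bigr => m _ do rewrite rmorphM /= map_mpolyX -/f'.
  rewrite -(mul_mpolyw _ (leqnn _)).
  rewrite (bigD1 (BMultinom ltm0)) //= eqxx rmorph0 scaler0 add0r.
  under eq_bigr => m /negPf mm0 do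
    rewrite -[_ == _]/(m == BMultinom ltm0) mm0 rmorphM /= map_mpolyX scaleNr AqE.
  rewrite sumrN rmorphM /= map_mpolyX AqE.
  apply/eqP; rewrite eq_sym subr_eq; apply/eqP.
  transitivity (B * A ^+ q); last first.
    by rewrite (mul_mpolyw _ (leqnn _)) (bigD1 (BMultinom ltm0)).
  by rewrite fAB mulrA -exprSr prednK // mulrC.
have [|b' b'E] := span_descend _ bE 0.
  move=> e; rewrite big_ord1 => /eqP; rewrite mulf_eq0 mleadc_eq0 (negPf B_neq0) fmorph_eq0.
  by move=> /eqP e0 l; rewrite ord1.
pose g := \sum_(m : 'X_{1..n < msize (A ^+ q.-1)}) b' (inl m) *: 'X_[m].
pose h := 'X_[m0] - \sum_(m : 'X_{1..n < msize B} | m != m0 :> 'X_{1..n}) b' (inr m) *: 'X_[m].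
have hgE : Aq * h = f * g.
  have S2 : \sum_(m : 'X_{1..n < msize B}) b' (inr m) *: p (inr m) =
      Aq * \sum_(m : 'X_{1..n < msize B} | m != m0 :> 'X_{1..n}) b' (inr m) *: 'X_[m].
    rewrite mulr_sumr [RHS]big_mkcond; apply: eq_bigr => m _ /=.
    by case: eqP => _ /=; rewrite ?scaler0 // scalerAr.
  rewrite /h /g mulrBr b'E big_sumType S2 addrK mulr_sumr.
  by apply: eq_bigr => m _; rewrite /= scalerAr.
have h0 : h != 0.
  apply: contraTneq (oner_neq0 k) => /mpolyP/(_ m0).
  rewrite mcoeffB mcoeffX eqxx mcoeff0 raddf_sum /= big1 ?subr0 => [/eqP|m /negPf mm0].
    by rewrite negbK.
  by rewrite mcoeffZ mcoeffX mm0 mulr0.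
have szh : (msize h <= msize B)%N.
  apply: leq_trans (msizeD_le _ _) _; rewrite geq_max msizeX ltm0 mmeasureN /=.
  apply: leq_trans (msize_sum _ _ _) _; apply/bigmax_leqP => m _.
  by apply: leq_trans (msizeZ_le _ _) _; rewrite msizeX bmdeg.
have Bh : divides B (map_mpoly i h).
  apply: (prime_power_cancel (j := q.-1) (g := map_mpoly i g) pA nAB).
  apply: (mulfI A_neq0); rewrite !mulrA -exprS prednK // -AqE -fAB.
  by rewrite -!rmorphM hgE.
have h'0 : map_mpoly i h != 0 by rewrite map_mpoly_eq0.
have [|s s0 hB] := dvd_msize_scale h'0 Bh; first by rewrite msize_map_mpoly.
have [A3 fE] : divides h f.
  apply: (@dvd_descend _ _ i); rewrite -/f' fAB hB; apply: dvdZ => //; apply: dvd_mull.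
have A3E : map_mpoly i A3 = s^-1 *: A.
  apply: (mulIf h'0); transitivity f'; first by rewrite /f' fE rmorphM.
  have cancel_s (C D : {mpoly M[n]}) : C * D = (s^-1 *: C) * (s *: D).
    by rewrite -scalerAr -scalerAl scalerA mulfV // scale1r.
  by rewrite fAB hB; apply: cancel_s.
have nh : nonconstant h by apply/(nonconstant_map i); rewrite /nonconstant hB msizeZ.
have irrA3 : mirreducible (map_mpoly i A3).
  rewrite A3E; have [nA noA] := irrA; split.
    by rewrite /nonconstant msizeZ // invr_eq0.
  move=> [C [D [nC nD E]]]; apply: noA; exists (s *: C), D; split=> //.
    by rewrite /nonconstant msizeZ.
  by rewrite -scalerAl -E scalerA mulfV // scale1r.
exists A3, h; split=> //; first by apply/(nonconstant_map i); case: irrA3.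
by apply/eqP; rewrite -(fmorph_eq0 i) -meval_map A3E mevalZ -/x' Ax mulr0.
Qed.

End SmoothPoint.

(** * Gauss's lemma for factorizations in several variables *)

Lemma dvd_mpolyC_const (R : idomainType) n (c : R) (g : {mpoly R[n]}) :
  c != 0 -> divides g c%:MP -> exists2 b, b != 0 & g = b%:MP.
Proof.
move=> c0 [h E]; have {}E : c%:MP = (h : {mpoly R[n]}) * g by [].
have hg0 : h * g != 0 by rewrite -E mpolyC_eq0.
have [h0 g0] : h != 0 /\ g != 0 by apply/andP; rewrite -negb_or -mulf_eq0.
have szE := msizeM h0 g0; rewrite -E mmeasureC c0 in szE.
have arith (a b : nat) : 1%N = (a + b).-1 -> a != 0%N -> b != 0%N -> b = 1%N by lia.
have /eqP/msize_poly1P[b b0 ->] : msize g = 1%N.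
  by apply: (arith _ _ szE); rewrite msize_poly_eq0.
by exists b.
Qed.

Section GaussFactor.
Variables (R : idomainType) (k : fieldType) (j : {rmorphism R -> k}).
Hypotheses (fR : factorial_ring R) (j_inj : injective j).
Hypothesis j_frac : forall t, exists p q, j q != 0 /\ t = j p / j q.
Variable n : nat.

Let j0 a : (j a == 0) = (a == 0). Proof. by rewrite -(rmorph0 j) (inj_eq j_inj). Qed.

Lemma map_mpoly_injective : injective (map_mpoly j : {mpoly R[n]} -> {mpoly k[n]}).
Proof.
move=> p q /mpolyP E; apply/mpolyP => m; apply: j_inj.
by have := E m; rewrite !mcoeff_map_mpoly.
Qed.

Lemma clear_denominators (A : {mpoly k[n]}) :
  exists c A1, c != 0 /\ map_mpoly j A1 = j c *: A.
Proof.
rewrite [A]mpolyE; elim: (msupp A) => [|m s [c [A1 [c0 A1E]]]].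
  by exists 1, 0; rewrite big_nil scaler0 rmorph0 oner_neq0.
have [p [q [q0 tE]]] := j_frac A@_m.
exists (c * q), (A1 * q%:MP + (c * p) *: 'X_[m]); split.
  by rewrite mulf_neq0 // -j0.
rewrite big_cons rmorphD rmorphM /= map_mpolyC map_mpolyZ map_mpolyX A1E addrC scalerDr.
rewrite [_ * (j q)%:MP]mulrC mul_mpolyC !scalerA !rmorphM [j q * _]mulrC; congr (_ + _ *: _).
by rewrite tE [j p / _]mulrC mulrA mulfK.
Qed.

(** Clear the denominators of both factors; the primes of their product are
    then distributed over the two factors and cancelled there. *)
Lemma gauss_factor (f : {mpoly R[n]}) (A B : {mpoly k[n]}) : map_mpoly j f = A * B ->
  exists A' B' a b, [/\ f = A' * B', a != 0, b != 0,
    map_mpoly j A' = a *: A & map_mpoly j B' = b *: B].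
Proof.
move=> fAB; have [c [A1 [c0 A1E]]] := clear_denominators A.
have [d [B1 [d0 B1E]]] := clear_denominators B.
have cd0 : c * d != 0 by apply: mulf_neq0.
have [l ppcd] := fR cd0.
have E : (c * d)%:MP * f = A1 * B1.
  apply: map_mpoly_injective; rewrite !rmorphM /= A1E B1E fAB !map_mpolyC.
  by rewrite -!mul_mpolyC mulrACA.
have [a [b [A' [B' [cdE A1E' B1E' fE]]]]] :=
  prime_product_split (prime_product_mpolyC n ppcd) E.
have [|a' a'0 aE] := @dvd_mpolyC_const _ n _ a cd0; first by rewrite cdE; apply: dvd_mulr.
have [|b' b'0 bE] := @dvd_mpolyC_const _ n _ b cd0; first by rewrite cdE; apply: dvd_mull.
have scaled (u v : R) (C1 C' : {mpoly R[n]}) (C : {mpoly k[n]}) : u != 0 -> C1 = u%:MP * C' ->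
    map_mpoly j C1 = j v *: C -> map_mpoly j C' = (j v / j u) *: C.
  move=> u0 ->; rewrite rmorphM /= map_mpolyC mul_mpolyC mulrC -scalerA => <-.
  by rewrite scalerA mulVf ?scale1r // j0.
exists A', B', (j c / j a'), (j d / j b'); split=> //.
- by rewrite mulf_neq0 ?invr_eq0 ?j0.
- by rewrite mulf_neq0 ?invr_eq0 ?j0.
- by apply: scaled A1E; rewrite // A1E' aE.
- by apply: scaled B1E; rewrite // B1E' bE.
Qed.

End GaussFactor.

(** * Exchanging two groups of variables *)

Definition mpoly_swap (R : comNzRingType) a b :
    {mpoly {mpoly R[a]}[b]} -> {mpoly {mpoly R[b]}[a]} :=
  mmap (map_mpoly (@mpolyC b R)) (fun i => ('X_i)%:MP).

HB.instance Definition _ (R : comNzRingType) a b :=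
  GRing.RMorphism.copy (@mpoly_swap R a b)
    (mmap (map_mpoly (@mpolyC b R)) (fun i => ('X_i)%:MP)).

Lemma mcoeff_swap (R : comNzRingType) a b (p : {mpoly {mpoly R[a]}[b]}) m m' :
  (mpoly_swap p)@_m@_m' = p@_m'@_m.
Proof.
rewrite (mpolyE p) rmorph_sum !raddf_sum /=; apply: eq_bigr => l _.
rewrite -mul_mpolyC rmorphM mcoeffCM mcoeffX /= /mpoly_swap mmapC mmapX.
have -> : mmap1 (fun i : 'I_b => ('X_i)%:MP) l = ('X_[l])%:MP :> {mpoly {mpoly R[b]}[a]}.
  by rewrite /mmap1 mpolyXE_id rmorph_prod; apply: eq_bigr => i _; rewrite rmorphXn.
rewrite mulrC mcoeffCM mcoeff_map_mpoly mulrC mul_mpolyC mcoeffZ mcoeffX.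
by case: eqP => _; rewrite ?mulr1 // !mulr0 mcoeff0.
Qed.

Lemma mpoly_swapK (R : comNzRingType) a b :
  cancel (@mpoly_swap R a b) (@mpoly_swap R b a).
Proof. by move=> p; apply/mpolyP => m; apply/mpolyP => m'; rewrite !mcoeff_swap. Qed.

Lemma mpoly_swapC (R : comNzRingType) a b (h : {mpoly R[a]}) :
  mpoly_swap (h%:MP : {mpoly {mpoly R[a]}[b]}) = map_mpoly (@mpolyC b R) h.
Proof. by rewrite /mpoly_swap mmapC. Qed.

Lemma msize_swap_ge (R : idomainType) a b (p : {mpoly {mpoly R[a]}[b]}) m :
  (msize p@_m <= msize (mpoly_swap p))%N.
Proof.
rewrite [msize p@_m]mmeasureE; apply/bigmax_leqP_seq => m' m'p _.
apply: msize_mdeg_lt; rewrite mcoeff_msupp; apply: contraTneq m'p => /mpolyP/(_ m).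
by rewrite mcoeff_swap mcoeff0 => E; rewrite mcoeff_msupp E eqxx.
Qed.

(** * Binary forms *)

Section BinaryForms.
Variables (F : fieldType) (S : comAlgType F) (a b : S).

(** The value at [(a, b)] of the form of degree [e] whose dehomogenization is
    [p]. *)
Definition homogenize (p : {poly F}) e : S := \sum_(l < e.+1) p`_l *: (a ^+ l * b ^+ (e - l)).

Lemma homogenize_root (p : {poly F}) e r : (size p <= e.+1)%N ->
  homogenize (p * ('X - r%:P)) e.+1 = homogenize p e * (a - r *: b).
Proof.
move=> szp; rewrite /homogenize [RHS]mulrBr.
have coefE l : (p * ('X - r%:P))`_l = (if l is l'.+1 then p`_l' else 0) - r * p`_l.
  by rewrite mulrBr coefB coefMX coefMC mulrC; case: l.
under eq_bigr => l _ do rewrite coefE scalerBl.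
rewrite sumrB; congr (_ - _).
  rewrite big_ord_recl /= scale0r add0r mulr_suml; apply: eq_bigr => l _.
  by rewrite /bump /= subSS -scalerAl exprSr mulrAC.
rewrite big_ord_recr /= [p`_e.+1]nth_default // mulr0 scale0r addr0 mulr_suml.
apply: eq_bigr => l _; have le : (l <= e)%N by rewrite -ltnS.
by rewrite subSn // exprSr -scalerAr -scalerAl !scalerA mulrA.
Qed.

Lemma homogenize_prod c (rs : seq F) :
  homogenize (c *: \prod_(r <- rs) ('X - r%:P)) (size rs) =
  c *: \prod_(r <- rs) (a - r *: b).
Proof.
elim: rs => [|r rs IH].
  by rewrite !big_nil /homogenize big_ord1 coefZ coef1 !expr0 !mulr1.
rewrite !big_cons mulrC scalerAl /= homogenize_root; last first.
  by rewrite (leq_trans (size_scale_leq _ _)) // size_prod_XsubC.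
by rewrite IH -scalerAl mulrC.
Qed.

End BinaryForms.

(** * Gordan's theorem at the generic point *)

Lemma addn_pred_le_r u v : ((u + v).-1 <= u)%N -> u != 0%N -> (v <= 1)%N.
Proof. lia. Qed.

Lemma prime_dvd_prod (R : idomainType) (p : R) (I : Type) (r : seq I) (G : I -> R) :
  prime_elt p -> divides p (\prod_(z <- r) G z) ->
  exists s1 z s2, r = s1 ++ z :: s2 /\ divides p (G z).
Proof.
move=> [_ pU pM]; elim: r => [|z r IH]; rewrite ?big_nil ?big_cons.
  by move=> [c /esym cE]; case/negP: pU; apply/unitrPr; exists c; rewrite mulrC.
case/pM => [pz|/IH[s1 [z' [s2 [-> pz']]]]]; first by exists [::], z, r.
by exists (z :: s1), z', s2.
Qed.

Definition coprime_mpoly (K : fieldType) n (p q : {mpoly K[n]}) : Prop :=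
  forall d, divides d p -> divides d q -> ~ nonconstant d.

Lemma closed_algebraic (K : closedFieldType) (k : fieldType) (i : {rmorphism K -> k}) t :
  algebraicOver i t -> exists e, t = i e.
Proof.
move=> [p p0 pt]; have [r pE] := closed_field_poly_normal p.
have : root (map_poly i (\prod_(z <- r) ('X - z%:P))) t.
  move: pt; rewrite {1}pE map_polyZ rootZ // fmorph_eq0 lead_coef_eq0 //.
rewrite rmorph_prod /= => rt; have [z zr tz] : exists2 z, z \in r & t = i z.
  elim: r rt {pE} => [|z r IH]; first by rewrite big_nil -polyC1 rootC oner_eq0.
  rewrite big_cons rmorphB /= map_polyX map_polyC rootM root_XsubC => /orP[/eqP ->|/IH[w wr ->]].
    by exists z; rewrite // mem_head.
  by exists w; rewrite // inE wr orbT.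
by exists z.
Qed.

Section GenericPoint.
Variables (K : closedFieldType) (n : nat) (k : fieldType).
Variable j : {rmorphism {mpoly K[n]} -> k}.
Hypothesis j_inj : injective j.
Hypothesis j_frac : forall t, exists p q, j q != 0 /\ t = j p / j q.

(** The field [k] is the function field of affine space, whose generic point is
    [generic_coord]. A polynomial over [K] can be evaluated there, by [j], or be
    lifted to a polynomial over [k] in fresh variables. *)
Definition generic_const : {rmorphism K -> k} := j \o @mpolyC n K.
Local Notation kap := generic_const.
Definition generic_coord (l : 'I_n) : k := j 'X_l.
Local Notation x := generic_coord.
Definition generic_lift (p : {mpoly K[n]}) : {mpoly k[n]} := map_mpoly kap p.
Local Notation lift := generic_lift.

HB.instance Definition _ := GRing.RMorphism.copy generic_lift (map_mpoly kap).

Lemma generic_liftZ c p : lift (c *: p) = kap c *: lift p.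
Proof. by rewrite /lift map_mpolyZ. Qed.

Lemma generic_eval p : (lift p).@[x] = j p.
Proof.
apply: (mpoly_rmorph_ext (f := meval x \o map_mpoly kap) (g := j)) => [c|l] /=.
  by rewrite map_mpolyC mevalC.
by rewrite map_mpolyX mevalXU.
Qed.

Lemma generic_eq0 p : (j p == 0) = (p == 0).
Proof. by rewrite -(rmorph0 j) (inj_eq j_inj). Qed.

(** The value at the generic point is given by the injective [j]. *)
Lemma generic_through (A : {mpoly k[n]}) (p : {mpoly K[n]}) :
  A.@[x] = 0 -> divides A (lift p) -> p = 0.
Proof.
move=> Ax [B E]; apply/eqP; rewrite -generic_eq0 -generic_eval E mevalM Ax mulr0.
by [].
Qed.

Lemma coprime_fraction t : exists phi psi,
  [/\ psi != 0, t = j phi / j psi & coprime_mpoly phi psi].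
Proof.
have [p0 [q0 [jq0 tE0]]] := j_frac t.
pose Pr (w : {mpoly K[n]} * {mpoly K[n]}) := w.2 != 0 /\ t = j w.1 / j w.2.
have Pr0 : Pr (p0, q0) by split=> //=; rewrite -generic_eq0.
have [[phi psi] [/= psi0 tE] minP] :=
  exists_minimal (fun w : {mpoly K[n]} * {mpoly K[n]} => msize w.2) Pr0.
exists phi, psi; split=> // d [a aE] [b bE] nd.
have {}bE : psi = (b : {mpoly K[n]}) * d by [].
have /mulf_neq0E[b0 d0] : b * d != 0 by rewrite -bE.
have : Pr (a, b).
  split=> //=; rewrite tE aE bE !rmorphM -mulf_div divff ?mulr1 //.
  by rewrite generic_eq0.
by move/minP; rewrite /= leqNgt bE msize_mul_lt.
Qed.

Section Pencil.
Variables (P Q : {mpoly K[n]}).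
Hypothesis Q0 : Q != 0.
Let tau : k := - (j P / j Q).
Hypothesis tauN : forall e, tau != kap e.
Let f : {mpoly k[n]} := lift P + tau *: lift Q.

Let jQ0 : j Q != 0. Proof. by rewrite generic_eq0. Qed.

(** Since [K] is algebraically closed, [tau] is transcendental over it. *)
Lemma tau_eval_inj (g : {poly K}) : (map_poly kap g).[tau] = 0 -> g = 0.
Proof.
move=> g0; apply/eqP; apply: contraT => gN0.
have [e /eqP] : exists e, tau = kap e.
  by apply: closed_algebraic; exists g => //; apply/eqP.
by rewrite (negPf (tauN e)).
Qed.

(** Modulo [f] the constant [tau] equals [- P / Q], so that after multiplication
    by a power of [Q] every expression in [tau] becomes a polynomial over [K]. *)
Lemma pencil_reduce_const (g : {poly K}) : exists D0, forall D, (D0 <= D)%N ->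
  exists G, divides f (lift G - (map_poly kap g).[tau] *: lift Q ^+ D).
Proof.
elim/poly_ind: g => [|g c [D0 IH]].
  by exists 0%N => D _; exists 0; rewrite !rmorph0 horner0 scale0r subr0; apply: dvd0.
exists D0.+1 => -[//|D]; rewrite ltnS => /IH[G [H HE]].
exists (c *: Q ^+ D.+1 - P * G), (- lift P * H - (map_poly kap g).[tau] *: lift Q ^+ D).
have GE : lift G = H * f + (map_poly kap g).[tau] *: lift Q ^+ D.
  by apply/eqP; rewrite -subr_eq -HE.
have liftE : lift (c *: Q ^+ D.+1 - P * G) = kap c *: lift Q ^+ D.+1 - lift P * lift G.
  by rewrite rmorphB rmorphM /= generic_liftZ rmorphXn.
rewrite liftE GE rmorphD rmorphM /= map_polyX map_polyC hornerMXaddC.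
rewrite -/kap -(mul_mpolyC (kap c)) -!mul_mpolyC /f -mul_mpolyC mpolyCD mpolyCM exprS.
ring.
Qed.

Lemma pencil_reduce_coef (mu : {poly {poly K}}) N : exists D, forall l, (l < N)%N ->
  exists G, divides f (lift G - (map_poly kap mu`_l).[tau] *: lift Q ^+ D).
Proof.
suff [D DP] : exists D0, forall D, (D0 <= D)%N -> forall l, (l < N)%N ->
    exists G, divides f (lift G - (map_poly kap mu`_l).[tau] *: lift Q ^+ D).
  by exists D => l lN; apply: DP lN.
elim: N => [|N [D0 IH]]; first by exists 0%N.
have [D1 H1] := pencil_reduce_const mu`_N.
exists (maxn D0 D1) => D; rewrite geq_max => /andP[leD0 leD1] l.
by rewrite ltnS leq_eqVlt => /predU1P[->|/IH]; [apply: H1 | apply].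
Qed.

Variable A : {mpoly k[n]}.
Hypotheses (Ax : A.@[x] = 0) (Af : divides A f).
Variables (M : closedFieldType) (i : {rmorphism k -> M}).
Hypothesis irrA : mirreducible (map_mpoly i A).

Let pA : prime_elt (map_mpoly i A). Proof. exact: mirreducible_prime. Qed.
Let A0 : A != 0. Proof. by case: pA; rewrite map_mpoly_eq0. Qed.
Let lc := mleadc A.
Let lc0 : lc != 0. Proof. by rewrite mleadc_eq0. Qed.

(** Otherwise [A] would be, up to a constant, a polynomial over [K] that
    vanishes at the generic point. *)
Lemma nonconstant_ratio : exists m, forall e, A@_m / lc != kap e.
Proof.
apply: NNPP => /not_ex_all_not H.
have coefK m : exists e, kap e = (lc^-1 *: A)@_m.
  have /not_all_ex_not[e /negP] := H m; rewrite negbK => /eqP E.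
  by exists e; rewrite mcoeffZ mulrC E.
have [B BE] := lift_mpoly coefK.
have B0 : B = 0.
  apply: (@generic_through A) => //; exists lc^-1%:MP.
  by rewrite mul_mpolyC.
by move: A0; rewrite -(scale1r A) -(mulfV lc0) -scalerA -BE B0 rmorph0 scaler0 eqxx.
Qed.

Lemma clear_fraction_poly (R : idomainType) (q : {poly {fraction R}}) :
  exists d (mu : {poly R}), d != 0 /\ map_poly (@tofrac R) mu = tofrac d *: q.
Proof.
elim/poly_ind: q => [|q c [d [mu [d0 muE]]]].
  by exists 1, 0; rewrite rmorph0 scaler0 oner_neq0.
have [a [b [b0 ->]]] := fracE c.
exists (d * b), (b *: mu * 'X + (d * a)%:P); split; first exact: mulf_neq0.
have E : tofrac (d * a) = tofrac d * tofrac b * (tofrac a / tofrac b).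
  by rewrite [tofrac a / _]mulrC mulrA mulfK ?tofrac_eq0 // rmorphM.
rewrite rmorphD rmorphM /= map_polyX map_polyC map_polyZ muE -!mul_polyC /=.
have aux (S : comNzRingType) (q' x' d' b' c' : S) :
  b' * (d' * q') * x' + d' * b' * c' = (d' * b') * (q' * x' + c') by ring.
by rewrite E [tofrac (d * b)]rmorphM !polyCM; apply: aux.
Qed.

Let g0 : {rmorphism {poly K} -> k} := horner_eval tau \o map_poly kap.

Lemma tau_eval_injective : injective g0.
Proof.
move=> u v /eqP; rewrite -subr_eq0 -rmorphB => /eqP /tau_eval_inj /eqP.
by rewrite subr_eq0 => /eqP.
Qed.

Lemma pencil_neq0 : f != 0.
Proof.
apply/eqP => /mpolyP/(_ (mlead Q)); rewrite mcoeff0 mcoeffD mcoeffZ.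
rewrite /lift /generic_lift !mcoeff_map_mpoly => E.
have lQ0 : mleadc Q != 0 by rewrite mleadc_eq0.
have /eqP[] := tauN (- P@_(mlead Q) / mleadc Q).
rewrite fmorph_div rmorphN; apply: (canRL (mulfK _)); first by rewrite fmorph_eq0.
by apply/eqP; rewrite -addr_eq0 addrC; apply/eqP.
Qed.

(** [A] divides [f], whose coefficients lie in [K(tau)]. *)
Lemma ratio_algebraic m : exists2 mu : {poly {poly K}}, mu != 0 &
  (map_poly g0 mu).[A@_m / lc] = 0.
Proof.
have [h0 h0E] := frac_lift tau_eval_injective.
pose c0 : {rmorphism K -> {fraction {poly K}}} := @tofrac _ \o @polyC K.
pose f0 : {mpoly {fraction {poly K}}[n]} := map_mpoly c0 P + tofrac 'X *: map_mpoly c0 Q.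
have h0c e : h0 (c0 e) = kap e.
  by rewrite /c0 /= h0E /g0 /= map_polyC /horner_eval hornerC.
have h0f : map_mpoly h0 f0 = f.
  have e1 p : map_mpoly h0 (map_mpoly c0 p) = lift p by apply: map_mpoly_map.
  have e2 : h0 (tofrac 'X) = tau by rewrite h0E /g0 /= map_polyX /horner_eval hornerX.
  have e3 : map_mpoly h0 f0 = map_mpoly h0 (map_mpoly c0 P) +
      map_mpoly h0 (tofrac 'X *: map_mpoly c0 Q) by apply: rmorphD.
  have e4 : map_mpoly h0 (tofrac 'X *: map_mpoly c0 Q) =
      h0 (tofrac 'X) *: map_mpoly h0 (map_mpoly c0 Q) by apply: map_mpolyZ.
  by rewrite e3 e4 e2; congr (_ + _ *: _); apply: e1.
have f00 : f0 != 0 by rewrite -(map_mpoly_eq0 h0) h0f pencil_neq0.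
pose ih : {rmorphism {fraction {poly K}} -> M} := i \o h0.
have [|c cN0 algc] := @factor_coef_algebraic _ M ih n f0 (map_mpoly i A) f00.
  have -> : map_mpoly ih f0 = map_mpoly i f by rewrite -h0f (map_mpoly_map (h := ih)).
  exact: dvd_rmorph.
have [q q0 qt] : algebraicOver ih (i (A@_m / lc)).
  have -> : i (A@_m / lc) = (c * (map_mpoly i A)@_m) / (c * (map_mpoly i A)@_(mlead A)).
    by rewrite -mulf_div divff // mul1r !mcoeff_map_mpoly fmorph_div.
  exact: algebraic_div.
have [d [mu [d0 muE]]] := clear_fraction_poly q.
exists mu.
  apply: contraNneq q0 => mu0; move: muE; rewrite mu0 rmorph0 => /esym/eqP.
  by rewrite -!size_poly_eq0 size_scale ?tofrac_eq0.
have -> : map_poly g0 mu = h0 (tofrac d) *: map_poly h0 q.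
  rewrite -map_polyZ -muE -map_poly_comp; apply: eq_map_poly => u /=.
  by rewrite h0E.
have : root (map_poly h0 q) (A@_m / lc) by rewrite -(fmorph_root i) -map_poly_comp.
by move/rootP; rewrite hornerZ => ->; rewrite mulr0.
Qed.

(** Gordan's form of Lueroth's theorem, first half.  The norm of
    [lift phi - t *: lift psi] down to [K(tau)] vanishes at the generic point,
    hence is a multiple of [f], so that [A] divides one of its conjugates; the
    value at the generic point tells which one. *)
Lemma pencil_dvd m phi psi : psi != 0 -> A@_m / lc = j phi / j psi ->
  divides A (lift phi - (A@_m / lc) *: lift psi).
Proof.
move=> psi0 tE; set t := A@_m / lc in tE *.
have jpsi0 : j psi != 0 by rewrite generic_eq0.
have [mu mu0 mut] := ratio_algebraic m.
pose e := (size mu).-1; have szmu : size mu = e.+1 by rewrite prednK // size_poly_gt0.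
have [D DP] := pencil_reduce_coef mu e.+1.
pose N := homogenize (lift phi) (lift psi) (map_poly g0 mu) e.
have [Z ZN] : exists Z, divides f (lift Z - lift Q ^+ D * N).
  rewrite /N /homogenize mulr_sumr.
  apply: (big_ind (fun W => exists Z, divides f (lift Z - W))) => [|W1 W2 [Z1 H1] [Z2 H2]|l _].
  - by exists 0; rewrite rmorph0 subr0; apply: dvd0.
  - by exists (Z1 + Z2); rewrite rmorphD /= opprD addrACA; apply: dvdD.
  have [G GP] := DP l (ltn_ord l).
  exists (G * (phi ^+ l * psi ^+ (e - l))).
  have := dvdMr (lift (phi ^+ l * psi ^+ (e - l))) GP.
  rewrite mulrBl -rmorphM !rmorphM !rmorphXn /= coef_map /=.
  by rewrite -!scalerAl -scalerAr.
have Nx : N.@[x] = 0.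
  rewrite /N /homogenize rmorph_sum /=.
  transitivity (\sum_(l < e.+1) j psi ^+ e * ((map_poly g0 mu)`_l * t ^+ l)).
    apply: eq_bigr => l _; rewrite mevalZ rmorphM !rmorphXn /= !generic_eval.
    rewrite [RHS]mulrCA; congr (_ * _); have le : (l <= e)%N by rewrite -ltnS.
    have psiE : j psi ^+ e = j psi ^+ (e - l) * j psi ^+ l by rewrite -exprD subnK.
    by rewrite tE expr_div_n psiE -mulrA [j phi ^+ l / _]mulrC mulVKf ?expf_neq0 // mulrC.
  rewrite -mulr_sumr; have szm : size (map_poly g0 mu) = e.+1.
    by rewrite size_map_inj_poly ?rmorph0 //; apply: tau_eval_injective.
  by move: mut; rewrite horner_coef szm => ->; rewrite mulr0.
have Z0 : Z = 0.
  apply/eqP; rewrite -generic_eq0 -generic_eval; have [H HE] := ZN.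
  have fx : f.@[x] = 0.
    by rewrite /f mevalD mevalZ !generic_eval /tau mulNr mulfVK // subrr.
  have /(congr1 (meval x)) := HE.
  rewrite mevalB !mevalM fx Nx !mulr0 subr0 => ->.
  by [].
have AN : divides (map_mpoly i A) (map_mpoly i (lift Q ^+ D * N)).
  apply: dvd_rmorph; apply: dvd_trans Af _; have := dvdN ZN.
  by rewrite Z0 rmorph0 sub0r opprK.
have AQ : ~ divides (map_mpoly i A) (map_mpoly i (lift Q)).
  by move/dvd_descend => /(generic_through Ax) Qz; move: Q0; rewrite Qz eqxx.
have {}AN : divides (map_mpoly i A) (map_mpoly i N).
  have [_ _ pM] := pA; move: AN; rewrite rmorphM rmorphXn /=.
  elim: {ZN DP} D => [|D IH]; first by rewrite expr0 mul1r.
  by rewrite exprS -mulrA => /pM[].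
pose q' := map_poly i (map_poly g0 mu).
have szq' : size q' = e.+1.
  by rewrite size_map_poly size_map_inj_poly ?rmorph0 //; apply: tau_eval_injective.
have NE : map_mpoly i N = homogenize (map_mpoly i (lift phi)) (map_mpoly i (lift psi)) q' e.
  rewrite /N /homogenize rmorph_sum /=; apply: eq_bigr => l _.
  by rewrite map_mpolyZ rmorphM !rmorphXn /= /q' [in RHS]coef_map.
have [rs rsE] := closed_field_poly_normal q'.
have lq0 : lead_coef q' != 0 by rewrite lead_coef_eq0 -size_poly_eq0 szq'.
have szrs : size rs = e.
  by apply: succn_inj; rewrite -szq' rsE size_scale // size_prod_XsubC.
move: AN; rewrite NE rsE -szrs homogenize_prod.
move/(dvdMl (lead_coef q')^-1%:MP); rewrite mul_mpolyC scalerA mulVf // scale1r.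
case/(prime_dvd_prod pA) => [_ [r [_ [_ Ar]]]].
have xE : (map_mpoly i A).@[fun l => i (x l)] = 0 by rewrite meval_map Ax rmorph0.
have rE : r = i t.
  have [H /(congr1 (meval (fun l => i (x l))))] := Ar.
  rewrite mevalM xE mulr0 mevalB mevalZ !meval_map !generic_eval => /eqP.
  rewrite subr_eq0 => /eqP E; rewrite tE fmorph_div E mulfK //.
  by rewrite fmorph_eq0.
apply: (@dvd_descend _ _ i); move: Ar; rewrite rE.
by rewrite rmorphB /= map_mpolyZ.
Qed.

Lemma lift_combination_neq0 t phi psi : psi != 0 -> (forall e, t != kap e) ->
  lift phi - t *: lift psi != 0.
Proof.
move=> psi0 tN; apply/eqP => /mpolyP/(_ (mlead psi)); rewrite mcoeff0 mcoeffB mcoeffZ.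
rewrite /lift !mcoeff_map_mpoly => /eqP; rewrite subr_eq0 => /eqP E.
have lpsi0 : mleadc psi != 0 by rewrite mleadc_eq0.
have /eqP[] := tN (phi@_(mlead psi) / mleadc psi).
by rewrite fmorph_div; apply: (canRL (mulfK _)); rewrite ?fmorph_eq0.
Qed.

(** Second half: by Gauss's lemma the polynomial
    [phi(z) psi(x) - psi(z) phi(x)] is, up to a constant, the primitive multiple
    of [A], because its degree in [x] is at most that of the coefficients of the
    latter, and because it has no factor that is free of [x]. *)
Lemma pencil_generator m phi psi : psi != 0 -> A@_m / lc = j phi / j psi ->
  (forall e, A@_m / lc != kap e) -> coprime_mpoly phi psi ->
  exists2 c, c != 0 & lift phi - (A@_m / lc) *: lift psi = c *: A.
Proof.
move=> psi0 tE tN cop; have AE := pencil_dvd psi0 tE.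
have E0 := lift_combination_neq0 phi psi0 tN.
set t := A@_m / lc in tE tN AE E0 *.
have jpsi0 : j psi != 0 by rewrite generic_eq0.
have phi0 : phi != 0.
  by apply: contraTneq (tN 0) => phi0; rewrite tE phi0 !rmorph0 mul0r negbK.
have [B BE] : exists B : {mpoly k[n]}, lift phi - t *: lift psi = B * A by [].
pose C := map_mpoly (@mpolyC n K) : {mpoly K[n]} -> {mpoly {mpoly K[n]}[n]}.
have jC p : map_mpoly j (C p) = lift p by apply: map_mpoly_map.
pose E1 := C phi * psi%:MP - C psi * phi%:MP.
have jE1 : map_mpoly j E1 = A * (j psi *: B).
  have jM p q : map_mpoly j (C p * q%:MP) = j q *: lift p.
    by rewrite mulrC mul_mpolyC map_mpolyZ jC.
  rewrite rmorphB /= !jM -scalerAr [A * B]mulrC -BE scalerBr scalerA.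
  by rewrite tE [_ * (_ / _)]mulrC divfK.
have fK : factorial_ring {mpoly K[n]} by apply: factorial_mpoly; apply: factorial_field.
have [G [H [a [b [E1E a0 b0 GE HE]]]]] := gauss_factor fK j_inj j_frac jE1.
have Gj l : j G@_l = a * A@_l by rewrite -mcoeff_map_mpoly GE mcoeffZ.
have Am : A@_m = t * lc by rewrite /t divfK.
have t0 : t != 0 by have := tN 0; rewrite rmorph0.
have Gm : G@_m * psi = G@_(mlead A) * phi.
  have tpsi : t * j psi = j phi by rewrite tE divfK.
  by apply: j_inj; rewrite !rmorphM !Gj Am -tpsi /lc; ring.
have szphi : (msize phi <= msize (mpoly_swap G))%N.
  apply: leq_trans (msize_swap_ge G m); apply: msize_dvd.
    by rewrite -generic_eq0 Gj Am; do 2?[apply: mulf_neq0 => //].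
  by apply: (mpoly_Euclid phi0 cop); rewrite Gm; apply: dvd_mull.
have szpsi : (msize psi <= msize (mpoly_swap G))%N.
  apply: leq_trans (msize_swap_ge G (mlead A)); apply: msize_dvd.
    by rewrite -generic_eq0 Gj mulf_neq0.
  apply: (mpoly_Euclid psi0 (r := phi)) => [d dpsi dphi|]; first exact: cop.
  by rewrite -Gm; apply: dvd_mull.
have swC p : mpoly_swap (C p) = p%:MP by rewrite /C -mpoly_swapC mpoly_swapK.
have szC p : msize (C p) = msize p.
  by rewrite !mmeasureE; apply/perm_big/msupp_map_mpoly/can_inj/mpolyCK.
have szE1 : (msize (mpoly_swap E1) <= msize (mpoly_swap G))%N.
  have swM p q : mpoly_swap (C p * q%:MP) = p *: C q.
    by rewrite rmorphM /= swC mpoly_swapC mul_mpolyC.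
  have -> : mpoly_swap E1 = mpoly_swap (C phi * psi%:MP) - mpoly_swap (C psi * phi%:MP).
    by apply: rmorphB.
  rewrite !swM.
  apply: leq_trans (msizeD_le _ _) _; rewrite geq_max mmeasureN.
  have szZ (p q : {mpoly K[n]}) : (msize (p *: C q) <= msize q)%N.
    by apply: leq_trans (eq_leq (szC q)); apply: msizeZ_le.
  by apply/andP; split; [apply: leq_trans (szZ _ _) szpsi | apply: leq_trans (szZ _ _) szphi].
have E10 : E1 != 0.
  apply: contraNneq E0 => E10; move: jE1; rewrite E10 rmorph0 -scalerAr mulrC -BE.
  by move/esym/eqP; rewrite mscalerI (negPf jpsi0).
have G0 : G != 0 by apply: contraNneq E10 => G0; rewrite E1E G0 mul0r.
have H0 : H != 0 by apply: contraNneq E10 => H0; rewrite E1E H0 mulr0.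
have sw0 (p : {mpoly {mpoly K[n]}[n]}) : p != 0 -> mpoly_swap p != 0.
  by apply: contraNneq => pz; rewrite -(mpoly_swapK p) pz rmorph0.
have [h HE'] : exists h, mpoly_swap H = h%:MP.
  exists (mpoly_swap H)@_0; apply: msize1_polyC.
  have szM := msizeM (sw0 _ G0) (sw0 _ H0).
  rewrite -rmorphM -E1E in szM.
  apply: (@addn_pred_le_r (msize (mpoly_swap G)) (msize (mpoly_swap H))).
    exact: leq_trans (eq_leq (esym szM)) szE1.
  by rewrite -lt0n; apply: leq_trans szpsi; rewrite msize_gt0.
have {HE'} HC : H = C h by rewrite -[LHS]mpoly_swapK HE' mpoly_swapC.
have h0 : h != 0 by apply: contraNneq H0 => h0; rewrite HC h0 /C rmorph0.
have hE : lift h = (b * j psi) *: B by rewrite -jC -HC HE scalerA.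
have bj0 : b * j psi != 0 by rewrite mulf_neq0.
have BhE : B = (b * j psi)^-1 *: lift h by rewrite hE scalerA mulVf // scale1r.
have [hphi hpsi] : divides h phi /\ divides h psi.
  apply: (dvd_descend_pair tN); exists ((b * j psi)^-1 *: A).
  by rewrite -!scalerAl [A * _]mulrC scalerAl -BhE; apply: BE.
have szh : (msize h <= 1)%N by rewrite leqNgt; apply/negP; apply: cop.
have hc := msize1_polyC szh; set c := h@_0 in hc.
have c0 : c != 0 by apply: contraNneq h0 => c0; rewrite hc c0 rmorph0.
exists ((b * j psi)^-1 * kap c); first by rewrite mulf_neq0 ?invr_eq0 // fmorph_eq0.
by rewrite BE BhE hc /lift map_mpolyC -scalerAl mul_mpolyC scalerA.
Qed.

End Pencil.
End GenericPoint.

(** * Polynomials composed with a pencil *)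

Section Composed.
Variables (K : fieldType) (n : nat).
Implicit Types P Q phi psi : {mpoly K[n]}.

Definition binary_form_in phi psi d P : Prop :=
  exists h : {mpoly K[2]}, h \is d.-homog /\ P = h \mPo [tuple phi; psi].

Lemma binary_form_const phi psi c : binary_form_in phi psi 0 c%:MP.
Proof.
exists c%:MP; split; last by rewrite comp_mpolyC.
by rewrite -[c%:MP]mulr1 mul_mpolyC; apply: dhomogZ; apply: dhomog1.
Qed.

Lemma binary_formD phi psi d P Q : binary_form_in phi psi d P ->
  binary_form_in phi psi d Q -> binary_form_in phi psi d (P + Q).
Proof.
move=> [h1 [hh1 ->]] [h2 [hh2 ->]]; exists (h1 + h2).
by split; [apply: dhomogD | rewrite comp_mpolyD].
Qed.

Lemma binary_formZ phi psi d c P : binary_form_in phi psi d P ->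
  binary_form_in phi psi d (c *: P).
Proof.
by move=> [h [hh ->]]; exists (c *: h); split; [apply: dhomogZ | rewrite comp_mpolyZ].
Qed.

Lemma binary_formM phi psi d e P Q : binary_form_in phi psi d P ->
  binary_form_in phi psi e Q -> binary_form_in phi psi (d + e) (P * Q).
Proof.
move=> [h1 [hh1 ->]] [h2 [hh2 ->]]; exists (h1 * h2).
by split; [apply: dhomogM | rewrite rmorphM].
Qed.

Lemma binary_form_linear phi psi a b :
  binary_form_in phi psi 1 (a *: phi + b *: psi).
Proof.
apply: binary_formD; apply: binary_formZ.
  by exists 'X_ord0; split; [rewrite dhomogX; apply/eqP/mdeg1 | rewrite comp_mpolyXU].
by exists 'X_(lift ord0 ord0); split; [rewrite dhomogX; apply/eqP/mdeg1 | rewrite comp_mpolyXU].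
Qed.

(** Being a form of degree [d] depends only on the span of [phi] and [psi]. *)
Lemma binary_form_ind phi psi phi' psi' d P :
  binary_form_in phi' psi' 1 phi -> binary_form_in phi' psi' 1 psi ->
  binary_form_in phi psi d P -> binary_form_in phi' psi' d P.
Proof.
move=> Hphi Hpsi [h [/dhomogP hh ->]].
have powF Q e : binary_form_in phi' psi' 1 Q -> binary_form_in phi' psi' e (Q ^+ e).
  move=> HQ; elim: e => [|e IH]; first by rewrite expr0 -mpolyC1; apply: binary_form_const.
  by rewrite exprS -add1n; apply: binary_formM.
have H0 : binary_form_in phi' psi' d 0.
  by exists 0; split; [apply: rpred0 | rewrite comp_mpoly0].
rewrite comp_mpolyE big_seq.
apply: (big_ind (binary_form_in phi' psi' d)) => //.
  exact: binary_formD.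
move=> m /hh dm'; have dm : mdeg m = d by exact: dm'.
rewrite !big_ord_recl big_ord0 mulr1; apply: binary_formZ.
have <- : (m ord0 + m (lift ord0 ord0))%N = d.
  by rewrite -dm mdegE !big_ord_recl big_ord0 addn0.
by apply: binary_formM; apply: powF; rewrite !(tnth_nth 0).
Qed.

Lemma msize_lin_le a b P Q N : (msize P <= N)%N -> (msize Q <= N)%N ->
  (msize (a *: P + b *: Q) <= N)%N.
Proof.
move=> PN QN; apply: leq_trans (msizeD_le _ _) _; rewrite geq_max.
by apply/andP; split; apply: leq_trans (msizeZ_le _ _) _.
Qed.

Lemma dvd_lin d P Q a b : divides d P -> divides d Q -> divides d (a *: P + b *: Q).
Proof. by move=> dP dQ; rewrite -!mul_mpolyC; apply: dvdD; apply: dvdMl. Qed.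

Lemma cramer2 (P Q : {mpoly K[n]}) a1 b1 a2 b2 : a1 * b2 - a2 * b1 != 0 ->
  exists u1 v1 u2 v2,
    P = u1 *: (a1 *: P + b1 *: Q) + v1 *: (a2 *: P + b2 *: Q) /\
    Q = u2 *: (a1 *: P + b1 *: Q) + v2 *: (a2 *: P + b2 *: Q).
Proof.
move=> D0; set D := (_ - _) in D0.
exists (b2 / D), (- b1 / D), (- a2 / D), (a1 / D).
rewrite !scalerDr !scalerA; split.
  rewrite addrACA -!scalerDl [X in X *: P](_ : _ = 1) ?[X in X *: Q](_ : _ = 0).
  - by rewrite scale1r scale0r addr0.
  - by rewrite /D; field.
  - by rewrite /D; field.
rewrite addrACA -!scalerDl [X in X *: P](_ : _ = 0) ?[X in X *: Q](_ : _ = 1).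
- by rewrite scale1r scale0r add0r.
- by rewrite /D; field.
- by rewrite /D; field.
Qed.

Lemma proportional (a b a1 b1 : K) : (a != 0) || (b != 0) -> a1 * b = a * b1 ->
  exists e, a1 = e * a /\ b1 = e * b.
Proof.
have [-> /= b0|a0 _ E] := eqVneq a 0; last first.
  by exists (a1 / a); rewrite divfK // mulrAC E mulrAC mulfV // mul1r.
rewrite mul0r => /eqP; rewrite mulf_eq0 (negPf b0) orbF => /eqP ->.
by exists (b1 / b); rewrite mulr0 divfK.
Qed.

Section Pencil.
Variables (phi psi : {mpoly K[n]}).
Hypothesis cop : coprime_mpoly phi psi.
Hypothesis indep : forall a b, a *: phi + b *: psi = 0 -> a = 0 /\ b = 0.

Let mem c := phi - c *: psi.

Lemma pencil_memberB c c' : mem c - mem c' = (c' - c) *: psi.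
Proof. by rewrite /mem opprB addrC addrA subrK -scalerBl. Qed.

Lemma pencil_member_form c : binary_form_in phi psi 1 (mem c).
Proof. by have := binary_form_linear phi psi 1 (- c); rewrite scale1r scaleNr. Qed.

Lemma pencil_member_neq0 c : mem c != 0.
Proof.
apply/eqP => E; have [|/eqP] := indep (a := 1) (b := - c); last by rewrite oner_eq0.
by rewrite scale1r scaleNr.
Qed.

Lemma pencil_member_coprime c d : divides d (mem c) -> divides d psi -> ~ nonconstant d.
Proof.
move=> dc dpsi; apply: cop => //.
by rewrite -[phi](subrK (c *: psi)); apply: dvdD => //; rewrite -mul_mpolyC; apply: dvdMl.
Qed.

Lemma pencil_members_coprime c c' d : c != c' -> divides d (mem c) ->
  divides d (mem c') -> ~ nonconstant d.
Proof.
move=> cc' dc dc'; apply: (pencil_member_coprime dc).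
have -> : psi = ((c' - c)^-1)%:MP * (mem c - mem c').
  rewrite pencil_memberB mul_mpolyC scalerA mulVf ?scale1r //.
  by rewrite subr_eq0 eq_sym.
by apply: dvdMl; apply: dvdB.
Qed.

(** If two members were constant, all would be, and the generators would be
    dependent. *)
Lemma pencil_member_nonconstant : exists s : seq K, forall c, c \notin s -> nonconstant (mem c).
Proof.
have [[c0 nc0]|H] := classic (exists c0, ~ nonconstant (mem c0)); last first.
  by exists [::] => c _; apply: NNPP => nc; apply: H; exists c.
exists [:: c0] => c; rewrite inE => cc0; apply: NNPP => nc.
have memC c' : ~ nonconstant (mem c') -> exists e, mem c' = e%:MP.
  by move=> /negP; rewrite -leqNgt => /msize1_polyC E; exists (mem c')@_0.
have [e eE] := memC c nc; have [e0 e0E] := memC c0 nc0.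
have psiE : (c0 - c) *: psi = (e - e0)%:MP.
  by rewrite mpolyCB -eE -e0E pencil_memberB.
have c0c : c0 - c != 0 by rewrite subr_eq0 eq_sym.
have [w psiw] : exists w, psi = w%:MP.
  exists ((c0 - c)^-1 * (e - e0)).
  by rewrite mpolyCM mul_mpolyC -psiE scalerA mulVf // scale1r.
have phiw : phi = (e + c * w)%:MP.
  by rewrite mpolyCD mpolyCM -eE -psiw mul_mpolyC /mem subrK.
have [|w0 _] := indep (a := w) (b := - (e + c * w)).
  by rewrite phiw psiw -!mul_mpolyC -!mpolyCM -mpolyCD mulNr mulrC subrr.
have [|_ /eqP] := indep (a := 0) (b := 1); last by rewrite oner_eq0.
by rewrite psiw w0 !scale0r scaler0 addr0.
Qed.

(** Infinitely many members are those that escape every finite list. *)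
Definition pencil_infinite P Q : Prop := forall s : seq K, exists c a b,
  [/\ c \notin s, (a != 0) || (b != 0) & divides (mem c) (a *: P + b *: Q)].

(** Distinct members are coprime, so that the product of many of them would
    divide [P]. *)
Lemma pencil_members_dvd (s0 : seq K) P : P != 0 ->
  (forall c, c \notin s0 -> nonconstant (mem c)) ->
  ~ (forall s : seq K, exists2 c, c \notin s & divides (mem c) P).
Proof.
move=> P0 nc H.
suff [R szR RP] : exists2 R, (msize P < msize R)%N & divides R P.
  by have := msize_dvd P0 RP; rewrite leqNgt szR.
suff [s [R [ss0 RE szR RP]]] : exists s R, [/\ forall c, c \in s -> c \notin s0,
    R = \prod_(c <- s) mem c, (msize P < msize R)%N & divides R P] by exists R.
elim: (msize P) => [|N [s [R [ss0 RE szR RP]]]].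
  by exists [::], 1; rewrite big_nil msize1; split=> //; exists P; rewrite mulr1.
have [c cN cP] := H (s ++ s0); move: cN; rewrite mem_cat negb_or => /andP[cs cs0].
exists (c :: s), (mem c * R); split.
- by move=> c'; rewrite inE => /predU1P[->|/ss0].
- by rewrite big_cons RE.
- rewrite mulrC (leq_trans _ (msize_mul_lt (nc c cs0) _)) //.
  by rewrite -msize_gt0 (leq_trans _ szR).
have [T PE] := RP; suff [T' TE] : divides (mem c) T.
  by exists T'; rewrite PE TE mulrA.
have : divides (mem c) (T * R) by rewrite -PE.
rewrite RE; elim: s cs {ss0 RE szR RP} => [|c' s IH]; first by rewrite big_nil mulr1.
rewrite inE negb_or => /andP[cc' cs]; rewrite big_cons mulrCA [mem c' * _]mulrC => H'.
apply: IH => //; apply: (mpoly_Euclid (pencil_member_neq0 c) _ H') => d dc dc'.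
exact: pencil_members_coprime cc' dc dc'.
Qed.

(** By induction on the degrees. Some combinations [P2 * mem c1] and [Q2 * mem
    c2] of [P] and [Q] are divisible by members of the pencil and independent.
    Modulo a third member [mem c], both [mem c1] and [mem c2] are multiples of
    [psi]; hence [mem c] divides a combination of [P2] and [Q2] whenever it
    divides a combination of [P] and [Q], and the induction applies to the
    coprime pair [P2], [Q2]. *)
Lemma pencil_composition P Q : coprime_mpoly P Q -> pencil_infinite P Q ->
  exists d, binary_form_in phi psi d P /\ binary_form_in phi psi d Q.
Proof.
have [s0 nc] := pencil_member_nonconstant.
have [N] := ubnP (maxn (msize P) (msize Q)); elim: N P Q => // N IH P Q.
rewrite ltnS => szPQ copPQ infPQ.
have constE R : ~ nonconstant R -> exists e, R = e%:MP.
  by move=> /negP; rewrite -leqNgt => /msize1_polyC E; exists R@_0.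
have [[a [b [ab0 abE]]]|indepPQ] := classic (exists a b,
    (a != 0) || (b != 0) /\ a *: P + b *: Q = 0).
  have const_of u v (S T : {mpoly K[n]}) : coprime_mpoly S T -> v != 0 ->
      u *: S + v *: T = 0 -> (exists e, S = e%:MP) /\ (exists e, T = e%:MP).
    move=> copST v0 E; have TE : T = (- (v^-1 * u)) *: S.
      rewrite scaleNr -scalerA -[u *: S](addrK (v *: T)) E sub0r scalerN opprK.
      by rewrite scalerA mulVf // scale1r.
    have [e SE] : exists e, S = e%:MP.
      apply: constE; apply: copST; first exact: dvd_refl.
      by rewrite TE -mul_mpolyC; apply: dvd_mull.
    by split; [exists e | exists (- (v^-1 * u) * e); rewrite TE {1}SE -mul_mpolyC mpolyCM].
  have [[e PE] [e' QE]] : (exists e, P = e%:MP) /\ (exists e, Q = e%:MP).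
    case/orP: ab0 => [a0|b0]; last exact: const_of abE.
    have copQP : coprime_mpoly Q P by move=> d dQ dP; apply: copPQ.
    have abE' : b *: Q + a *: P = 0 by rewrite addrC.
    by have [] := const_of _ _ _ _ copQP a0 abE'; split.
  by exists 0%N; rewrite PE QE; split; apply: binary_form_const.
have comb0 a b : (a != 0) || (b != 0) -> a *: P + b *: Q != 0.
  by move=> ab0; apply/eqP => E; apply: indepPQ; exists a, b.
have [c1 [a1 [b1 [c1s0 ab1 dvd1]]]] := infPQ s0.
have [c2 [a2 [b2 [c2s dvd2 D0]]]] : exists c2 a2 b2,
    [/\ c2 \notin s0, divides (mem c2) (a2 *: P + b2 *: Q) & a1 * b2 - a2 * b1 != 0].
  apply: NNPP => H; apply: (pencil_members_dvd (comb0 _ _ ab1) nc) => s.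
  have [c [a [b [cs ab0 cab]]]] := infPQ (s ++ s0).
  move: cs; rewrite mem_cat negb_or => /andP[cs cs0].
  exists c => //; have D0 : a1 * b - a * b1 = 0.
    by apply/eqP/negP => D0; apply: H; exists c, a, b; split=> //; apply/negP.
  have [e [-> ->]] : exists e, a1 = e * a /\ b1 = e * b.
    by apply: proportional => //; apply/eqP; rewrite -subr_eq0 D0.
  by rewrite -!scalerA -scalerDr -mul_mpolyC; apply: dvdMl.
have ab2 : (a2 != 0) || (b2 != 0).
  rewrite -negb_and; apply: contra D0 => /andP[/eqP -> /eqP ->].
  by rewrite mulr0 mul0r subrr.
have [P2 P2E] : exists P2 : {mpoly K[n]}, a1 *: P + b1 *: Q = P2 * mem c1 by [].
have [Q2 Q2E] : exists Q2 : {mpoly K[n]}, a2 *: P + b2 *: Q = Q2 * mem c2 by [].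
have shrink a b c (T : {mpoly K[n]}) : (a != 0) || (b != 0) -> c \notin s0 ->
    a *: P + b *: Q = T * mem c -> (msize T < N)%N.
  move=> ab0 cs0 E; have T0 : T != 0.
    by apply: contraNneq (comb0 _ _ ab0) => T0; rewrite E T0 mul0r.
  apply: leq_trans (msize_mul_lt (nc _ cs0) T0) _; rewrite -E.
  by apply: leq_trans szPQ; apply: msize_lin_le; rewrite ?leq_maxl ?leq_maxr.
have [u1 [v1 [u2 [v2 [PE QE]]]]] := cramer2 P Q D0.
rewrite P2E Q2E in PE QE.
have [|||d [HP2 HQ2]] := IH P2 Q2.
- by rewrite gtn_max (shrink _ _ _ _ ab1 c1s0 P2E) (shrink _ _ _ _ ab2 c2s Q2E).
- move=> d dP2 dQ2; apply: copPQ.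
    by rewrite PE; apply: dvd_lin; apply: dvdMr.
  by rewrite QE; apply: dvd_lin; apply: dvdMr.
- move=> s; have [c [a [b [cs ab0 cab]]]] := infPQ (c1 :: c2 :: s).
  move: cs; rewrite !inE !negb_or => /and3P[cc1 cc2 cs].
  (* coordinates of the given combination with respect to the two chosen ones *)
  pose a' := a * u1 + b * u2; pose b' := a * v1 + b * v2.
  have abE : a *: P + b *: Q = (a' *: P2) * mem c1 + (b' *: Q2) * mem c2.
    by rewrite {1}PE {1}QE !scalerDr !scalerA addrACA -!scalerDl -!scalerAl.
  have ab'0 : (a' != 0) || (b' != 0).
    rewrite -negb_and; apply: contra (comb0 _ _ ab0) => /andP[/eqP a'0 /eqP b'0].
    by rewrite abE a'0 b'0 !scale0r !mul0r addr0.
  exists c, (a' * (c - c1)), (b' * (c - c2)); split=> //.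
    by rewrite !mulf_eq0 !subr_eq0 (negPf cc1) (negPf cc2) !orbF.
  apply: (mpoly_Euclid (pencil_member_neq0 c) (r := psi)) => [d|].
    exact: pencil_member_coprime.
  have memE c' : mem c' = mem c + (c - c') *: psi.
    by rewrite -pencil_memberB addrC subrK.
  (* multiplying by [psi] turns its multiples into [mem c1] and [mem c2] *)
  have -> : ((a' * (c - c1)) *: P2 + (b' * (c - c2)) *: Q2) * psi =
      a *: P + b *: Q - (a' *: P2 + b' *: Q2) * mem c.
    rewrite abE (memE c1) (memE c2) -!mul_mpolyC !mpolyCM.
    by move: (mem c) (c - c1)%:MP (c - c2)%:MP => *; ring.
  by apply: dvdB => //; apply: dvd_mull.
exists (d + 1)%N; split; [rewrite PE | rewrite QE].
  by apply: binary_formD; apply: binary_formZ; apply: binary_formM => //;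
    apply: pencil_member_form.
by apply: binary_formD; apply: binary_formZ; apply: binary_formM => //;
  apply: pencil_member_form.
Qed.

End Pencil.
End Composed.

(** * The theorem of Bertini and Krull for one parameter *)

Lemma exists_nonroot (K : closedFieldType) n (p : {mpoly K[n]}) : p != 0 ->
  exists v : 'I_n -> K, p.@[v] != 0.
Proof.
move=> p0; pose N := msize p; pose q := kronecker N p.
have q0 : q != 0.
  apply: contraNneq p0 => q0; apply/eqP/mpolyP => m; rewrite mcoeff0.
  have [ltm|gem] := ltnP (mdeg m) N; last exact/memN_msupp_eq0/msize_mdeg_ge.
  by rewrite -(kronecker_coef (leqnn _) ltm) -/q q0 coef0.
have [y] := closed_nonrootP _ q0; rewrite rootE => qy.
exists (fun i => y ^+ (N ^ i)); apply: contra qy => /eqP <-; apply/eqP.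
apply: (mpoly_rmorph_ext (f := horner_eval y \o @kronecker K n N)
  (g := meval (fun i => y ^+ (N ^ i)))) => [c|l] /=.
  by rewrite /kronecker mmapC /horner_eval hornerC mevalC.
by rewrite /kronecker mmapX mmap1U /horner_eval hornerXn mevalXU.
Qed.

Section OneParameter.
Variables (K : closedFieldType) (n : nat) (k : fieldType).
Variable j : {rmorphism {mpoly K[n]} -> k}.
Hypothesis j_inj : injective j.
Hypothesis j_frac : forall t, exists p q, j q != 0 /\ t = j p / j q.
Local Notation kap := (generic_const j).
Local Notation x := (generic_coord j).
Local Notation lift := (generic_lift j).

Variables (P Q : {mpoly K[n]}).
Hypotheses (Q0 : Q != 0) (copPQ : coprime_mpoly P Q).
Let tau : k := - (j P / j Q).
Hypothesis tauN : forall e, tau != kap e.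
Let f : {mpoly k[n]} := lift P + tau *: lift Q.

Section Specialize.
Variables (phi psi : {mpoly K[n]}) (B : {mpoly k[n]}).
Hypotheses (psi0 : psi != 0) (indep : forall a b, a *: phi + b *: psi = 0 -> a = 0 /\ b = 0).
Hypothesis fE : f = (lift phi - (j phi / j psi) *: lift psi) * B.

(** Clear the denominators in the factorization of [f] and evaluate the
    coordinates of the generic point at [v]; the factor of the pencil
    survives. *)
Lemma pencil_specialize : exists2 w : {mpoly K[n]}, w != 0 &
  forall v : 'I_n -> K, w.@[v] != 0 ->
  divides (psi.@[v] *: phi - phi.@[v] *: psi) (Q.@[v] *: P - P.@[v] *: Q).
Proof.
have [w [B1 [w0 B1E]]] := clear_denominators j_inj j_frac B.
pose C := map_mpoly (@mpolyC n K) : {mpoly K[n]} -> {mpoly {mpoly K[n]}[n]}.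
pose W (p q : {mpoly K[n]}) := q *: C p - p *: C q.
have jC p : map_mpoly j (C p) = lift p by apply: map_mpoly_map.
have jZ p q : map_mpoly j (q *: C p) = j q *: lift p by rewrite map_mpolyZ jC.
have jW p q : q != 0 -> map_mpoly j (W p q) = j q *: (lift p - (j p / j q) *: lift q).
  move=> q0; have e1 : map_mpoly j (W p q) = map_mpoly j (q *: C p) - map_mpoly j (p *: C q).
    by apply: rmorphB.
  transitivity (j q *: lift p - j p *: lift q); first by rewrite e1; congr (_ - _); apply: jZ.
  by rewrite scalerBr scalerA mulrCA mulfV ?mulr1 // generic_eq0.
have E : (w * psi) *: W P Q = Q *: (W phi psi * B1).
  apply: (map_mpoly_injective j_inj).
  have fE' : lift P - (j P / j Q) *: lift Q = f by rewrite /f /tau scaleNr.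
  have e1 : map_mpoly j ((w * psi) *: W P Q) = j (w * psi) *: (j Q *: f).
    by rewrite map_mpolyZ jW // fE'.
  have e2 : map_mpoly j (W phi psi * B1) = map_mpoly j (W phi psi) * map_mpoly j B1.
    by apply: rmorphM.
  have e3 : map_mpoly j (Q *: (W phi psi * B1)) = j Q *: (map_mpoly j (W phi psi) * map_mpoly j B1).
    by rewrite map_mpolyZ e2.
  rewrite e1 e3 jW // B1E fE -scalerAr -!scalerAl !scalerA rmorphM; congr (_ *: _).
  by rewrite mulrC mulrA.
exists (w * psi * Q); first by rewrite !mulf_neq0.
move=> v; rewrite !mevalM !mulf_eq0 !negb_or => /andP[/andP[wv psiv] Qv].
pose ev := map_mpoly (meval v) : {mpoly {mpoly K[n]}[n]} -> {mpoly K[n]}.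
have evC p : ev (C p) = p.
  apply/mpolyP => m; rewrite /ev /C !mcoeff_map_mpoly; exact: mevalC.
have evZ p q : ev (q *: C p) = q.@[v] *: p by rewrite /ev map_mpolyZ; congr (_ *: _); apply: evC.
have evW p q : ev (W p q) = q.@[v] *: p - p.@[v] *: q.
  by rewrite -!evZ; apply: rmorphB.
have /(congr1 ev) := E.
have -> : ev ((w * psi) *: W P Q) = (w * psi).@[v] *: (Q.@[v] *: P - P.@[v] *: Q).
  by rewrite -evW; apply: map_mpolyZ.
have -> : ev (Q *: (W phi psi * B1)) =
    Q.@[v] *: ((psi.@[v] *: phi - phi.@[v] *: psi) * ev B1).
  rewrite -evW; have <- : ev (W phi psi * B1) = ev (W phi psi) * ev B1 by apply: rmorphM.
  exact: map_mpolyZ.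
move=> Ev; have wpsi0 : (w * psi).@[v] != 0 by rewrite mevalM mulf_neq0.
exists (((w * psi).@[v]^-1 * Q.@[v]) *: ev B1).
by rewrite -scalerAl [ev B1 * _]mulrC -scalerA -Ev scalerA mulVf // scale1r.
Qed.

(** A general [v] avoids the zero sets of the finitely many members to be
    excluded, so that its ratio [phi / psi] is not among them. *)
Lemma pencil_infinite_generic : pencil_infinite phi psi P Q.
Proof.
have [w w0 wP] := pencil_specialize.
move=> s; pose u := w * psi * Q * \prod_(c <- s) (phi - c *: psi).
have u0 : u != 0.
  rewrite !mulf_neq0 // prodf_seq_neq0; apply/allP => c _; apply/implyP => _.
  exact: pencil_member_neq0.
have [v] := exists_nonroot u0; rewrite !mevalM !mulf_eq0 !negb_or.
move=> /andP[/andP[/andP[wv psiv] Qv] sv].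
pose c := phi.@[v] / psi.@[v].
exists c, (Q.@[v]), (- P.@[v]); split; last 1 first.
- have -> : phi - c *: psi = psi.@[v]^-1 *: (psi.@[v] *: phi - phi.@[v] *: psi).
    by rewrite scalerBr !scalerA mulVf // scale1r mulrC.
  by apply: dvdZ; rewrite ?invr_eq0 // scaleNr; apply: wP.
- apply: contra sv => cs; rewrite rmorph_prod prodf_seq_eq0; apply/hasP.
  by exists c => //=; rewrite mevalB mevalZ divfK // subrr.
- by rewrite Qv.
Qed.

End Specialize.

Variables (M : closedFieldType) (i : {rmorphism k -> M}).
Variables (A B : {mpoly k[n]}).
Hypotheses (Ax : A.@[x] = 0) (fAB : f = A * B) (irrA : mirreducible (map_mpoly i A)).

(** Some ratio of coefficients of [A] is not constant; written as the reduced
    fraction [phi / psi] it generates the pencil of which [A] is the generic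
    member. The specializations of [A] are then members of the pencil that
    divide combinations of [P] and [Q], which makes these forms in [phi] and
    [psi]. *)
Lemma one_parameter : exists phi psi d,
  [/\ coprime_mpoly phi psi, psi != 0 /\ (forall a b, a *: phi + b *: psi = 0 -> a = 0 /\ b = 0),
      (msize phi <= msize A)%N /\ (msize psi <= msize A)%N,
      binary_form_in phi psi d P /\ binary_form_in phi psi d Q
    & (forall e, j phi / j psi != kap e) /\
      mirreducible (map_mpoly i (lift phi - (j phi / j psi) *: lift psi))].
Proof.
have Af : divides A f by rewrite fAB; apply: dvd_mulr.
have [m tN] := nonconstant_ratio j_inj Ax irrA.
have [phi [psi [psi0 tE cop]]] := coprime_fraction j_inj j_frac (A@_m / mleadc A).
have [c c0 AE] := pencil_generator j_inj j_frac Q0 tauN Ax Af irrA psi0 tE tN cop.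
rewrite tE in tN AE; set t := j phi / j psi in tN AE *.
have indep a b : a *: phi + b *: psi = 0 -> a = 0 /\ b = 0.
  move=> E; have [a0|a0] := eqVneq a 0.
    split=> //; move/eqP: E; rewrite a0 scale0r add0r mscalerI (negPf psi0) orbF.
    by move/eqP.
  have /eqP[] := tN (- (a^-1 * b)).
  have phiE : phi = (- (a^-1 * b)) *: psi.
    rewrite scaleNr -scalerA -[b *: psi](addKr (a *: phi)) E addr0 scalerN opprK.
    by rewrite scalerA mulVf // scale1r.
  rewrite /t {1}phiE -mul_mpolyC rmorphM mulfK // generic_eq0 //.
have coefE l : (phi@_l != 0) || (psi@_l != 0) -> l \in msupp A.
  move=> phipsi; rewrite mcoeff_msupp; apply: contraTneq phipsi => Al0.
  have E : kap phi@_l = t * kap psi@_l.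
    apply/eqP; rewrite -subr_eq0; apply/eqP; have := congr1 (mcoeff l) AE.
    by rewrite mcoeffB !mcoeffZ Al0 mulr0 !mcoeff_map_mpoly.
  have [psil|psil] := eqVneq psi@_l 0.
    by move/eqP: E; rewrite psil rmorph0 mulr0 fmorph_eq0 orbF negbK.
  have /eqP[] := tN (phi@_l / psi@_l).
  by rewrite fmorph_div E mulfK // fmorph_eq0.
have szA (p : {mpoly K[n]}) : (forall l, p@_l != 0 -> l \in msupp A) -> (msize p <= msize A)%N.
  move=> pA; rewrite [msize p]mmeasureE; apply/bigmax_leqP_seq => l lp _.
  by apply: msize_mdeg_lt; apply: pA; rewrite -mcoeff_msupp.
have fE : f = (lift phi - t *: lift psi) * (c^-1 *: B).
  by rewrite AE -scalerAr -scalerAl scalerA mulVf // scale1r.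
have inf := pencil_infinite_generic psi0 indep fE.
have [d forms] := pencil_composition cop indep copPQ inf.
exists phi, psi, d; split=> //.
  by split; apply: szA => l l0; apply: coefE; rewrite l0 ?orbT.
split=> //; rewrite AE map_mpolyZ; have [nA noA] := irrA.
have ic0 : i c != 0 by rewrite fmorph_eq0.
split; first by rewrite /nonconstant msizeZ.
move=> [C [D [nC nD E]]]; apply: noA; exists ((i c)^-1 *: C), D; split=> //.
  by rewrite /nonconstant msizeZ // invr_eq0.
by rewrite -scalerAl -E scalerA mulVf // scale1r.
Qed.

End OneParameter.

(** * Weights *)

Section Weights.
Import Order.TTheory Num.Theory.
Variables (n : nat) (w : 'I_n -> int).

Definition wt (m : 'X_{1..n}) : int := \sum_(i < n) w i * (m i)%:Z.

Lemma wtD m1 m2 : wt (m1 + m2)%MM = wt m1 + wt m2.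
Proof.
rewrite /wt -big_split; apply: eq_bigr => i _.
by rewrite mnmDE PoszD mulrDr.
Qed.

Variable R : idomainType.
Implicit Types p q A B : {mpoly R[n]}.

Definition whomog (c : int) p : Prop := forall m, m \in msupp p -> wt m = c.

Definition wcomp (c : int) p : {mpoly R[n]} :=
  \sum_(m <- msupp p | wt m == c) p@_m *: 'X_[m].

Lemma mcoeff_wcomp c p m : (wcomp c p)@_m = if wt m == c then p@_m else 0.
Proof.
rewrite /wcomp raddf_sum /=.
have [mp|mNp] := boolP (m \in msupp p); last first.
  rewrite (memN_msupp_eq0 mNp) if_same big_seq_cond big1 // => m' /andP[m'p _].
  rewrite mcoeffZ mcoeffX; case: eqP => [E|_]; last by rewrite mulr0.
  by rewrite -E m'p in mNp.
case: ifP => wm.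
  rewrite big_mkcond (bigD1_seq m) ?msupp_uniq //= wm.
  rewrite mcoeffZ mcoeffX eqxx mulr1 big1 ?addr0 // => m' /negPf m'm.
  by case: ifP => // _; rewrite mcoeffZ mcoeffX m'm mulr0.
rewrite big1 // => m' /eqP wm'; rewrite mcoeffZ mcoeffX.
by case: eqP => [E|_]; [rewrite -wm' E eqxx in wm | rewrite mulr0].
Qed.

Lemma wcomp_whomog c p : whomog c (wcomp c p).
Proof.
by move=> m; rewrite mcoeff_msupp mcoeff_wcomp; case: ifP => [/eqP //|_]; rewrite eqxx.
Qed.

Lemma wcompD c p q : wcomp c (p + q) = wcomp c p + wcomp c q.
Proof.
by apply/mpolyP => m; rewrite mcoeffD !mcoeff_wcomp mcoeffD; case: ifP; rewrite ?addr0.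
Qed.

Lemma wcompZ c a p : wcomp c (a *: p) = a *: wcomp c p.
Proof.
by apply/mpolyP => m; rewrite mcoeffZ !mcoeff_wcomp mcoeffZ; case: ifP; rewrite ?mulr0.
Qed.

Lemma wcomp_id c p : whomog c p -> wcomp c p = p.
Proof.
move=> hp; apply/mpolyP => m; rewrite mcoeff_wcomp; case: eqP => // wm.
by rewrite memN_msupp_eq0 //; apply/negP => /hp.
Qed.

Lemma wcomp_ne c p : (forall m, m \in msupp p -> wt m != c) -> wcomp c p = 0.
Proof.
move=> hp; apply/mpolyP => m; rewrite mcoeff_wcomp mcoeff0; case: ifP => // wm.
by rewrite memN_msupp_eq0 //; apply/negP => /hp; rewrite wm.
Qed.

Lemma whomogX m : whomog (wt m) ('X_[m] : {mpoly R[n]}).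
Proof. by move=> m'; rewrite msuppX inE => /eqP ->. Qed.

Lemma whomogD c p q : whomog c p -> whomog c q -> whomog c (p + q).
Proof. by move=> hp hq m /msuppD_le; rewrite mem_cat => /orP[/hp|/hq]. Qed.

Lemma whomogZ c a p : whomog c p -> whomog c (a *: p).
Proof. by move=> hp m /msuppZ_le /hp. Qed.

Lemma msuppM_ex p q m : m \in msupp (p * q) ->
  exists m1 m2, [/\ m1 \in msupp p, m2 \in msupp q & m = (m1 + m2)%MM].
Proof. by move/msuppM_le => /allpairsP[[m1 m2] [h1 h2 ->]]; exists m1, m2. Qed.

Lemma whomogM a b p q : whomog a p -> whomog b q -> whomog (a + b) (p * q).
Proof.
by move=> hp hq m /msuppM_ex[m1 [m2 [/hp <- /hq <- ->]]]; rewrite wtD.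
Qed.

Lemma whomog_exp a p e : whomog a p -> whomog (a *+ e) (p ^+ e).
Proof.
move=> hp; elim: e => [|e IH].
  rewrite expr0 mulr0n => m; rewrite msupp1 inE => /eqP ->.
  by rewrite /wt big1 // => i _; rewrite mnm0E mulr0.
by rewrite exprS mulrS; apply: whomogM.
Qed.

Lemma wcompM a c p q : whomog a p -> wcomp c (p * q) = p * wcomp (c - a) q.
Proof.
move=> hp; rewrite -[in LHS](addrNK (wcomp (c - a) q) q) mulrDr wcompD.
rewrite [X in X + _]wcomp_ne ?add0r => [|m].
  rewrite wcomp_id //; have -> : c = a + (c - a) by rewrite addrC subrK.
  by apply: whomogM => //; rewrite addrAC subrr add0r; apply: wcomp_whomog.
case/msuppM_ex => m1 [m2 [/hp wm1]]; rewrite mcoeff_msupp mcoeffB mcoeff_wcomp => m2q ->.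
rewrite wtD wm1; apply: contraNneq m2q => wm2.
by rewrite -wm2 addrAC subrr add0r eqxx subrr.
Qed.

Lemma exists_max_wt (s : seq 'X_{1..n}) m0 : m0 \in s ->
  exists2 m, m \in s & forall m', m' \in s -> wt m' <= wt m.
Proof.
elim: s m0 => // m1 s IH m0 _; case: s IH => [|m2 s] IH.
  by exists m1; rewrite ?inE // => m'; rewrite inE => /eqP ->.
have [m ms maxm] := IH m2 (mem_head _ _).
have [le|lt] := leP (wt m) (wt m1).
  exists m1; rewrite ?mem_head // => m'; rewrite inE => /predU1P[->//|/maxm le'].
  exact: le_trans le' le.
exists m; first by rewrite inE ms orbT.
move=> m'; rewrite inE => /predU1P[->|/maxm//].
exact: ltW.
Qed.

(** The product of the components of largest weight does not vanish, and no
    other term of [A * B] reaches its weight. *)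
Lemma wt_max_mul A B : A != 0 -> B != 0 -> exists mA mB m,
  [/\ mA \in msupp A /\ (forall m', m' \in msupp A -> wt m' <= wt mA),
      mB \in msupp B /\ (forall m', m' \in msupp B -> wt m' <= wt mB)
    & m \in msupp (A * B) /\ wt m = wt mA + wt mB].
Proof.
move=> A0 B0; have [mA mAs maxA] := exists_max_wt (mlead_supp A0).
have [mB mBs maxB] := exists_max_wt (mlead_supp B0).
set a := wt mA in maxA *; set b := wt mB in maxB *.
have top (C : {mpoly R[n]}) mC : mC \in msupp C -> wcomp (wt mC) C != 0.
  rewrite mcoeff_msupp; apply: contraNneq => /mpolyP/(_ mC).
  by rewrite mcoeff_wcomp eqxx mcoeff0 => ->.
have AB1 : wcomp a A * wcomp b B != 0 by apply: mulf_neq0; apply: top.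
have m1 := mlead_supp AB1; set m := mlead _ in m1.
have wm : wt m = a + b.
  by apply: (whomogM _ _ m1); apply: wcomp_whomog.
exists mA, mB, m; split=> //; split=> //.
have E : A * B = wcomp a A * wcomp b B + (wcomp a A * (B - wcomp b B) + (A - wcomp a A) * B).
  by ring.
rewrite mcoeff_msupp E mcoeffD [X in _ + X]memN_msupp_eq0 ?addr0 -?mcoeff_msupp //.
have low (C : {mpoly R[n]}) c m' : (forall m'', m'' \in msupp C -> wt m'' <= c) ->
    m' \in msupp (C - wcomp c C) -> wt m' < c.
  move=> maxC; rewrite mcoeff_msupp mcoeffB mcoeff_wcomp; case: ifP => [_|ne].
    by rewrite subrr eqxx.
  rewrite subr0 -mcoeff_msupp => /maxC.
  by rewrite le_eqVlt ne.
apply/negP => /msuppD_le; rewrite mem_cat => /orP[] /msuppM_ex[m2 [m3 [h2 h3 mE]]].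
  have : wt m < a + b.
    rewrite mE wtD (wcomp_whomog h2).
    by rewrite ltrD2l; apply: low h3.
  by rewrite wm ltxx.
have : wt m < a + b by rewrite mE wtD ltr_leD // ?(low _ _ _ maxA h2) ?maxB.
by rewrite wm ltxx.
Qed.

End Weights.

Section WeightFactors.
Import Order.TTheory Num.Theory.
Variables (n : nat) (R : idomainType).
Implicit Types (A B : {mpoly R[n]}) (w : 'I_n -> int).

Lemma wtN w m : wt (fun i => - w i) m = - wt w m.
Proof. by rewrite /wt -sumrN; apply: eq_bigr => i _; rewrite mulNr. Qed.

(** Both the largest and the smallest weights of the factors add up to those
    of the product, which coincide. *)
Lemma whomog_factor w c A B : A * B != 0 -> whomog w c (A * B) ->
  exists a, whomog w a A.
Proof.
move=> AB0 hAB; have /andP[A0 B0] : (A != 0) && (B != 0).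
  by rewrite -negb_or -mulf_eq0.
have [mA [mB [m [[mAs maxA] [mBs maxB] [ms wm]]]]] := wt_max_mul w A0 B0.
have [nA [nB [m' [[nAs minA] [nBs minB] [m's wm']]]]] :=
  wt_max_mul (fun i => - w i) A0 B0.
rewrite (hAB _ ms) in wm; rewrite !wtN (hAB _ m's) in wm'.
have leA := maxA _ nAs; have leB := maxB _ nBs.
have E : wt w nA = wt w mA by lia.
exists (wt w mA) => m1 m1s; apply/le_anti; rewrite maxA //=.
by have := minA _ m1s; rewrite !wtN lerN2 E.
Qed.

Lemma wt_coord (i : 'I_n) m : wt (fun k => Posz (k == i)) m = Posz (m i).
Proof.
rewrite /wt (bigD1 i) //= eqxx mul1r big1 ?addr0 // => k /negPf ->.
by rewrite mul0r.
Qed.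

Lemma single_support A m : A != 0 -> (forall m', m' \in msupp A -> m' = m) ->
  A = A@_m *: 'X_[m].
Proof.
move=> A0 sA; have mE := sA _ (mlead_supp A0).
apply/mpolyP => m'; rewrite mcoeffZ mcoeffX; case: eqP => [->|ne]; first by rewrite mulr1.
rewrite mulr0; apply: memN_msupp_eq0; apply/negP => /sA E.
by case: ne.
Qed.

(** A monomial is homogeneous for each of the coordinate weights. *)
Lemma monomial_factor A B c m : c != 0 -> A * B = c *: 'X_[m] ->
  exists a mA, a != 0 /\ A = a *: 'X_[mA].
Proof.
move=> c0 E; have AB0 : A * B != 0 by rewrite E mscalerI negb_or c0 -msize_poly_eq0 msizeX.
have A0 : A != 0 by apply: contraNneq AB0 => ->; rewrite mul0r.
exists (mleadc A), (mlead A); rewrite mleadc_eq0; split=> //.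
apply: single_support => // m' m'A; apply/mnmP => i.
have [|a hA] := @whomog_factor (fun k => Posz (k == i)) (wt (fun k => Posz (k == i)) m) A B AB0.
  by rewrite E; apply: whomogZ; apply: whomogX.
have := hA _ m'A; rewrite -(hA _ (mlead_supp A0)) !wt_coord.
by case.
Qed.

End WeightFactors.

(** * The generic point of the family *)

Lemma mpoly_ring_ind n (R : comNzRingType) (Pr : {mpoly R[n]} -> Prop) :
  (forall c, Pr c%:MP) -> (forall i, Pr 'X_i) ->
  (forall p q, Pr p -> Pr q -> Pr (p + q)) -> (forall p q, Pr p -> Pr q -> Pr (p * q)) ->
  forall p, Pr p.
Proof.
move=> PrC PrX PrD PrM p; have Pr0 : Pr 0 by rewrite -mpolyC0.
have Pr1 : Pr 1 by rewrite -mpolyC1.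
rewrite (mpolyE p); apply: (big_ind Pr) => // m _.
rewrite -mul_mpolyC mpolyXE_id; apply: (PrM _ _ (PrC _)).
apply: (big_ind Pr) => // i _; elim: (m i) => [|e IH]; first by rewrite expr0.
by rewrite exprS; apply: PrM.
Qed.

Section FamilyParameters.
Variables (K : fieldType) (n l : nat) (P : {mpoly K[n]}) (q : 'I_l.+1 -> 'X_{1..n}).

(** The coefficient ring carries all parameters but the first one, followed by
    the coordinates of the generic point; the first parameter is the value
    for which the generic point lies on the hypersurface. *)
Local Notation R := {mpoly K[l + n]}.
Local Notation S := {mpoly K[l.+1]}.
Local Notation T := {mpoly S[n]}.

Definition at_point (p : {mpoly K[n]}) : R :=
  mmap (@mpolyC (l + n) K) (fun i => 'X_(rshift l i)) p.

HB.instance Definition _ := GRing.RMorphism.copy at_point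
  (mmap (@mpolyC (l + n) K) (fun i => 'X_(rshift l i))).

Definition param (j : 'I_l) : R := 'X_(lshift n j).

Definition point_num : R :=
  at_point P + \sum_(j < l) param j * at_point 'X_[q (lift ord0 j)].

Definition point_den : R := at_point 'X_[q ord0].

Definition point_params (i : 'I_l.+1) : {fraction R} :=
  if unlift ord0 i is Some j then tofrac (param j)
  else - (tofrac point_num / tofrac point_den).

Definition generic_family : T :=
  map_mpoly (@mpolyC l.+1 K) P + \sum_(i < l.+1) ('X_i : S) *: 'X_[q i].

Definition spec_params (g : S) : {fraction R} :=
  mmap (@tofrac R \o @mpolyC (l + n) K) point_params g.

HB.instance Definition _ := GRing.RMorphism.copy spec_params
  (mmap (@tofrac R \o @mpolyC (l + n) K) point_params).

Lemma at_pointC c : at_point c%:MP = c%:MP.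
Proof. by rewrite /at_point mmapC. Qed.

Lemma at_pointX i : at_point 'X_i = 'X_(rshift l i).
Proof. by rewrite /at_point mmapX mmap1U. Qed.

(** The coordinates of the generic point are read again as the variables of
    the family. *)
Definition to_family (r : R) : T :=
  mmap (@mpolyC n S \o @mpolyC l.+1 K)
    (fun i => match split i with inl j => ('X_(lift ord0 j))%:MP | inr i' => 'X_i' end) r.

HB.instance Definition _ := GRing.RMorphism.copy to_family
  (mmap (@mpolyC n S \o @mpolyC l.+1 K)
    (fun i => match split i with inl j => ('X_(lift ord0 j))%:MP | inr i' => 'X_i' end)).

Lemma to_family_param j : to_family (param j) = ('X_(lift ord0 j))%:MP.
Proof.
rewrite /to_family /param mmapX mmap1U.
by rewrite -[lshift n j]/(unsplit (inl j)) unsplitK.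
Qed.

Lemma to_family_point (p : {mpoly K[n]}) :
  to_family (at_point p) = map_mpoly (@mpolyC l.+1 K) p.
Proof.
apply: (mpoly_rmorph_ext (f := to_family \o at_point)
  (g := map_mpoly (@mpolyC l.+1 K))) => [c|i] /=.
  by rewrite at_pointC /to_family mmapC /= map_mpolyC.
rewrite at_pointX map_mpolyX /to_family mmapX mmap1U.
by rewrite -[rshift l i]/(unsplit (inr i)) unsplitK.
Qed.

Lemma generic_family_coef m : generic_family@_m =
  (P@_m)%:MP + \sum_(i < l.+1) ((q i == m)%:R : S) * 'X_i.
Proof.
rewrite mcoeffD mcoeff_map_mpoly raddf_sum /=; congr (_ + _).
by apply: eq_bigr => i _; rewrite mcoeffZ mcoeffX mulrC.
Qed.

Lemma generic_family_supp m : (P@_m != 0) \/ (exists i, q i = m) ->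
  m \in msupp generic_family.
Proof.
rewrite mcoeff_msupp generic_family_coef => H; apply/eqP => E.
have E0 : P@_m = 0.
  move/mpolyP/(_ 0%MM): E; rewrite mcoeffD mcoeffC eqxx mulr1 raddf_sum mcoeff0 /=.
  rewrite big1 ?addr0 // => i _; rewrite -mpolyC_nat mul_mpolyC mcoeffZ mcoeffX.
  by rewrite mnm1_eq0 mulr0.
case: H => [|[i0 qi0]]; first by rewrite E0 eqxx.
move/mpolyP/(_ U_(i0)%MM): E; rewrite E0 mpolyC0 add0r raddf_sum mcoeff0 /=.
rewrite (bigD1 i0) //= big1 => [|i /negPf ii0].
  by rewrite qi0 eqxx mul1r mcoeffXU eqxx addr0 => /eqP; rewrite oner_eq0.
by rewrite -mpolyC_nat mul_mpolyC mcoeffZ mcoeffXU ii0 mulr0.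
Qed.

Lemma at_point_inj : injective at_point.
Proof.
pose back : {rmorphism R -> {mpoly K[n]}} :=
  mmap (@mpolyC n K) (fun i => match split i with inl _ => 0 | inr i' => 'X_i' end).
apply: (can_inj (g := back)).
apply: (mpoly_rmorph_ext (f := back \o at_point) (g := idfun)) => [c|i] /=.
  by rewrite at_pointC mmapC.
rewrite at_pointX mmapX mmap1U.
by rewrite -[rshift l i]/(unsplit (inr i)) unsplitK.
Qed.

Lemma point_den_neq0 : point_den != 0.
Proof.
rewrite -(rmorph0 at_point) (inj_eq at_point_inj).
by rewrite -msize_poly_eq0 msizeX.
Qed.

Let den0 : tofrac point_den != 0. Proof. by rewrite tofrac_eq0 point_den_neq0. Qed.

(** Eliminating the first parameter: modulo the family, a polynomial in the
    parameters agrees, up to a power of the first monomial, with its value at the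
    parameters of the generic point. *)
Lemma spec_params_reduce (g : S) : exists D (G : R),
  tofrac G = tofrac point_den ^+ D * spec_params g /\
  divides generic_family (to_family G - 'X_[q ord0] ^+ D * g%:MP).
Proof.
have denE : to_family point_den = 'X_[q ord0] by rewrite to_family_point map_mpolyX.
elim/mpoly_ring_ind: g => [c|i|g1 g2 [D1 [G1 [E1 H1]]] [D2 [G2 [E2 H2]]]
    |g1 g2 [D1 [G1 [E1 H1]]] [D2 [G2 [E2 H2]]]].
- exists 0%N, c%:MP; rewrite !expr0 !mul1r /spec_params mmapC; split=> //.
  by rewrite /to_family mmapC subrr; apply: dvd0.
- have [j ->|->] := unliftP ord0 i.
    exists 0%N, (param j); rewrite !expr0 !mul1r /spec_params mmapX mmap1U.
    rewrite /point_params liftK; split=> //.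
    by rewrite to_family_param subrr; apply: dvd0.
  exists 1%N, (- point_num); rewrite !expr1; split.
    rewrite /spec_params mmapX mmap1U /point_params unlift_none.
    by rewrite mulrN mulrC divfK // rmorphN.
  have -> : to_family (- point_num) - 'X_[q ord0] * ('X_ord0)%:MP = - generic_family.
    have e1 : to_family point_num = to_family (at_point P) +
        \sum_(j < l) to_family (param j) * to_family (at_point 'X_[q (lift ord0 j)]).
      transitivity (to_family (at_point P) +
        to_family (\sum_(j < l) param j * at_point 'X_[q (lift ord0 j)])).
        exact: rmorphD.
      congr (_ + _); rewrite (rmorph_sum to_family); apply: eq_bigr => j _.
      exact: rmorphM.
    have e2 : to_family (- point_num) = - to_family point_num by apply: rmorphN.
    rewrite e2 -opprD e1; congr (- _).
    rewrite to_family_point /generic_family big_ord_recl -addrA; congr (_ + _).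
    rewrite addrC mulrC mul_mpolyC; congr (_ + _); apply: eq_bigr => j _.
    by rewrite to_family_param to_family_point map_mpolyX mul_mpolyC.
  by apply: dvdN; apply: dvd_refl.
- exists (D1 + D2)%N, (point_den ^+ D2 * G1 + point_den ^+ D1 * G2); split.
    rewrite (rmorphD spec_params) tofracD !tofracM !tofracXn E1 E2 exprD mulrDr.
    by rewrite !mulrA; congr (_ * _ + _ * _); rewrite mulrC.
  have -> : to_family (point_den ^+ D2 * G1 + point_den ^+ D1 * G2) =
      'X_[q ord0] ^+ D2 * to_family G1 + 'X_[q ord0] ^+ D1 * to_family G2.
    by rewrite (rmorphD to_family) !(rmorphM to_family) !(rmorphXn to_family) /= denE.
  have comb : forall X a b c d : T, X ^+ D2 * a + X ^+ D1 * b - X ^+ (D1 + D2) * (c + d) =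
      X ^+ D2 * (a - X ^+ D1 * c) + X ^+ D1 * (b - X ^+ D2 * d).
    by move=> X a b c d; rewrite exprD; ring.
  rewrite mpolyCD comb.
  by apply: dvdD; apply: dvdMl.
- exists (D1 + D2)%N, (G1 * G2); split.
    by rewrite (rmorphM spec_params) tofracM E1 E2 exprD mulrACA.
  have -> : to_family (G1 * G2) = to_family G1 * to_family G2 by apply: rmorphM.
  rewrite mpolyCM; set X := 'X_[q ord0]; set c := g1%:MP; set d := g2%:MP.
  have -> : to_family G1 * to_family G2 - X ^+ (D1 + D2) * (c * d) =
      (to_family G1 - X ^+ D1 * c) * to_family G2 + X ^+ D1 * c * (to_family G2 - X ^+ D2 * d).
    by rewrite exprD; move: (to_family G1) (to_family G2) => a b; ring.
  by apply: dvdD; [apply: dvdMr | apply: dvdMl].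
Qed.

Hypothesis two_terms : exists e, P@_e != 0 /\ e != q ord0.

(** A relation between the parameters would make the family divide a multiple
    of a power of a monomial, so that it would have a single term. *)
Lemma spec_params_inj : injective spec_params.
Proof.
suff H g : spec_params g = 0 -> g = 0.
  move=> g1 g2 /eqP; rewrite -subr_eq0 -rmorphB => /eqP /H /eqP.
  by rewrite subr_eq0 => /eqP.
move=> g0; apply/eqP; apply: contraT => gN0.
have [D [G [E]]] := spec_params_reduce g.
rewrite g0 mulr0 in E; have -> : G = 0 by apply/eqP; rewrite -tofrac_eq0 E.
rewrite rmorph0 sub0r => /dvdN; rewrite opprK => [[H HE]].
have {}HE : generic_family * (H : T) = g *: 'X_[q ord0 *+ D].
  by rewrite mulrC -HE mulrC mul_mpolyC mpolyXn.
have [a [m [_ famE]]] := monomial_factor gN0 HE.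
have suppE e : e \in msupp generic_family -> e = m.
  by rewrite famE => /msuppZ_le; rewrite msuppX inE => /eqP.
have [e [Pe /negP]] := two_terms; case; apply/eqP.
rewrite (suppE e); last by apply: generic_family_supp; left.
by rewrite (suppE (q ord0)) //; apply: generic_family_supp; right; exists ord0.
Qed.

End FamilyParameters.

(** * Smoothness of the generic point *)

Lemma mulX_mderivX (R : comNzRingType) n (i : 'I_n) (m : 'X_{1..n}) :
  'X_i * ('X_[m] : {mpoly R[n]})^`M(i) = (m i)%:R *: 'X_[m].
Proof.
rewrite mderivX -scalerAr -mpolyXD; have [->|mi] := eqVneq (m i) 0%N; first by rewrite !scale0r.
by rewrite addmC submK // lep1mP.
Qed.

Lemma mcoeff_mulX_mderiv (R : comNzRingType) n (i : 'I_n) (p : {mpoly R[n]}) m :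
  ('X_i * p^`M(i))@_m = (m i)%:R * p@_m.
Proof.
elim/mpolyind: p => [|c m' p _ _ IH]; first by rewrite mderiv0 mulr0 mcoeff0 mulr0.
rewrite mderivD mulrDr !mcoeffD IH mulrDr mderivZ -scalerAr mulX_mderivX.
congr (_ + _); rewrite !mcoeffZ mcoeffX.
by case: eqP => [->|_]; rewrite ?mulr0 // !mulr1 mulrC.
Qed.

Lemma map_mulX_mderiv (A B : comNzRingType) (s : {rmorphism A -> B}) n (i : 'I_n) (p : {mpoly A[n]}) :
  map_mpoly s ('X_i * p^`M(i)) = 'X_i * (map_mpoly s p)^`M(i).
Proof.
apply/mpolyP => m; rewrite mcoeff_map_mpoly !mcoeff_mulX_mderiv mcoeff_map_mpoly /=.
by rewrite rmorphM rmorph_nat.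
Qed.

Lemma mulX_mderiv_lin (A : comNzRingType) n (i : 'I_n) (p : {mpoly A[n]})
    (I : finType) (c : I -> A) (q : I -> 'X_{1..n}) :
  'X_i * (p + \sum_t c t *: 'X_[q t])^`M(i) =
  'X_i * p^`M(i) + \sum_t c t *: ((q t i)%:R *: 'X_[q t]).
Proof.
rewrite mderivD mulrDr; congr (_ + _); rewrite raddf_sum mulr_sumr; apply: eq_bigr => t _.
by rewrite /= mderivZ -scalerAr mulX_mderivX.
Qed.

Lemma rmorph_lin (A B : comNzRingType) (s : {rmorphism A -> B}) (I : finType) a (u v : I -> A) :
  s (a + \sum_t u t * v t) = s a + \sum_t s (u t) * s (v t).
Proof.
by rewrite rmorphD rmorph_sum; congr (_ + _); apply: eq_bigr => t _; rewrite rmorphM.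
Qed.

Section FamilyFactor.
Variables (K : closedFieldType) (n l : nat) (P : {mpoly K[n]}) (q : 'I_l.+1 -> 'X_{1..n}).
Local Notation R := {mpoly K[l + n]}.
Local Notation k := {fraction R}.
Local Notation S := {mpoly K[l.+1]}.

Definition point_val : {rmorphism {mpoly K[n]} -> k} := @tofrac R \o @at_point K n l.
Local Notation j := point_val.
Local Notation lift := (generic_lift j).
Local Notation x := (generic_coord j).
Local Notation par := (point_params P q).

Definition point_family : {mpoly k[n]} :=
  lift P + \sum_(i < l.+1) par i *: 'X_[q i].
Local Notation f := point_family.

Lemma point_val_inj : injective j.
Proof. by move=> a b /eqP; rewrite /= tofrac_eq => /eqP /at_point_inj. Qed.

Lemma generic_liftX m : lift 'X_[m] = 'X_[m].
Proof. by rewrite /generic_lift map_mpolyX. Qed.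

Lemma point_params0 : par ord0 = - (tofrac (point_num P q) / j 'X_[q ord0]).
Proof. by rewrite /point_params unlift_none. Qed.

Lemma point_paramsS i : par (fintype.lift ord0 i) = tofrac (param K n i).
Proof. by rewrite /point_params liftK. Qed.

Lemma point_numE : tofrac (point_num P q) =
  j P + \sum_(i < l) par (fintype.lift ord0 i) * j 'X_[q (fintype.lift ord0 i)].
Proof.
rewrite /point_num tofracD; congr (_ + _).
transitivity (\sum_(i < l) tofrac (param K n i * at_point l 'X_[q (fintype.lift ord0 i)])).
  exact: rmorph_sum.
by apply: eq_bigr => i _; rewrite tofracM point_paramsS.
Qed.

(** The first parameter is eliminated: the term that belongs to it is replaced
    by [P] and the other terms, with the opposite sign. *)
Lemma point_family_sum a (v : 'I_l.+1 -> k) :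
  a + \sum_(i < l.+1) par i * (v i * j 'X_[q i]) =
  (a - v ord0 * j P) +
  \sum_(i < l) par (fintype.lift ord0 i) *
    ((v (fintype.lift ord0 i) - v ord0) * j 'X_[q (fintype.lift ord0 i)]).
Proof.
rewrite big_ord_recl point_params0 point_numE.
have q0 : j 'X_[q ord0] != 0.
  by rewrite (generic_eq0 point_val_inj) -msize_poly_eq0 msizeX.
have -> : - ((j P + \sum_(i < l) par (fintype.lift ord0 i) * j 'X_[q (fintype.lift ord0 i)]) /
    j 'X_[q ord0]) * (v ord0 * j 'X_[q ord0]) =
  - v ord0 * (j P + \sum_(i < l) par (fintype.lift ord0 i) * j 'X_[q (fintype.lift ord0 i)]).
  by rewrite mulrCA mulNr divfK // mulrN mulNr.
rewrite mulrDr addrA addrA mulNr -addrA; congr (_ + _).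
rewrite mulr_sumr -big_split; apply: eq_bigr => i _ /=.
rewrite mulrBl mulrBr mulNr addrC; congr (_ - _).
by rewrite mulrCA.
Qed.

Lemma point_family_eval : f.@[x] = 0.
Proof.
rewrite /f mevalD.
transitivity (j P + \sum_(i < l.+1) par i * (1 * j 'X_[q i])).
  congr (_ + _); first exact: generic_eval.
  transitivity (\sum_(i < l.+1) (par i *: 'X_[q i]).@[x]); first exact: (rmorph_sum (meval x)).
  apply: eq_bigr => i _.
  by rewrite mul1r mevalZ -[j _]generic_eval generic_liftX.
rewrite point_family_sum mul1r subrr add0r big1 // => i _.
by rewrite subrr mul0r mulr0.
Qed.

(** Setting all parameters to zero, or all but one, isolates each term. *)
Lemma param_comb_eq0 (a : {mpoly K[n]}) (b : 'I_l -> {mpoly K[n]}) :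
  at_point l a + \sum_(t < l) param K n t * at_point l (b t) = 0 -> a = 0 /\ forall t, b t = 0.
Proof.
move=> u0.
pose spec (v : 'I_l -> {mpoly K[n]}) : {rmorphism R -> {mpoly K[n]}} :=
  mmap (@mpolyC n K) (fun i => match split i with inl t => v t | inr i' => 'X_i' end).
have spec_point v p : spec v (at_point l p) = p.
  apply: (mpoly_rmorph_ext (f := spec v \o at_point l) (g := idfun)) => [c|i] /=.
    by rewrite at_pointC mmapC.
  by rewrite at_pointX mmapX mmap1U -[rshift l i]/(unsplit (inr i)) unsplitK.
have spec_param v t : spec v (param K n t) = v t.
  by rewrite /= /param mmapX mmap1U -[lshift n t]/(unsplit (inl t)) unsplitK.
have specE v : a + \sum_(t < l) v t * b t = 0.
  transitivity (spec v (at_point l a + \sum_(t < l) param K n t * at_point l (b t))); last first.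
    by rewrite u0; apply: rmorph0.
  rewrite (rmorph_lin (spec v)) spec_point; congr (_ + _); apply: eq_bigr => t _.
  by rewrite spec_param spec_point.
have a0 : a = 0.
  by have := specE (fun _ => 0); rewrite big1 ?addr0 // => t _; rewrite mul0r.
split=> // t; have := specE (fun t' => (t' == t)%:R); rewrite a0 add0r (bigD1 t) //=.
by rewrite eqxx mul1r big1 ?addr0 // => t' /negPf ->; rewrite mul0r.
Qed.

(** The operator ['X_i * d/dX_i] multiplies each monomial by an exponent;
    since the family vanishes at the point, only the differences with the
    exponent of the first monomial contribute. *)
Lemma point_val_deriv i : j 'X_i * f^`M(i).@[x] =
  tofrac (at_point l ('X_i * P^`M(i) - (q ord0 i)%:R *: P) +
    \sum_(t < l) param K n t * at_point l
      (((q (fintype.lift ord0 t) i)%:R - (q ord0 i)%:R) *: 'X_[q (fintype.lift ord0 t)])).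
Proof.
have jnat (c : nat) p : j (c%:R *: p) = c%:R * j p.
  by rewrite -mul_mpolyC mpolyC_nat (rmorphM j) rmorph_nat.
have jX m : ('X_[m] : {mpoly k[n]}).@[x] = j 'X_[m] by rewrite -[j _]generic_eval generic_liftX.
transitivity (j ('X_i * P^`M(i)) + \sum_(t < l.+1) par t * ((q t i)%:R * j 'X_[q t])).
  transitivity (('X_i * f^`M(i)).@[x]); first by rewrite mevalM mevalXU.
  have -> : 'X_i * f^`M(i) = lift ('X_i * P^`M(i)) +
      \sum_(t < l.+1) par t *: ((q t i)%:R *: 'X_[q t]).
    rewrite (mulX_mderiv_lin i (lift P)); congr (_ + _).
    by symmetry; apply: map_mulX_mderiv.
  rewrite mevalD; congr (_ + _); first exact: generic_eval.
  rewrite (rmorph_sum (meval x)); apply: eq_bigr => t _ /=.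
  by rewrite !mevalZ jX.
rewrite point_family_sum tofracD; congr (_ + _).
  rewrite -[RHS]/(j ('X_i * P^`M(i) - (q ord0 i)%:R *: P)) rmorphB; congr (_ - _).
  by rewrite jnat.
rewrite (rmorph_sum (@tofrac R)); apply: eq_bigr => t _.
rewrite (rmorphM (@tofrac R)) point_paramsS; congr (_ * _).
by rewrite -[RHS]/(j _) scalerBl rmorphB !jnat mulrBl.
Qed.

(** The remaining parameters being independent, the logarithmic derivative
    vanishes only if all differences of exponents vanish in [K]. *)
Lemma point_family_smooth i :
  (exists e, P@_e != 0 /\ ((e i)%:R : K) != (q ord0 i)%:R) \/
  (exists t, ((q (fintype.lift ord0 t) i)%:R : K) != (q ord0 i)%:R) ->
  f^`M(i).@[x] != 0.
Proof.
move=> sep; apply/eqP => d0.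
have := point_val_deriv i; rewrite d0 mulr0 => /esym/eqP; rewrite tofrac_eq0 => /eqP.
case/param_comb_eq0 => e0 t0; case: sep => [[e [Pe ne]]|[t ne]].
  move/mpolyP/(_ e): e0; rewrite mcoeffB mcoeff_mulX_mderiv mcoeffZ -mulrBl mcoeff0.
  by move/eqP; rewrite mulf_eq0 (negPf Pe) orbF subr_eq0 (negPf ne).
move/eqP: (t0 t); rewrite scaler_eq0 subr_eq0 (negPf ne) /=.
by rewrite -msize_poly_eq0 msizeX.
Qed.

End FamilyFactor.

Lemma dvd_mpolyX (K : fieldType) n (i : 'I_n) (p : {mpoly K[n]}) :
  (forall e, p@_e != 0 -> e i != 0%N) -> divides 'X_i p.
Proof.
move=> pi; rewrite (mpolyE p) big_seq; apply: dvd_sum => e; rewrite mcoeff_msupp => /pi ei.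
by exists (p@_e *: 'X_[e - U_(i)]); rewrite -scalerAl -mpolyXD submK // lep1mP.
Qed.

Lemma closed_root (K : closedFieldType) (c : K) p : (0 < p)%N -> exists d, d ^+ p = c.
Proof.
move=> p0; have [d dE] := @solve_monicpoly K p (fun i => if i == 0%N then c else 0) p0.
exists d; rewrite dE (bigD1 (Ordinal p0)) //= expr0 mulr1 big1 ?addr0 // => i /negPf i0.
by rewrite (_ : (i == 0%N :> nat) = false) ?mul0r // -i0.
Qed.

(** The Frobenius map is additive, and [K] contains the [p]-th roots of the
    coefficients. *)
Lemma pth_power (K : closedFieldType) n (p : nat) (P : {mpoly K[n]}) : p \in [pchar K] ->
  (forall e i, P@_e != 0 -> (p %| e i)%N) -> exists q, P = q ^+ p.
Proof.
move=> chp dvp; have p0 : (0 < p)%N by apply: prime_gt0 (pcharf_prime chp).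
have root_p (c : K) := closed_root c p0.
have chm : p \in [pchar {mpoly K[n]}] := rmorph_pchar (@mpolyC n K) chp.
suff H : forall s : seq 'X_{1..n}, (forall e i, e \in s -> (p %| e i)%N) ->
    exists q : {mpoly K[n]}, \sum_(e <- s) P@_e *: 'X_[e] = q ^+ p.
  have [|q qE] := H (msupp P); first by move=> e i; rewrite mcoeff_msupp; apply: dvp.
  by exists q; rewrite -qE -mpolyE.
elim=> [|e s IH] es; first by exists 0; rewrite big_nil expr0n eqn0Ngt p0.
have [|q qE] := IH; first by move=> e' i e's; apply: es; rewrite inE e's orbT.
have [d dE] := root_p P@_e.
exists (d *: 'X_[[multinom (e i %/ p) | i < n]] + q).
rewrite big_cons qE -[RHS]/(pFrobenius_aut chm _) rmorphD /= !pFrobenius_autE.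
congr (_ + _); rewrite exprZn dE mpolyXn; congr (_ *: 'X_[_]).
by apply/mnmP => i; rewrite mulmnE mnmE divnK // es // inE eqxx.
Qed.

(** If no coordinate separated the exponents, either some coordinate would
    divide all terms, or all exponents of [P] would vanish in [K]. *)
Lemma exists_separating (K : closedFieldType) n l (P : {mpoly K[n]}) (q : 'I_l.+1 -> 'X_{1..n}) :
  nonconstant P -> ~ pure_power P ->
  (forall r, divides r P -> (forall t, divides r 'X_[q t]) -> ~ nonconstant r) ->
  exists i, (exists e, P@_e != 0 /\ ((e i)%:R : K) != (q ord0 i)%:R) \/
    (exists t, ((q (fintype.lift ord0 t) i)%:R : K) != (q ord0 i)%:R).
Proof.
move=> Pn PN cop; apply: NNPP => /not_ex_all_not sep.
have sepP i e : P@_e != 0 -> ((e i)%:R : K) = (q ord0 i)%:R.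
  by move=> Pe; apply/eqP; apply: contraT => ne; case: (sep i); left; exists e.
have sepq i t : ((q t i)%:R : K) = (q ord0 i)%:R.
  have [t' ->|-> //] := unliftP ord0 t.
  by apply/eqP; apply: contraT => ne; case: (sep i); right; exists t'.
have q0 i : ((q ord0 i)%:R : K) = 0.
  apply/eqP; apply: contraT => ne; case: (cop 'X_i).
  - by apply: dvd_mpolyX => e /sepP E; apply: contraNneq ne => e0; rewrite -E e0.
  - move=> t; apply: dvd_mpolyX => e; rewrite mcoeffX.
    have [<- _|_] := eqVneq (q t) e; last by rewrite eqxx.
    by apply: contraNneq ne => e0; move: (sepq i t); rewrite e0 => <-.
  by rewrite /nonconstant msizeX mdeg1.
have [e [i [Pe ei]]] : exists e i, P@_e != 0 /\ e i != 0%N.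
  apply: NNPP => H; move: Pn; rewrite /nonconstant.
  have : P = (P@_0)%:MP.
    apply/mpolyP => e; rewrite mcoeffC; have [<-|e0] := eqVneq 0%MM e; rewrite ?mulr1 // mulr0.
    apply/eqP; apply: contraT => Pe; case: H; exists e.
    apply: NNPP => /not_ex_all_not H; case/eqP: e0; apply/mnmP => i; rewrite mnm0E.
    by apply/esym/eqP; apply: contraT => ei; case: (H i).
  by move=> ->; rewrite msizeC; case: (_ != 0).
have [||p chp] := @natf0_pchar K (e i); first by rewrite lt0n.
  by rewrite sepP ?q0.
have [Q QE] : exists Q, P = Q ^+ p.
  by apply: pth_power => // e' i' Pe'; rewrite (dvdn_pcharf chp) sepP ?q0.
by apply: PN; exists Q, p; split=> //; apply: prime_gt1 (pcharf_prime chp).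
Qed.
(** * Factoring the family at its generic point *)

Lemma exists_other_term (K : fieldType) n (P : {mpoly K[n]}) m :
  P != 0 -> ~ monomial_upto_const P -> exists e, P@_e != 0 /\ e != m.
Proof.
move=> P0 PN; apply: NNPP => /not_ex_all_not H; case: PN; exists m.
have PE : P = P@_m *: 'X_[m].
  apply: single_support => // m'; rewrite mcoeff_msupp => Pm'.
  by apply/eqP; apply: contraT => ne; case: (H m').
exists P@_m => //; apply/eqP => Pm; move: P0.
by rewrite PE Pm scale0r eqxx.
Qed.

Lemma map_mpoly_lin (A B C : comNzRingType) (c0 : {rmorphism A -> B}) (s : {rmorphism B -> C})
    (s0 : {rmorphism A -> C}) n (p : {mpoly A[n]})
    (I : finType) (c : I -> B) (c' : I -> C) (q : I -> 'X_{1..n}) :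
  (forall a, s (c0 a) = s0 a) -> (forall t, s (c t) = c' t) ->
  map_mpoly s (map_mpoly c0 p + \sum_t c t *: 'X_[q t]) =
  map_mpoly s0 p + \sum_t c' t *: 'X_[q t].
Proof.
move=> s0E cE; rewrite rmorphD; congr (_ + _); first exact: map_mpoly_map.
rewrite (rmorph_sum (map_mpoly s)).
by apply: eq_bigr => t _ /=; rewrite map_mpolyZ map_mpolyX cE.
Qed.

Section FamilyFactor.
Variables (K : closedFieldType) (n l : nat) (P : {mpoly K[n]}) (q : 'I_l.+1 -> 'X_{1..n}).
Variables (L : algClosure (ratfun K l.+1)) (M : algClosure (ratfun K (l + n))).
Hypotheses (P_nonconst : nonconstant P) (P_not_mono : ~ monomial_upto_const P)
  (P_not_pow : ~ pure_power P)
  (cop : forall r, divides r P -> (forall t, divides r 'X_[q t]) -> ~ nonconstant r).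

(** The parameters of the generic point are algebraically independent, so that
    the family over the rational functions specializes to the family through
    the generic point without loss, and stays reducible. There the point is
    rational and smooth, and singles out a rational factor. *)
Lemma family_factor :
  mreducible (to_closure L P + \sum_(i < l.+1) lambda L i *: 'X_[q i]) ->
  exists A B : {mpoly (ratfun K (l + n))[n]},
    [/\ point_family P q = A * B, nonconstant A, nonconstant B,
      A.@[generic_coord (point_val K n l)] = 0 & mirreducible (map_mpoly (closure_emb M) A)].
Proof.
move=> red.
have two := exists_other_term (q ord0) (nonconstant_neq0 P_nonconst) P_not_mono.
have [kappa kappaE] := frac_lift (spec_params_inj two).
pose c0 : {rmorphism K -> ratfun K l.+1} := @tofrac _ \o @mpolyC l.+1 K.
pose F0 : {mpoly (ratfun K l.+1)[n]} := map_mpoly c0 P +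
  \sum_(i < l.+1) tofrac ('X_i : {mpoly K[l.+1]}) *: 'X_[q i].
have F0L : map_mpoly (closure_emb L) F0 = to_closure L P + \sum_(i < l.+1) lambda L i *: 'X_[q i].
  by apply: (map_mpoly_lin (s := closure_emb L) (s0 := closure_emb L \o c0)).
have F0k : map_mpoly kappa F0 = point_family P q.
  apply: (map_mpoly_lin (s := kappa) (s0 := generic_const (point_val K n l))) => [c|i].
    transitivity (spec_params P q c%:MP); first exact: kappaE.
    transitivity (@tofrac {mpoly K[l + n]} c%:MP); first exact: mmapC.
    by congr tofrac; symmetry; apply: at_pointC.
  transitivity (spec_params P q 'X_i); first exact: kappaE.
  by rewrite /spec_params mmapX mmap1U.
have redM : mreducible (map_mpoly (closure_emb M) (point_family P q)).
  have -> : map_mpoly (closure_emb M) (point_family P q) = map_mpoly (closure_emb M \o kappa) F0.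
    by rewrite -F0k; apply: map_mpoly_map.
  apply: (reducible_transfer (j := closure_emb L)); first exact: closure_alg.
  by rewrite F0L.
apply: rational_factor => //.
- exact: closure_alg.
- exact: point_family_eval.
- have [i sep] := exists_separating P_nonconst P_not_pow cop.
  by exists i; apply: point_family_smooth.
Qed.

End FamilyFactor.
(** * One monomial: the site comes from a pencil *)

Lemma ratio_not_const (K : closedFieldType) n (k : fieldType) (j : {rmorphism {mpoly K[n]} -> k})
    p m : injective j -> p != 0 -> ~ eq_upto_const p 'X_[m] ->
  forall e, j p / j 'X_[m] != generic_const j e.
Proof.
move=> j_inj p0 pN e; apply/eqP => E.
have Xm : j 'X_[m] != 0 by rewrite (generic_eq0 j_inj) -msize_poly_eq0 msizeX.
have pE : p = e *: 'X_[m].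
  by apply: j_inj; rewrite -mul_mpolyC (rmorphM j) -[j p](divfK Xm) E.
by case: pN; exists e => //; apply: contraNneq p0 => e0; rewrite pE e0 scale0r.
Qed.

Section OneMonomial.
Variables (K : closedFieldType) (n : nat) (P : {mpoly K[n]}) (q : 'I_1 -> 'X_{1..n}).
Variables (L : algClosure (ratfun K 1)) (M : algClosure (ratfun K (0 + n))).
Hypotheses (P_nonconst : nonconstant P) (P_not_mono : ~ monomial_upto_const P)
  (P_not_pow : ~ pure_power P).
Hypothesis cop : coprime_mpoly P 'X_[q ord0].
Hypothesis q_le : (msize ('X_[q ord0] : {mpoly K[n]}) <= msize P)%N.
Local Notation j := (point_val K n 0).

Lemma point_val_frac t : exists p r, j r != 0 /\ t = j p / j r.
Proof.
have surj : forall r : {mpoly K[0 + n]}, exists p, tofrac r = j p.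
  move=> r; pose back : {rmorphism {mpoly K[0 + n]} -> {mpoly K[n]}} :=
    mmap (@mpolyC n K) (fun i : 'I_(0 + n) => 'X_(i : 'I_n)).
  exists (back r); rewrite /=; congr tofrac; symmetry.
  apply: (mpoly_rmorph_ext (f := @at_point K n 0 \o back) (g := idfun)) => [c|i] /=.
    by rewrite mmapC at_pointC.
  by rewrite mmapX mmap1U at_pointX; congr ('X_ _); apply: ord_inj.
have [a [b [b0 ->]]] := fracE t.
have [p pE] := surj a; have [r rE] := surj b.
by exists p, r; rewrite -pE -rE tofrac_eq0 b0.
Qed.

Let X0 : 'X_[q ord0] != 0 :> {mpoly K[n]}. Proof. by rewrite -msize_poly_eq0 msizeX. Qed.
Let jX0 : j 'X_[q ord0] != 0. Proof. by rewrite (generic_eq0 (@point_val_inj K n 0)). Qed.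

(** With a single parameter, the field of the generic point consists of
    rational functions of the point alone, and the family is the pencil of [P]
    and the monomial. *)
Lemma one_monomial_site :
  mreducible (to_closure L P + \sum_(i < 1) lambda L i *: 'X_[q i]) ->
  exists phi psi d,
  [/\ coprime_mpoly phi psi, psi != 0 /\ (forall a b, a *: phi + b *: psi = 0 -> a = 0 /\ b = 0),
      (msize phi < msize P)%N /\ (msize psi < msize P)%N,
      binary_form_in phi psi d P /\ binary_form_in phi psi d 'X_[q ord0]
    & (forall e, j phi / j psi != generic_const j e) /\
      mirreducible (map_mpoly (closure_emb M)
        (generic_lift j phi - (j phi / j psi) *: generic_lift j psi))].
Proof.
move=> red.
have [] := family_factor M P_nonconst P_not_mono P_not_pow _ red.
  by move=> r rP rX; apply: (cop rP (rX ord0)).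
move=> A [B [fE An Bn Ax irrA]].
have P0 := nonconstant_neq0 P_nonconst.
have tN : forall e, - (j P / j 'X_[q ord0]) != generic_const j e.
  move=> e; apply/eqP => E.
  have nP : ~ eq_upto_const P 'X_[q ord0] by move=> H; apply: P_not_mono; exists (q ord0).
  have /negP := ratio_not_const (@point_val_inj K n 0) P0 nP (- e).
  by case; rewrite (rmorphN (generic_const j)) -E opprK.
have fE' : generic_lift j P + - (j P / j 'X_[q ord0]) *: generic_lift j 'X_[q ord0] = A * B.
  rewrite -fE [RHS]/point_family big_ord1; congr (_ + _ *: _); last exact: generic_liftX.
  by rewrite [RHS]point_params0 point_numE big_ord0 addr0.
have [phi [psi [d [c1 c2 [s1 s2] c3 c4]]]] :=
  one_parameter (@point_val_inj K n 0) point_val_frac X0 cop tN Ax fE' irrA.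
have A0 := nonconstant_neq0 An.
have sA : (msize A < msize P)%N.
  apply: leq_trans (msize_mul_lt Bn A0) _; rewrite -fE' -[generic_lift j P]scale1r.
  by apply: msize_lin_le; rewrite msize_map_mpoly.
by exists phi, psi, d; split=> //; split; apply: leq_ltn_trans sA.
Qed.
End OneMonomial.

(** * Several monomials: a factor free of the parameters *)

Lemma msize_affine_mul (R : idomainType) n (p a b : {mpoly R[n]}) :
  p != 0 -> (msize p <= 2)%N -> p = a * b -> (msize a <= 1)%N \/ (msize b <= 1)%N.
Proof.
move=> p0 + E; move: p0; rewrite E mulf_eq0 negb_or => /andP[a0 b0]; rewrite msizeM //.
have arith (u v : nat) : ((u + v).-1 <= 2)%N -> (u <= 1)%N \/ (v <= 1)%N by lia.
exact: arith.
Qed.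

(** After an exchange of the two groups of variables the polynomial is of
    degree one in the first group, over the polynomials in the second one;
    hence one factor is constant in the first group. *)
Lemma affine_factor (R : idomainType) n l (D0 : {mpoly R[n]}) (D : 'I_l -> {mpoly R[n]})
    (A B : {mpoly {mpoly R[l]}[n]}) : D0 != 0 ->
  map_mpoly (@mpolyC l R) D0 + \sum_t ('X_t : {mpoly R[l]}) *: map_mpoly (@mpolyC l R) (D t) = A * B ->
  exists a, [/\ A = map_mpoly (@mpolyC l R) a \/ B = map_mpoly (@mpolyC l R) a,
    divides a D0 & forall t, divides a (D t)].
Proof.
move=> D00 E.
pose E3 : {mpoly {mpoly R[n]}[l]} := D0%:MP + \sum_t (D t)%:MP * 'X_t.
have E3E : E3 = mpoly_swap A * mpoly_swap B.
  rewrite -(rmorphM (@mpoly_swap R l n)) -E /E3; apply: (can_inj (@mpoly_swapK R n l)).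
  rewrite mpoly_swapK (rmorphD (@mpoly_swap R n l)) /= mpoly_swapC; congr (_ + _).
  rewrite (rmorph_sum (@mpoly_swap R n l)); apply: eq_bigr => t _.
  rewrite (rmorphM (@mpoly_swap R n l)) /= mpoly_swapC -mul_mpolyC mulrC; congr (_ * _).
  by rewrite /mpoly_swap mmapX mmap1U.
have coef0 : E3@_0 = D0.
  rewrite mcoeffD mcoeffC eqxx mulr1 (raddf_sum (mcoeff 0%MM)) big1 ?addr0 // => t _ /=.
  by rewrite mcoeffCM mcoeffX mnm1_eq0 mulr0.
have coef1 t : E3@_U_(t) = D t.
  rewrite mcoeffD mcoeffC mnm1_eq0 mulr0 add0r (raddf_sum (mcoeff U_(t)%MM)) (bigD1 t) //=.
  rewrite mcoeffCM mcoeffXU eqxx mulr1 big1 ?addr0 // => t' /negPf t't.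
  by rewrite mcoeffCM mcoeffXU t't mulr0.
have E30 : E3 != 0 by apply: contraNneq D00 => z; rewrite -coef0 z mcoeff0.
have sE3 : (msize E3 <= 2)%N.
  rewrite msizeE; apply/bigmax_leqP_seq => m; rewrite mcoeff_msupp => mE _.
  rewrite ltnS leqNgt; apply: contra mE => m2; rewrite mcoeffD mcoeffC.
  have /negPf -> : m != 0%MM by apply: contraTneq m2 => ->; rewrite mdeg0.
  rewrite mulr0 add0r (raddf_sum (mcoeff m)) big1 // => t _ /=.
  rewrite mcoeffCM mcoeffX; case: eqP => [mt|_]; last by rewrite mulr0.
  by move: m2; rewrite -mt mdeg1.
have half : forall C C' : {mpoly {mpoly R[l]}[n]}, E3 = mpoly_swap C * mpoly_swap C' ->
    (msize (mpoly_swap C) <= 1)%N ->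
    exists a, [/\ C = map_mpoly (@mpolyC l R) a, divides a D0 & forall t, divides a (D t)].
  move=> C C' CE /msize1_polyC; set a := (_)@_0 => Ca; exists a.
  have CE' m : E3@_m = (mpoly_swap C')@_m * a.
    by rewrite [in LHS]CE [in LHS]Ca [LHS]mcoeffCM; apply: mulrC.
  split; first by rewrite -[C]mpoly_swapK Ca mpoly_swapC.
    by exists (mpoly_swap C')@_0; rewrite -coef0.
  by move=> t; exists (mpoly_swap C')@_U_(t); rewrite -coef1.
have [sA|sB] := msize_affine_mul E30 sE3 E3E.
  by have [a [? ? ?]] := half A B E3E sA; exists a; split=> //; left.
have [|a [? ? ?]] := half B A _ sB; first by rewrite mulrC.
by exists a; split=> //; right.
Qed.
Lemma map_mpoly_comb (A B C : comNzRingType) (c0 : {rmorphism A -> B}) (s : {rmorphism B -> C})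
    (s0 : {rmorphism A -> C}) n (p : {mpoly A[n]})
    (I : finType) (c : I -> B) (c' : I -> C) (u : I -> {mpoly A[n]}) :
  (forall a, s (c0 a) = s0 a) -> (forall t, s (c t) = c' t) ->
  map_mpoly s (map_mpoly c0 p + \sum_t c t *: map_mpoly c0 (u t)) =
  map_mpoly s0 p + \sum_t c' t *: map_mpoly s0 (u t).
Proof.
move=> s0E cE; rewrite rmorphD; congr (_ + _); first exact: map_mpoly_map.
rewrite (rmorph_sum (map_mpoly s)); apply: eq_bigr => t _ /=; rewrite map_mpolyZ cE.
by congr (_ *: _); apply: map_mpoly_map.
Qed.

Lemma map_mpoly_minor (A B C : comNzRingType) (c0 : {rmorphism A -> B}) (s : {rmorphism B -> C})
    (s0 : {rmorphism A -> C}) n (p : {mpoly A[n]}) x y m :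
  (forall a, s (c0 a) = s0 a) ->
  map_mpoly s (x *: map_mpoly c0 p - y *: 'X_[m]) = s x *: map_mpoly s0 p - s y *: 'X_[m].
Proof.
move=> s0E; transitivity (map_mpoly s (x *: map_mpoly c0 p) - map_mpoly s (y *: 'X_[m])).
  exact: rmorphB.
congr (_ - _); rewrite [LHS]map_mpolyZ ?map_mpolyX //; congr (_ *: _).
exact: map_mpoly_map.
Qed.

Lemma nonconstant_coef (F : fieldType) n (p : {mpoly F[n]}) :
  nonconstant p -> exists m, m != 0%MM /\ p@_m != 0.
Proof.
move=> pn; have p0 := nonconstant_neq0 pn; exists (mlead p); split.
  by move: pn; rewrite /nonconstant -(mlead_deg p0); apply: contraTneq => ->; rewrite mdeg0.
by rewrite mleadc_eq0.
Qed.

Lemma nonconstant_transfer (F : fieldType) (R S T : comNzRingType) (f : {rmorphism R -> F})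
    (s : {rmorphism R -> T}) (u : {rmorphism S -> T}) n (C : {mpoly F[n]}) C' (c : {mpoly S[n]}) d :
  injective s -> d != 0 -> nonconstant C -> map_mpoly f C' = d *: C ->
  map_mpoly s C' = map_mpoly u c -> exists m, m != 0%MM /\ c@_m != 0.
Proof.
move=> s_inj d0 /nonconstant_coef[m [m0 Cm]] CE cE; exists m; split=> //.
apply: contraNneq Cm => cm; move/mpolyP/(_ m): cE; rewrite !mcoeff_map_mpoly cm /=.
rewrite rmorph0 -(rmorph0 s) => /s_inj C'm.
move/mpolyP/(_ m): CE; rewrite mcoeff_map_mpoly /= C'm mcoeffZ (rmorph0 f) => /esym/eqP.
by rewrite mulf_eq0 (negPf d0).
Qed.

Lemma clear_first (k : fieldType) n (p r : {mpoly k[n]}) x0 a (I : finType) (c d : I -> k)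
    (u : I -> {mpoly k[n]}) : x0 != 0 ->
  (x0 *: p - a *: r) + \sum_t c t *: (x0 *: u t - d t *: r) =
  x0 *: (p + (- ((a + \sum_t c t * d t) / x0) *: r + \sum_t c t *: u t)).
Proof.
move=> x00; rewrite !scalerDr scalerA mulrN mulrCA divff // mulr1 scaleNr scalerDl opprD.
rewrite -!addrA; congr (_ + (_ + _)); rewrite scaler_suml scaler_sumr -sumrN -big_split.
by apply: eq_bigr => t _ /=; rewrite scalerBr addrC !scalerA (mulrC x0).
Qed.

Section FreeFactor.
Variables (K : closedFieldType) (n l : nat) (P : {mpoly K[n]}) (q : 'I_l.+1 -> 'X_{1..n}).
Local Notation R := {mpoly K[l + n]}.
Local Notation R1 := {mpoly K[n]}.
Local Notation j := (point_val K n l).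

(** The minor q0(x) p(z) - p(x) q0(z), which vanishes on the diagonal and, up
    to a scalar, depends only on the pencil spanned by [p] and the first
    monomial. *)
Definition point_minor (p : {mpoly K[n]}) : {mpoly R1[n]} :=
  ('X_[q ord0] : R1) *: map_mpoly (@mpolyC n K) p - p *: 'X_[q ord0].

Definition split_params : {rmorphism R -> {mpoly R1[l]}} :=
  mmap (@mpolyC l R1 \o @mpolyC n K)
    (fun i => match split i with inl t => 'X_t | inr i' => ('X_i')%:MP end).

Lemma split_params_point p : split_params (at_point l p) = p%:MP.
Proof.
apply: (mpoly_rmorph_ext (f := split_params \o @at_point K n l) (g := @mpolyC l R1)) => [c|i] /=.
  by rewrite at_pointC mmapC.
by rewrite at_pointX mmapX mmap1U -[rshift l i]/(unsplit (inr i)) unsplitK.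
Qed.

Lemma split_params_param t : split_params (param K n t) = 'X_t.
Proof. by rewrite /= /param mmapX mmap1U -[lshift n t]/(unsplit (inl t)) unsplitK. Qed.

Lemma split_params_inj : injective split_params.
Proof.
pose back : {rmorphism {mpoly R1[l]} -> R} := mmap (@at_point K n l) (@param K n l).
have backX t : back 'X_t = param K n t by rewrite /= mmapX mmap1U.
have backC p : back p%:MP = at_point l p by rewrite /= mmapC.
apply: (can_inj (g := back)).
have spX i : split_params 'X_i = match split i with inl t => 'X_t | inr i' => ('X_i')%:MP end.
  by rewrite /= mmapX mmap1U.
apply: (mpoly_rmorph_ext (f := back \o split_params) (g := idfun)) => [c|i].
  transitivity (back (c%:MP%:MP)); last by rewrite backC at_pointC.
  by congr (back _); apply: mmapC.
transitivity (back (split_params 'X_i)) => //; rewrite spX -[i in RHS]splitK.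
by case: (split i) => t /=; [apply: backX | rewrite backC at_pointX].
Qed.

Let X0 : j 'X_[q ord0] != 0.
Proof. by rewrite (generic_eq0 (@point_val_inj K n l)) -msize_poly_eq0 msizeX. Qed.

Lemma map_point_minor p :
  map_mpoly j (point_minor p) = j 'X_[q ord0] *: generic_lift j p - j p *: 'X_[q ord0].
Proof.
exact: map_mpoly_minor.
Qed.

Definition cleared_family : {mpoly R[n]} := map_mpoly (@at_point K n l) (point_minor P) +
  \sum_(t < l) param K n t *:
    map_mpoly (@at_point K n l) (point_minor 'X_[q (fintype.lift ord0 t)]).

Lemma cleared_familyE :
  map_mpoly (@tofrac R) cleared_family = j 'X_[q ord0] *: point_family P q.
Proof.
transitivity (map_mpoly j (point_minor P) + \sum_(t < l) tofrac (param K n t) *: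
    map_mpoly j (point_minor 'X_[q (fintype.lift ord0 t)])).
  exact: map_mpoly_comb.
transitivity ((j 'X_[q ord0] *: generic_lift j P - j P *: 'X_[q ord0]) +
    \sum_(t < l) point_params P q (fintype.lift ord0 t) *: (j 'X_[q ord0] *: 'X_[q (fintype.lift ord0 t)] -
      j 'X_[q (fintype.lift ord0 t)] *: 'X_[q ord0])).
  congr (_ + _); first exact: map_point_minor; apply: eq_bigr => t _.
  by rewrite map_point_minor generic_liftX point_paramsS.
rewrite (clear_first _ _ _ _ _ _ X0); congr (_ *: _).
by rewrite [RHS]/point_family big_ord_recl point_params0 point_numE.
Qed.

Hypotheses (P_other : exists e, P@_e != 0 /\ e != q ord0).
Variables A B : {mpoly {fraction R}[n]}.
Hypotheses (fE : point_family P q = A * B) (An : nonconstant A) (Bn : nonconstant B).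

Lemma point_minor_neq0 : point_minor P != 0.
Proof.
have [e [Pe eq]] := P_other; apply/eqP => /mpolyP/(_ e); rewrite mcoeffB !mcoeffZ mcoeffX.
rewrite eq_sym (negPf eq) mulr0 subr0 mcoeff0 mcoeff_map_mpoly => /eqP.
by rewrite mulf_eq0 -msize_poly_eq0 msizeX /= mpolyC_eq0 (negPf Pe).
Qed.

(** The first parameter having been eliminated, the family is affine in the
    other ones, so that one of its two factors does not contain them. *)
Lemma parameter_free_factor : exists a : {mpoly R1[n]},
  [/\ exists m, m != 0%MM /\ a@_m != 0, divides a (point_minor P)
    & forall t, divides a (point_minor 'X_[q (fintype.lift ord0 t)])].
Proof.
have tofrac_inj : injective (@tofrac R) by move=> u v /eqP; rewrite tofrac_eq => /eqP.
have clE : map_mpoly (@tofrac R) cleared_family = (j 'X_[q ord0] *: A) * B.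
  by rewrite cleared_familyE fE scalerAl.
have fracR t : exists p r, @tofrac R r != 0 /\ t = tofrac p / tofrac r.
  by have [u [v [v0 ->]]] := fracE t; exists u, v; rewrite tofrac_eq0.
have [A' [B' [a [b [cE a0 b0 AE BE]]]]] :=
  gauss_factor (factorial_mpoly (@factorial_field K)) tofrac_inj fracR clE.
have clS : map_mpoly split_params cleared_family = map_mpoly (@mpolyC l R1) (point_minor P) +
    \sum_(t < l) ('X_t : {mpoly R1[l]}) *:
      map_mpoly (@mpolyC l R1) (point_minor 'X_[q (fintype.lift ord0 t)]).
  exact: (map_mpoly_comb _ _ split_params_point split_params_param).
have clM : map_mpoly split_params cleared_family = map_mpoly split_params A' * map_mpoly split_params B'.
  by rewrite cE; apply: (rmorphM (map_mpoly split_params)).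
have [c [cAB dP dq]] := affine_factor point_minor_neq0 (etrans (esym clS) clM).
exists c; split=> //.
case: cAB => [cA|cB].
  have aX : a * j 'X_[q ord0] != 0 := mulf_neq0 a0 X0.
  exact: (nonconstant_transfer split_params_inj aX An (etrans AE (scalerA _ _ _)) cA).
exact: (nonconstant_transfer split_params_inj b0 Bn BE cB).
Qed.
End FreeFactor.
(** * Several monomials: all exponents lie on a line *)

Section Descent.
Variables (K : closedFieldType) (n : nat) (k : fieldType) (j : {rmorphism {mpoly K[n]} -> k}).
Hypothesis j_inj : injective j.
Variables (M : closedFieldType) (emb : {rmorphism k -> M}).
Local Notation lift := (generic_lift j).
Local Notation minor m p := (j 'X_[m] *: lift p - j p *: 'X_[m]).

(** The coefficients of a divisor are algebraic over [K], up to a common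
    factor, and [K] is algebraically closed. *)
Lemma divisor_descends (A : {mpoly k[n]}) (r : {mpoly K[n]}) : r != 0 -> divides A (lift r) ->
  exists (a : {mpoly K[n]}) c, c != 0 /\ map_mpoly emb (lift a) = c *: map_mpoly emb A.
Proof.
move=> r0 Ar.
have mapE p : map_mpoly emb (lift p) = map_mpoly (emb \o generic_const j) p.
  exact: map_mpoly_map.
have [|c c0 alg] := @factor_coef_algebraic K M (emb \o generic_const j) n r (map_mpoly emb A) r0.
  by rewrite -mapE; apply: (dvd_rmorph (map_mpoly emb)).
have [m|a aE] := @lift_mpoly K M (emb \o generic_const j) n (c *: map_mpoly emb A).
  by rewrite mcoeffZ; have [e ->] := closed_algebraic (alg m); exists e.
by exists a, c; rewrite mapE.
Qed.

(** The ratio of [p] to the monomial is not constant at the generic point, so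
    that a divisor over [K] of the minor divides each of them. *)
Lemma minor_descends (A : {mpoly k[n]}) a c m p : p != 0 -> ~ eq_upto_const p 'X_[m] ->
  c != 0 -> map_mpoly emb (lift a) = c *: map_mpoly emb A -> divides A (minor m p) ->
  divides a p /\ divides a 'X_[m].
Proof.
move=> p0 pN c0 aE dA.
have X0 : j 'X_[m] != 0 by rewrite (generic_eq0 j_inj) -msize_poly_eq0 msizeX.
have d1 : divides (lift a) (minor m p).
  apply: (dvd_descend (i := emb)); rewrite aE; apply: dvdZ => //.
  exact: (dvd_rmorph (map_mpoly emb)).
have d2 : divides (lift a) (lift p - (j p / j 'X_[m]) *: lift 'X_[m]).
  have -> : lift p - (j p / j 'X_[m]) *: lift 'X_[m] = (j 'X_[m])^-1%:MP * minor m p.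
    rewrite mul_mpolyC scalerBr !scalerA mulVf // scale1r mulrC.
    by congr (_ - _ *: _); apply: map_mpolyX.
  exact: dvdMl.
exact: (dvd_descend_pair (ratio_not_const j_inj p0 pN) d2).
Qed.

(** Let [w] be a weight that does not separate two of the monomials. The common
    factor divides their minor and is therefore homogeneous for [w]. If a term
    of [p] had another weight, the factor would divide the corresponding
    component of [p] alone, hence would not depend on the generic point. *)
Lemma minor_component (w : 'I_n -> int) (A : {mpoly k[n]}) m m1 p e :
  m1 != m -> wt w m1 = wt w m ->
  divides A (minor m 'X_[m1]) -> divides A (minor m p) -> p@_e != 0 -> wt w e != wt w m ->
  exists2 r, r != 0 & divides A (lift r).
Proof.
move=> m1m wm1 d1 dp pe we.
have X0 : j 'X_[m] != 0 by rewrite (generic_eq0 j_inj) -msize_poly_eq0 msizeX.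
have liftX u : lift 'X_[u] = 'X_[u] by apply: map_mpolyX.
have [a Aa] : exists a, whomog w a A.
  move: d1 => [H HE]; rewrite mulrC in HE; apply: (whomog_factor (B := H) (c := wt w m)).
    rewrite -HE; apply/eqP => /mpolyP/(_ m1); rewrite liftX mcoeffB !mcoeffZ !mcoeffX eqxx.
    by rewrite eq_sym (negPf m1m) mulr0 mulr1 subr0 mcoeff0 => /eqP; rewrite (negPf X0).
  rewrite -HE liftX -scaleNr; apply: whomogD; apply: whomogZ; last exact: whomogX.
  by rewrite -wm1; apply: whomogX.
exists (wcomp w (wt w e) p).
  by apply/eqP => /mpolyP/(_ e); rewrite mcoeff_wcomp eqxx mcoeff0 => /eqP; rewrite (negPf pe).
have lift_wcomp : lift (wcomp w (wt w e) p) = wcomp w (wt w e) (lift p).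
  apply/mpolyP => u; rewrite mcoeff_wcomp /lift !mcoeff_map_mpoly mcoeff_wcomp.
  by case: ifP => // _; rewrite /= mpolyC0 rmorph0.
move: dp => [H HE]; exists ((j 'X_[m])^-1 *: wcomp w (wt w e - a) H).
rewrite lift_wcomp -scalerAl mulrC -(wcompM _ _ Aa) mulrC -HE wcompD wcompZ -scaleNr wcompZ.
rewrite (wcomp_ne (p := 'X_[m])) ?scaler0 ?addr0 ?scalerA ?mulVf ?scale1r //.
by move=> u; rewrite msuppX inE => /eqP ->; rewrite eq_sym.
Qed.
End Descent.
Lemma coef_nonconstant (F : fieldType) n (p : {mpoly F[n]}) m :
  m != 0%MM -> p@_m != 0 -> nonconstant p.
Proof.
move=> m0; rewrite -mcoeff_msupp => /msize_mdeg_lt; apply: leq_trans.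
by rewrite ltnS lt0n mdeg_eq0.
Qed.

Section Collinear.
Variables (K : closedFieldType) (n l : nat) (P : {mpoly K[n]}) (q : 'I_l.+1 -> 'X_{1..n}).
Variables (L : algClosure (ratfun K l.+1)) (M : algClosure (ratfun K (l + n)))
  (M1 : algClosure (ratfun K n)).
Hypotheses (P_nonconst : nonconstant P) (P_not_mono : ~ monomial_upto_const P)
  (P_not_pow : ~ pure_power P)
  (cop : forall r, divides r P -> (forall t, divides r 'X_[q t]) -> ~ nonconstant r)
  (q_inj : injective q).

(** An exponent of another weight would make the common factor of the minors
    descend to [K], where it would divide [P] and all the monomials. *)
Lemma site_same_weight :
  mreducible (to_closure L P + \sum_(i < l.+1) lambda L i *: 'X_[q i]) ->
  forall w t1, wt w (q (fintype.lift ord0 t1)) = wt w (q ord0) ->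
  (forall e, P@_e != 0 -> wt w e = wt w (q ord0)) /\ forall t, wt w (q t) = wt w (q ord0).
Proof.
move=> red w t1 wt1.
have P0 := nonconstant_neq0 P_nonconst.
have two := exists_other_term (q ord0) P0 P_not_mono.
have [A [B [fE An Bn _ _]]] := family_factor M P_nonconst P_not_mono P_not_pow cop red.
have [a [[m [m0 am]] dP dq]] := parameter_free_factor two fE An Bn.
pose j : {rmorphism {mpoly K[n]} -> ratfun K n} := @tofrac {mpoly K[n]}.
have j_inj : injective j by move=> u v /eqP; rewrite tofrac_eq => /eqP.
pose A1 : {mpoly (ratfun K n)[n]} := map_mpoly j a.
have minorE p : map_mpoly j (point_minor q p) =
    j 'X_[q ord0] *: generic_lift j p - j p *: 'X_[q ord0].
  exact: map_mpoly_minor.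
have dP1 : divides A1 (j 'X_[q ord0] *: generic_lift j P - j P *: 'X_[q ord0]).
  by rewrite -minorE; apply: (dvd_rmorph (map_mpoly j)).
have dq1 t : divides A1 (j 'X_[q ord0] *: generic_lift j 'X_[q (fintype.lift ord0 t)]
    - j 'X_[q (fintype.lift ord0 t)] *: 'X_[q ord0]).
  by rewrite -minorE; apply: (dvd_rmorph (map_mpoly j)); apply: dq.
have X0 u : ('X_[u] : {mpoly K[n]}) != 0 by rewrite -msize_poly_eq0 msizeX.
have q_ne t : q (fintype.lift ord0 t) != q ord0.
  by rewrite (inj_eq q_inj) eq_sym neq_lift.
have qN t : ~ eq_upto_const ('X_[q (fintype.lift ord0 t)] : {mpoly K[n]}) 'X_[q ord0].
  move=> [c c0 /mpolyP/(_ (q (fintype.lift ord0 t)))].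
  rewrite mcoeffZ !mcoeffX eqxx eq_sym (negPf (q_ne t)) mulr0 => /eqP.
  by rewrite oner_eq0.
have PN : ~ eq_upto_const P 'X_[q ord0] by move=> H; apply: P_not_mono; exists (q ord0).
have absurd p e : divides A1 (j 'X_[q ord0] *: generic_lift j p - j p *: 'X_[q ord0]) ->
    p@_e != 0 -> wt w e = wt w (q ord0).
  move=> dp pe; apply/eqP; apply: contraT => we.
  have [r r0 dr] := minor_component j_inj (q_ne t1) wt1 (dq1 t1) dp pe we.
  have [b [c [c0 bE]]] := divisor_descends (closure_emb M1) r0 dr.
  have [bP bX] := minor_descends j_inj P0 PN c0 bE dP1.
  case: (cop bP).
    move=> t; have [t' ->|->] := unliftP ord0 t; last exact: bX.
    exact: (minor_descends j_inj (X0 _) (qN t') c0 bE (dq1 t')).1.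
  apply: (nonconstant_map (generic_const j) b).1.
  apply: (nonconstant_map (closure_emb M1) _).1.
  rewrite -[map_mpoly _ b]/(generic_lift j b) bE.
  apply: (coef_nonconstant m0); rewrite mcoeffZ !mcoeff_map_mpoly mulf_neq0 //=.
  by rewrite fmorph_eq0 -(rmorph0 j) (inj_eq j_inj).
split=> [e|t]; first exact: absurd.
have [t' ->|-> //] := unliftP ord0 t.
by apply: (absurd _ _ (dq1 t')); rewrite mcoeffX eqxx oner_eq0.
Qed.
End Collinear.
(** * Factoring binary forms *)

Section BinaryFormExpansion.
Variables (K : fieldType) (n : nat).
Implicit Types (P phi psi : {mpoly K[n]}) (p : {poly K}).

Lemma binary_form_poly phi psi d P : binary_form_in phi psi d P ->
  exists2 p : {poly K}, (size p <= d.+1)%N & P = homogenize phi psi p d.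
Proof.
move=> [h [/dhomogP hh ->]]; rewrite comp_mpolyE big_seq.
pose ok (S : {mpoly K[n]}) := exists2 p : {poly K}, (size p <= d.+1)%N & S = homogenize phi psi p d.
apply: (big_ind ok).
- exists 0; first by rewrite size_poly0.
  by rewrite /homogenize big1 // => l _; rewrite coef0 scale0r.
- move=> _ _ [p ps ->] [r rs ->]; exists (p + r).
    by rewrite (leq_trans (size_polyD _ _)) // geq_max ps.
  rewrite /homogenize -big_split; apply: eq_bigr => l _ /=.
  by rewrite coefD scalerDl.
move=> m /hh dm'; have dm : mdeg m = d by exact: dm'.
have md : (m ord0 + m (fintype.lift ord0 ord0))%N = d.
  by rewrite -dm mdegE !big_ord_recl big_ord0 addn0.
have m0d : (m ord0 < d.+1)%N by rewrite ltnS -md leq_addr.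
exists (h@_m *: 'X^(m ord0)).
  by rewrite (leq_trans (size_scale_leq _ _)) // size_polyXn.
rewrite !big_ord_recl big_ord0 mulr1 !(tnth_nth 0) /=.
rewrite /homogenize (bigD1 (Ordinal m0d)) //= big1 => [|l /negPf lm].
  by rewrite coefZ coefXn eqxx mulr1 addr0 -[in (d - _)%N]md addKn.
by rewrite coefZ coefXn -[(l : nat) == _]/(l == Ordinal m0d) lm mulr0 scale0r.
Qed.

Lemma binary_form_monomial phi psi k l : binary_form_in phi psi (k + l) (phi ^+ k * psi ^+ l).
Proof.
have powF Q e : binary_form_in phi psi 1 Q -> binary_form_in phi psi e (Q ^+ e).
  move=> HQ; elim: e => [|e IH]; first by rewrite expr0 -mpolyC1; apply: binary_form_const.
  by rewrite exprS -add1n; apply: binary_formM.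
have := binary_form_linear phi psi 1 0; have := binary_form_linear phi psi 0 1.
rewrite !scale1r !scale0r add0r addr0 => f1 f2.
by apply: binary_formM; apply: powF.
Qed.

Lemma binary_form0 phi psi d : binary_form_in phi psi d 0.
Proof.
rewrite -(scale0r (phi ^+ d * psi ^+ 0)); apply: binary_formZ.
by rewrite -[X in binary_form_in _ _ X]addn0; apply: binary_form_monomial.
Qed.

Lemma binary_form_sum phi psi d (I : Type) (r : seq I) (Pr : pred I) (G : I -> {mpoly K[n]}) :
  (forall i, Pr i -> binary_form_in phi psi d (G i)) ->
  binary_form_in phi psi d (\sum_(i <- r | Pr i) G i).
Proof. by move=> H; apply: big_ind => //; [apply: binary_form0 | apply: binary_formD]. Qed.

Lemma binary_form_homogenize phi psi p d : binary_form_in phi psi d (homogenize phi psi p d).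
Proof.
apply: binary_form_sum => l _; apply: binary_formZ.
have ld : (l <= d)%N by rewrite -ltnS.
by rewrite -{1}(subnKC ld); apply: binary_form_monomial.
Qed.

Lemma homogenize_low phi psi p d : (size p <= d.+1)%N ->
  homogenize phi psi p d.+1 = psi * homogenize phi psi p d.
Proof.
move=> ps; rewrite /homogenize big_ord_recr /= [p`_d.+1]nth_default // scale0r addr0 mulr_sumr.
apply: eq_bigr => l _; have ld : (l <= d)%N by rewrite -ltnS.
by rewrite subSn // exprS -scalerAr mulrCA.
Qed.

End BinaryFormExpansion.

Lemma binary_form_map (K L : fieldType) (f : {rmorphism K -> L}) n (phi psi : {mpoly K[n]}) d P :
  binary_form_in phi psi d P ->
  binary_form_in (map_mpoly f phi) (map_mpoly f psi) d (map_mpoly f P).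
Proof.
case/binary_form_poly => p _ ->; have -> : map_mpoly f (homogenize phi psi p d) =
    homogenize (map_mpoly f phi) (map_mpoly f psi) (map_poly f p) d.
  rewrite (rmorph_sum (map_mpoly f)); apply: eq_bigr => l _ /=.
  by rewrite map_mpolyZ (rmorphM (map_mpoly f)) !(rmorphXn (map_mpoly f)) coef_map.
exact: binary_form_homogenize.
Qed.

Definition pencil_line (K : fieldType) n (phi psi : {mpoly K[n]}) (ab : K * K) : {mpoly K[n]} :=
  ab.1 *: phi + ab.2 *: psi.

Lemma binary_form_split (K : closedFieldType) n (phi psi : {mpoly K[n]}) d P :
  binary_form_in phi psi d P -> exists c (s : seq (K * K)),
  [/\ size s = d, forall ab, ab \in s -> (ab.1 != 0) || (ab.2 != 0)
    & P = c *: \prod_(ab <- s) pencil_line phi psi ab].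
Proof.
case/binary_form_poly => p ps ->; have [->|p0] := eqVneq p 0.
  exists 0, (nseq d (1, 0)); rewrite size_nseq scale0r; split=> //.
    by move=> ab /nseqP[-> _]; rewrite oner_eq0.
  by rewrite /homogenize big1 // => l _; rewrite coef0 scale0r.
have [rs pE] := closed_field_poly_normal p; set c := lead_coef p in pE.
have c0 : c != 0 by rewrite lead_coef_eq0.
have prs : size p = (size rs).+1 by rewrite pE size_scale // size_prod_XsubC.
have rsd : (size rs <= d)%N by rewrite -ltnS -prs.
have lowE k : homogenize phi psi p (size rs + k) = psi ^+ k * homogenize phi psi p (size rs).
  elim: k => [|k IH]; first by rewrite addn0 expr0 mul1r.
  rewrite addnS homogenize_low ?IH ?exprS ?mulrA //.
  by rewrite prs ltnS leq_addr.
exists c, ([seq (1, - r) | r <- rs] ++ nseq (d - size rs) (0, 1)); split.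
- by rewrite size_cat size_map size_nseq subnKC.
- move=> ab; rewrite mem_cat => /orP[/mapP[r _ ->]|/nseqP[-> _]]; rewrite ?oner_eq0 ?orbT //.
rewrite -(subnKC rsd) lowE pE homogenize_prod addKn -scalerAr big_cat big_map /= mulrC.
congr (_ *: (_ * _)).
  by apply: eq_bigr => r _; rewrite /pencil_line scale1r scaleNr.
rewrite (eq_big_seq (fun=> psi)); last first.
  by move=> ab /nseqP[-> _]; rewrite /pencil_line scale0r add0r scale1r.
by rewrite big_const_seq count_predT size_nseq iter_mulr mulr1.
Qed.

(** * Linear factors of a form *)

(** A factor that is left alone, all other ones being constant, would be as
    large as the product. *)
Lemma reducible_product (F : fieldType) n (s : seq {mpoly F[n]}) c (f : {mpoly F[n]}) :
  nonconstant f -> f = c *: \prod_(g <- s) g ->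
  (forall g, g \in s -> (msize g < msize f)%N) -> mreducible f.
Proof.
move=> fn; elim: s c => [|g s IH] c; rewrite ?big_nil ?big_cons => fE gs.
  move: fn; rewrite /nonconstant fE -mul_mpolyC mulr1 msizeC; by case: (_ != 0).
have f0 := nonconstant_neq0 fn.
have c0 : c != 0 by apply: contraNneq f0 => c0; rewrite fE c0 scale0r.
have [gn|gc] := ltnP 1 (msize g); last first.
  apply: (IH (c * g@_0)) => [|g' g's]; last by apply: gs; rewrite inE g's orbT.
  by rewrite fE {1}(msize1_polyC gc) mul_mpolyC scalerA.
have [rn|rc] := ltnP 1 (msize (\prod_(h <- s) h)).
  exists (c *: g), (\prod_(h <- s) h); split=> //; last by rewrite -scalerAl.
  by rewrite /nonconstant msizeZ.
have [r fgE] : exists r, f = r *: g.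
  by exists (c * (\prod_(h <- s) h)@_0); rewrite fE {1}(msize1_polyC rc) mulrC mul_mpolyC scalerA.
have r0 : r != 0 by apply: contraNneq f0 => r0; rewrite fgE r0 scale0r.
have := gs g; rewrite inE eqxx => /(_ isT).
by rewrite [in msize f]fgE msizeZ // ltnn.
Qed.
Lemma msize_line_lt (K : fieldType) n (phi psi : {mpoly K[n]}) ab N :
  (msize phi < N)%N -> (msize psi < N)%N -> (msize (pencil_line phi psi ab) < N)%N.
Proof. by case: N => // N; rewrite !ltnS; apply: msize_lin_le. Qed.

Lemma not_power_of_small (K : closedFieldType) n (P A : {mpoly K[n]}) c e :
  nonconstant P -> ~ pure_power P -> (msize A < msize P)%N -> P <> c *: A ^+ e.
Proof.
move=> Pn PN AP PE; move: e => [|[|e]] in PE.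
- move: Pn; rewrite /nonconstant PE expr0 -mul_mpolyC mulr1 msizeC; by case: (_ != 0).
- by move: AP; rewrite PE expr1 ltnNge msizeZ_le.
have [d dE] := closed_root c (ltn0Sn e.+1).
by apply: PN; exists (d *: A), e.+2; rewrite exprZn dE.
Qed.

(** Over an algebraically closed field a form splits into linear factors. If
    no two are independent, all are proportional to the first one. *)
Lemma form_dichotomy (K : closedFieldType) n (phi psi : {mpoly K[n]}) d P :
  binary_form_in phi psi d P ->
  (exists ab1 ab2, [/\ ab1.1 * ab2.2 - ab2.1 * ab1.2 != 0,
     divides (pencil_line phi psi ab1) P & divides (pencil_line phi psi ab2) P]) \/
  (exists c ab, ((ab.1 != 0) || (ab.2 != 0)) /\ P = c *: pencil_line phi psi ab ^+ d).
Proof.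
case/binary_form_split => c [s [sd sn PE]].
case: s => [|ab0 s] in sd sn PE.
  right; exists c, (1, 0); rewrite oner_eq0 -sd; split=> //.
  by rewrite PE big_nil expr0.
have dvd_line ab : ab \in ab0 :: s -> divides (pencil_line phi psi ab) P.
  move=> ab_s; rewrite PE -mul_mpolyC; apply: dvdMl; rewrite (big_rem ab) //=; exact: dvd_mulr.
have [/hasP[ab ab_s ne]|/hasPn prop] :=
    boolP (has (fun ab => ab0.1 * ab.2 - ab.1 * ab0.2 != 0) s).
  by left; exists ab0, ab; split=> //; apply: dvd_line; rewrite inE ?eqxx // ab_s orbT.
right; rewrite PE -sd /=.
suff [e eE] : exists e, \prod_(ab <- s) pencil_line phi psi ab = e *: pencil_line phi psi ab0 ^+ size s.
  exists (c * e), ab0; split; first by apply: sn; rewrite inE eqxx.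
  by rewrite big_cons eE exprS -scalerAr scalerA.
have ab00 : (ab0.1 != 0) || (ab0.2 != 0) by apply: sn; rewrite inE eqxx.
elim: s prop {sd sn PE dvd_line} => [|ab s IH] prop.
  by exists 1; rewrite big_nil expr0 scale1r.
have [|e eE] := IH; first by move=> ab' ab's; apply: prop; rewrite inE ab's orbT.
have /prop : ab \in ab :: s by rewrite inE eqxx.
rewrite negbK subr_eq0 eq_sym => /eqP /(proportional ab00)[r [r1 r2]].
exists (r * e); rewrite big_cons eE /= exprS /pencil_line r1 r2 -!scalerA -scalerDr.
by rewrite -scalerAl -scalerAr !scalerA.
Qed.

Lemma monomial_form_supp (K : fieldType) n (m1 m2 : 'X_{1..n}) d (P : {mpoly K[n]}) e :
  binary_form_in 'X_[m1] 'X_[m2] d P -> P@_e != 0 ->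
  exists2 k, (k <= d)%N & e = (m1 *+ k + m2 *+ (d - k))%MM.
Proof.
case/binary_form_poly => p _ -> Pe; apply: NNPP => H; case/eqP: Pe.
rewrite (raddf_sum (mcoeff e)) big1 // => l _ /=.
rewrite mcoeffZ !mpolyXn -mpolyXD mcoeffX; case: eqP => [E|_]; last by rewrite mulr0.
by case: H; exists l; rewrite // -ltnS.
Qed.

Lemma weights_separate (g1 g2 : int) a l d : g1 != g2 -> (l <= d)%N -> (a <= d)%N ->
  g1 *+ l + g2 *+ (d - l) = g1 *+ a + g2 *+ (d - a) -> l = a.
Proof.
move=> g12 ld ad; have mulE (g : int) k : g *+ k = g * k%:Z by rewrite -mulr_natr natz.
rewrite !mulE -!subzn // => E.
have : (g1 - g2) * (l%:Z - a%:Z) = 0.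
  have -> : (g1 - g2) * (l%:Z - a%:Z) =
    (g1 * l%:Z + g2 * (d%:Z - l%:Z)) - (g1 * a%:Z + g2 * (d%:Z - a%:Z)) by ring.
  by rewrite E subrr.
by move/eqP; rewrite mulf_eq0 !subr_eq0 (negPf g12) /= eqz_nat => /eqP.
Qed.

Section FormWeights.
Import Order.TTheory Num.Theory.
Variables (K : closedFieldType) (n : nat) (w : 'I_n -> int).

Lemma whomog_form (A1 A2 : {mpoly K[n]}) g d p : whomog w g A1 -> whomog w g A2 ->
  whomog w (g *+ d) (homogenize A1 A2 p d).
Proof.
move=> h1 h2; apply: (big_ind (whomog w (g *+ d))).
- by move=> m; rewrite msupp0.
- by move=> ? ?; apply: whomogD.
move=> l _; apply: whomogZ; have ld : (l <= d)%N by rewrite -ltnS.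
rewrite -[in g *+ d](subnKC ld) mulrnDr; apply: whomogM; exact: whomog_exp.
Qed.

(** The products [A1 ^+ a * A2 ^+ (d - a)] have pairwise distinct weights, so
    that only one can occur. *)
Lemma whomog_form_single (A1 A2 : {mpoly K[n]}) g1 g2 g d p :
  whomog w g1 A1 -> whomog w g2 A2 -> g1 != g2 ->
  whomog w g (homogenize A1 A2 p d) -> homogenize A1 A2 p d != 0 ->
  exists a c, (a <= d)%N /\ homogenize A1 A2 p d = c *: (A1 ^+ a * A2 ^+ (d - a)).
Proof.
move=> h1 h2 g12 hg; set S := homogenize _ _ _ _ in hg * => S0.
pose t l := g1 *+ l + g2 *+ (d - l).
have term l : whomog w (t l) (A1 ^+ l * A2 ^+ (d - l)) by apply: whomogM; apply: whomog_exp.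
have SE : S = \sum_(l < d.+1) p`_l *: wcomp w g (A1 ^+ l * A2 ^+ (d - l)).
  rewrite -[LHS](wcomp_id hg) /S /homogenize.
  elim/big_ind2: _ => [|a b a' b' <- <-|l _]; last by rewrite wcompZ.
    by rewrite wcomp_ne // => m; rewrite msupp0.
  by rewrite wcompD.
have [a ta|none] := pickP (fun l : 'I_d.+1 => t l == g); last first.
  case/eqP: S0; rewrite SE big1 // => l _; rewrite wcomp_ne ?scaler0 // => m /term ->.
  by rewrite none.
exists a, p`_a; split; first by rewrite -ltnS.
rewrite SE (bigD1 a) //= big1 => [|l la].
  by rewrite addr0 wcomp_id // -(eqP ta).
rewrite wcomp_ne ?scaler0 // => m /term ->; apply: contraNneq la => tl.
by apply/eqP/ord_inj/(weights_separate g12 _ _ (etrans tl (esym (eqP ta)))); rewrite -ltnS.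
Qed.
End FormWeights.
Section OneMonomialWeight.
Import Order.TTheory Num.Theory.
Variables (K : closedFieldType) (n : nat) (w : 'I_n -> int).
Variables (P phi psi : {mpoly K[n]}) (q : 'X_{1..n}) (d : nat).
Hypotheses (P_nonconst : nonconstant P) (P_not_pow : ~ pure_power P).
Hypotheses (phi_lt : (msize phi < msize P)%N) (psi_lt : (msize psi < msize P)%N).
Hypotheses (copPq : coprime_mpoly P 'X_[q]).
Hypotheses (P_form : binary_form_in phi psi d P) (q_form : binary_form_in phi psi d 'X_[q]).

(** Two independent linear factors of [P] are homogeneous. If their weights
    differ, both [P] and the monomial are single products of their powers, and
    have a common factor. *)
Lemma one_monomial_weight g : whomog w g P -> wt w q = g.
Proof.
move=> Pg; have P0 := nonconstant_neq0 P_nonconst.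
case: (form_dichotomy P_form) => [[ab1 [ab2 [det d1 d2]]]|[c [ab [_ PE]]]]; last first.
  by case: (not_power_of_small P_nonconst P_not_pow (msize_line_lt ab phi_lt psi_lt) PE).
set A1 := pencil_line phi psi ab1 in d1 *; set A2 := pencil_line phi psi ab2 in d2 *.
have homA A : divides A P -> exists g', whomog w g' A.
  move=> [B PB]; apply: (whomog_factor (B := B) (c := g)); by rewrite mulrC -PB.
have [g1 h1] := homA _ d1; have [g2 h2] := homA _ d2.
have [u1 [v1 [u2 [v2 [phiE psiE]]]]] := cramer2 phi psi det.
have f1 : binary_form_in A1 A2 1 phi by rewrite phiE; apply: binary_form_linear.
have f2 : binary_form_in A1 A2 1 psi by rewrite psiE; apply: binary_form_linear.
have [p _ PE] := binary_form_poly (binary_form_ind f1 f2 P_form).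
have [r _ qE] := binary_form_poly (binary_form_ind f1 f2 q_form).
have q_supp : q \in msupp ('X_[q] : {mpoly K[n]}) by rewrite msuppX inE.
have [g12|g12] := eqVneq g1 g2.
  rewrite -g12 in h2; have Pl : mlead P \in msupp P by rewrite mcoeff_msupp mleadc_eq0.
  have WP := whomog_form (d := d) (p := p) h1 h2; have Wq := whomog_form (d := d) (p := r) h1 h2.
  by rewrite -(Pg _ Pl); rewrite -PE in WP; rewrite -qE in Wq; rewrite (WP _ Pl) (Wq _ q_supp).
have lt1 := msize_line_lt ab1 phi_lt psi_lt; have lt2 := msize_line_lt ab2 phi_lt psi_lt.
have [|//|b [c [bd PEb]]] := whomog_form_single h1 h2 g12 (g := g) (p := p) (d := d); rewrite -?PE //.
have [||a [c' [ad qEa]]] := whomog_form_single h1 h2 g12 (g := wt w q) (p := r) (d := d).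
- by rewrite -qE; apply: whomogX.
- by rewrite -qE -msize_poly_eq0 msizeX.
rewrite -PE in PEb; rewrite -qE in qEa.
have absurd A e c0 : (msize A < msize P)%N -> P <> c0 *: A ^+ e.
  exact: not_power_of_small.
have b0 : b != 0%N.
  apply: contra_notN (absurd A2 d c lt2) => /eqP b0.
  by rewrite {1}PEb b0 expr0 mul1r subn0.
have bd' : (d - b)%N != 0%N.
  apply: contra_notN (absurd A1 b c lt1) => /eqP bd'.
  by rewrite {1}PEb bd' expr0 mulr1.
have constX (e0 : K) e : (e0%:MP : {mpoly K[n]}) ^+ e = (e0 ^+ e)%:MP.
  by rewrite -(rmorphXn (@mpolyC n K)).
have n1 : nonconstant A1.
  rewrite /nonconstant ltnNge; apply/negP => /msize1_polyC A1E.
  apply: (absurd A2 (d - b)%N (c * A1@_0 ^+ b)) => //.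
  by rewrite {1}PEb {1}A1E constX mul_mpolyC scalerA.
have n2 : nonconstant A2.
  rewrite /nonconstant ltnNge; apply/negP => /msize1_polyC A2E.
  apply: (absurd A1 b (c * A2@_0 ^+ (d - b))) => //.
  by rewrite {1}PEb {1}A2E constX mulrC mul_mpolyC scalerA.
have dvdS (A : {mpoly K[n]}) e c0 B : e != 0%N -> divides A (c0 *: (A ^+ e * B)).
  by case: e => // e _; rewrite -mul_mpolyC exprS -mulrA; apply: dvdMl; apply: dvd_mulr.
have [a0|a0] := eqVneq a 0%N; last first.
  by case: (copPq (d := A1)) => //; rewrite qEa; apply: dvdS.
have d0 : d != 0%N by rewrite -lt0n (leq_trans _ bd) // lt0n.
case: (copPq (d := A2)) => //.
by rewrite qEa mulrC; apply: dvdS; rewrite a0 subn0.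
Qed.
End OneMonomialWeight.
(** * Exponents on a line *)

Section ExponentLine.
Variable n : nat.
Implicit Types (m e : 'X_{1..n}) (v x : 'I_n -> int).

Definition mdiff m1 m2 (i : 'I_n) : int := (m1 i)%:Z - (m2 i)%:Z.

Definition primitive_vec v : Prop := forall g : nat, (forall i, g %| `|v i|)%N -> g = 1%N.

(** A multiple of a primitive integral vector by a fraction is integral only if
    the fraction is. *)
Lemma proportional_primitive v x i0 : v i0 != 0 -> (forall i k, v k * x i = v i * x k) ->
  primitive_vec v -> exists c, forall i, x i = c * v i.
Proof.
move=> v0 vx prim; set d := gcdz (x i0) (v i0).
have d0 : d != 0 by rewrite gcdz_eq0 negb_and v0 orbT.
have /dvdzP[s sE] : (d %| x i0)%Z by apply: dvdz_gcdl.
have /dvdzP[t tE] : (d %| v i0)%Z by apply: dvdz_gcdr.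
have cop : coprimez t s.
  have dE : `|d|%N%:Z = d by [].
  apply/eqP/(mulIf d0); rewrite mul1r.
  transitivity (gcdz t s * `|d|%N%:Z); first by rewrite dE.
  by rewrite mulz_gcdl -sE -tE gcdzC.
have tx i : t * x i = s * v i.
  apply: (mulIf d0); rewrite -mulrA (mulrC (x i)) mulrA -tE vx sE; ring.
have t1 : `|t|%N = 1%N.
  apply: prim => i; have : (t %| s * v i)%Z by rewrite -tx dvdz_mulr.
  by rewrite Gauss_dvdzr.
have tt : t * t = 1.
  have arith (z : int) : `|z|%N = 1%N -> z = 1 \/ z = -1 by lia.
  by case: (arith t t1) => ->.
exists (t * s) => i.
by rewrite -mulrA -tx mulrA tt mul1r.
Qed.

Lemma wt_pair (a b : int) i k m :
  wt (fun t => a * (t == i)%:Z - b * (t == k)%:Z) m = a * (m i)%:Z - b * (m k)%:Z.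
Proof.
rewrite /wt; under eq_bigr => t _ do rewrite mulrBl -!mulrA.
rewrite sumrB -!mulr_sumr; congr (_ * _ - _ * _).
  rewrite (bigD1 i) //= eqxx mul1r big1 ?addr0 // => t /negPf ->; exact: mul0r.
rewrite (bigD1 k) //= eqxx mul1r big1 ?addr0 // => t /negPf ->; exact: mul0r.
Qed.

(** It suffices to use the weights that involve two coordinates only. *)
Lemma wt_parallel m1 m2 e e' :
  (forall w, wt w m1 = wt w m2 -> wt w e = wt w e') ->
  forall i k, mdiff m1 m2 k * mdiff e e' i = mdiff m1 m2 i * mdiff e e' k.
Proof.
move=> H i k; set v := mdiff m1 m2.
have : wt (fun t => v k * (t == i)%:Z - v i * (t == k)%:Z) m1 =
       wt (fun t => v k * (t == i)%:Z - v i * (t == k)%:Z) m2.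
  by rewrite !wt_pair /v /mdiff; ring.
move/H; rewrite !wt_pair /v /mdiff => E.
rewrite !mulrBr; apply/eqP; rewrite -subr_eq0; apply/eqP.
move: E => /eqP; rewrite -subr_eq0 => /eqP <-; ring.
Qed.

Lemma parallel_wt m1 m2 e e' w : e != e' ->
  (forall i k, mdiff m1 m2 k * mdiff e e' i = mdiff m1 m2 i * mdiff e e' k) ->
  wt w e = wt w e' -> wt w m1 = wt w m2.
Proof.
move=> ne vx we; have [k xk] : exists k, mdiff e e' k != 0.
  apply: NNPP => /not_ex_all_not H; case/eqP: ne; apply/mnmP => i.
  by move/negP: (H i); rewrite negbK subr_eq0 eqz_nat => /eqP.
have wtB a b : wt w a - wt w b = \sum_(i < n) w i * mdiff a b i.
  by rewrite /wt -sumrB; apply: eq_bigr => i _; rewrite -mulrBr.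
apply/eqP; rewrite -subr_eq0 wtB -(mulIr_eq0 _ (mulIf xk)) mulr_suml.
rewrite (eq_bigr (fun i => mdiff m1 m2 k * (w i * mdiff e e' i))).
  by rewrite -mulr_sumr -wtB we subrr mulr0.
by move=> i _; rewrite -mulrA -vx mulrCA.
Qed.
End ExponentLine.
Lemma coprime_monomials (K : fieldType) n (m1 m2 : 'X_{1..n}) :
  relatively_prime [:: ('X_[m1] : {mpoly K[n]}); 'X_[m2]] -> forall i, m1 i = 0%N \/ m2 i = 0%N.
Proof.
move=> cop i; have [?|m1i] := eqVneq (m1 i) 0%N; first by left.
have [?|m2i] := eqVneq (m2 i) 0%N; first by right.
have dX (m : 'X_{1..n}) : m i != 0%N -> divides 'X_i ('X_[m] : {mpoly K[n]}).
  move=> mi; apply: dvd_mpolyX => e; rewrite mcoeffX.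
  by have [<-|_] := eqVneq m e; rewrite ?eqxx.
case: (cop 'X_i); last by rewrite /nonconstant msizeX mdeg1.
by move=> p; rewrite !inE => /orP[/eqP->|/eqP->]; apply: dX.
Qed.

Lemma to_closureX (K : fieldType) n l (L : algClosure (ratfun K l)) (m : 'X_{1..n}) :
  to_closure L ('X_[m] : {mpoly K[n]}) = 'X_[m].
Proof. exact: (map_mpolyX (closure_emb L \o (@tofrac _ \o @mpolyC l K))). Qed.

Lemma mcoeff_to_closure (K : fieldType) n l (L : algClosure (ratfun K l)) (p : {mpoly K[n]}) m :
  (to_closure L p)@_m = closure_emb L (tofrac (p@_m)%:MP).
Proof. exact: (mcoeff_map_mpoly (closure_emb L \o (@tofrac _ \o @mpolyC l K))). Qed.

Lemma lambda_neq0 (K : fieldType) l (L : algClosure (ratfun K l)) i : lambda L i != 0.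
Proof. by rewrite fmorph_eq0 tofrac_eq0 -msize_poly_eq0 msizeX. Qed.

(** If [g] divided the direction, the binomial would be a form of degree [g]
    in two smaller monomials, and would split over the algebraic closure. *)
Lemma generic_binomial_primitive (K : fieldType) n (L : algClosure (ratfun K 1))
    (m1 m2 : 'X_{1..n}) :
  (forall i, m1 i = 0%N \/ m2 i = 0%N) ->
  generically_irreducible L ('X_[m1] : {mpoly K[n]}) 'X_[m2] ->
  m1 != m2 /\ primitive_vec (mdiff m1 m2).
Proof.
move=> disj []; rewrite !to_closureX; set lam := lambda L ord0.
set F : {mpoly L[n]} := (X in nonconstant X) => Fn Firr.
have ne : m1 != m2.
  apply/eqP => E; have m0 : m1 = 0%MM.
    by apply/mnmP => i; rewrite mnm0E; case: (disj i) => //; rewrite E.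
  move: Fn; rewrite /F -E m0 /nonconstant mpolyX0 -[X in X + _]scale1r -scalerDl.
  by rewrite ltnNge (leq_trans (msizeZ_le _ _)) // msize1.
split=> // g gdvd; have [//|g1] := eqVneq g 1%N.
have gd i : (g %| m1 i)%N /\ (g %| m2 i)%N.
  have := gdvd i; rewrite /mdiff; have arith (a b : nat) : a = 0%N \/ b = 0%N ->
    (g %| `|a%:Z - b%:Z|)%N -> (g %| a)%N /\ (g %| b)%N.
    by case=> ->; rewrite ?subr0 ?sub0r ?abszN /= dvdn0.
  exact: arith.
pose a := [multinom (m1 i %/ g) | i < n]; pose b := [multinom (m2 i %/ g) | i < n].
have m1E : m1 = (a *+ g)%MM.
  by apply/mnmP => i; rewrite mulmnE mnmE divnK //; case: (gd i).
have m2E : m2 = (b *+ g)%MM.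
  by apply/mnmP => i; rewrite mulmnE mnmE divnK //; case: (gd i).
have g2 : (1 < g)%N.
  case: (g) g1 m1E m2E => [|[|g']] // _ m1E m2E; case/eqP: ne.
  by rewrite m1E m2E; apply/mnmP => i; rewrite !mulmnE !muln0.
have F1 : (mdeg m1 < msize F)%N.
  apply: msize_mdeg_lt; rewrite mcoeff_msupp mcoeffD mcoeffZ !mcoeffX eqxx (eq_sym m2) (negPf ne).
  by rewrite mulr0 addr0 oner_eq0.
have F2 : (mdeg m2 < msize F)%N.
  apply: msize_mdeg_lt; rewrite mcoeff_msupp mcoeffD mcoeffZ !mcoeffX eqxx (negPf ne).
  by rewrite mulr1 add0r lambda_neq0.
have Fform : binary_form_in 'X_[a] 'X_[b] g F.
  apply: binary_formD; last apply: binary_formZ.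
    by rewrite m1E -mpolyXn -[_ ^+ g]mulr1 -[X in binary_form_in _ _ X]addn0; apply: binary_form_monomial.
  by rewrite m2E -mpolyXn -[_ ^+ g]mul1r -[X in binary_form_in _ _ X]add0n; apply: binary_form_monomial.
have [c [s [_ _ FE]]] := binary_form_split Fform.
case: Firr; apply: (reducible_product (s := [seq pencil_line 'X_[a] 'X_[b] ab | ab <- s]) (c := c)) => //.
  by rewrite big_map.
have small (u : 'X_{1..n}) : (mdeg (u *+ g)%MM < msize F)%N ->
    (msize ('X_[u] : {mpoly L[n]}) < msize F)%N.
  rewrite msizeX mdegMn; have arith (k h f : nat) : (1 < h)%N -> (1 < f)%N -> (k * h < f)%N -> (k.+1 < f)%N.
    by case: k => [|k] //; nia.
  exact: arith.
by move=> _ /mapP[ab _ ->]; apply: msize_line_lt; apply: small; rewrite -?m1E -?m2E.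
Qed.

(** * Monomials of a decomposition form a site *)

Section FormSite.
Variables (K : fieldType) (n l : nat) (L : algClosure (ratfun K l)).
Variables (P : {mpoly K[n]}) (q : 'I_l -> 'X_{1..n}).
Local Notation F := (to_closure L P + \sum_(i < l) lambda L i *: 'X_[q i]).

(** The coefficient is a polynomial in the parameters with constant term
    [P@_m]. *)
Lemma family_coef_neq0 m : P@_m != 0 -> F@_m != 0.
Proof.
move=> Pm; have -> : F@_m = closure_emb L (tofrac ((P@_m)%:MP + \sum_(i < l) (q i == m)%:R * 'X_i)).
  rewrite mcoeffD mcoeff_to_closure (raddf_sum (mcoeff m)) tofracD (rmorphD (closure_emb L)).
  congr (_ + _); rewrite (rmorph_sum (@tofrac {mpoly K[l]})) (rmorph_sum (closure_emb L)).
  apply: eq_bigr => i _ /=; rewrite mcoeffZ mcoeffX tofracM (rmorphM (closure_emb L)).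
  by rewrite mulrC; congr (_ * _); rewrite !rmorph_nat.
rewrite fmorph_eq0 tofrac_eq0; apply/eqP => /mpolyP/(_ 0%MM).
rewrite mcoeffD mcoeffC eqxx mulr1 (raddf_sum (mcoeff 0%MM)) mcoeff0 big1 ?addr0 => [/eqP|i _ /=].
  by rewrite (negPf Pm).
by rewrite -mpolyC_nat mcoeffCM mcoeffX mnm1_eq0 mulr0.
Qed.

Lemma msize_family_ge : P != 0 -> (msize P <= msize F)%N.
Proof.
move=> P0; rewrite -(mlead_deg P0); apply: msize_mdeg_lt; rewrite mcoeff_msupp.
by apply: family_coef_neq0; rewrite mleadc_eq0.
Qed.

(** The whole family is a form in the two monomials, and its linear factors
    are smaller than [P]. *)
Lemma form_site m1 m2 d : nonconstant P -> binary_form_in 'X_[m1] 'X_[m2] d P ->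
  (maxn (msize ('X_[m1] : {mpoly K[n]})) (msize ('X_[m2] : {mpoly K[n]})) < msize P)%N ->
  (forall i, exists2 k, (k <= d)%N & q i = (m1 *+ k + m2 *+ (d - k))%MM) -> mreducible F.
Proof.
move=> Pn Pf; rewrite gtn_max => /andP[s1 s2] qk.
have Fge := msize_family_ge (nonconstant_neq0 Pn).
have Ff : binary_form_in 'X_[m1] 'X_[m2] d F.
  apply: binary_formD.
    have := binary_form_map (closure_emb L \o (@tofrac _ \o @mpolyC l K)) Pf.
    by rewrite !map_mpolyX.
  apply: binary_form_sum => i _; apply: binary_formZ; have [k kd ->] := qk i.
  by rewrite mpolyXD -!mpolyXn -{1}(subnKC kd); apply: binary_form_monomial.
have [c [s [_ _ FE]]] := binary_form_split Ff.
apply: (reducible_product (s := [seq pencil_line 'X_[m1] 'X_[m2] ab | ab <- s]) (c := c)).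
- exact: leq_trans Fge.
- by rewrite big_map.
move=> _ /mapP[ab _ ->]; apply: leq_trans Fge; rewrite !msizeX in s1 s2.
by apply: msize_line_lt; rewrite msizeX.
Qed.
End FormSite.
(** * Sites of a polynomial homogeneous in two monomials *)

Lemma wtMn n (w : 'I_n -> int) m k : wt w (m *+ k)%MM = wt w m *+ k.
Proof.
elim: k => [|k IH]; first by rewrite mulm0n mulr0n /wt big1 // => i _; rewrite mnm0E mulr0.
by rewrite mulmS wtD IH mulrS.
Qed.

Lemma wt1_mdeg n (m : 'X_{1..n}) : wt (fun=> 1) m = (mdeg m)%:Z.
Proof.
rewrite /wt mdegE; elim/big_ind2: _ => [//|a b c d -> ->|i _]; first by rewrite PoszD.
by rewrite mul1r.
Qed.

Lemma monomial_form_wt (K : fieldType) n (m1 m2 : 'X_{1..n}) d (P : {mpoly K[n]}) w :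
  binary_form_in 'X_[m1] 'X_[m2] d P -> wt w m1 = wt w m2 -> whomog w (wt w m1 *+ d) P.
Proof.
move=> Pf w12 e; rewrite mcoeff_msupp => /(monomial_form_supp Pf)[k kd ->].
by rewrite wtD !wtMn -w12 -mulrnDr subnKC.
Qed.

(** A monomial that lies on the line of the decomposition cannot lie outside
    the segment: its exponents would be negative, or its degree too large. *)
Lemma segment_bound n (a b q : 'X_{1..n}) (u v : int) d : a != b ->
  (forall i, a i = 0%N \/ b i = 0%N) ->
  (forall i, (q i)%:Z = (a i)%:Z * u + (b i)%:Z * v) -> u + v = d%:Z ->
  (mdeg a = 0%N -> mdeg q <= d * mdeg b)%N -> 0 <= u.
Proof.
move=> ne disj qE uv deg.
have [i ai|a0] := pickP (fun i => a i != 0%N).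
  have bi : b i = 0%N by case: (disj i) ai => [->|] //; rewrite eqxx.
  have arith (x y : nat) (z : int) : x != 0%N -> y%:Z = x%:Z * z -> 0 <= z.
    by case: x => // x _; nia.
  by apply: (arith _ (q i) u ai); rewrite qE bi mul0r addr0.
have aE : a = 0%MM by apply/mnmP => i; rewrite mnm0E; apply/eqP; have /negbT := a0 i; rewrite negbK.
have b0 : mdeg b != 0%N by rewrite mdeg_eq0 eq_sym -aE.
have qdeg : (mdeg q)%:Z = (mdeg b)%:Z * v.
  rewrite -!wt1_mdeg /wt mulr_suml; apply: eq_bigr => i _.
  by rewrite !mul1r qE aE mnm0E mul0r add0r.
have := deg; rewrite aE mdeg0 => /(_ erefl).
have arith (x y z : nat) (s t : int) : y != 0%N -> x%:Z = y%:Z * t -> s + t = z%:Z ->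
    (x <= z * y)%N -> 0 <= s.
  by case: y => // y _; nia.
exact: arith b0 qdeg uv.
Qed.

Section MonomialSites.
Variables (K : closedFieldType) (closure : forall l : nat, algClosure (ratfun K l)).
Variables (n : nat) (P : {mpoly K[n]}).
Hypotheses (P_nonconst : nonconstant P) (P_not_mono : ~ monomial_upto_const P)
  (P_not_pow : ~ pure_power P).

Section Site.
Variables (l : nat) (q : 'I_l.+1 -> 'X_{1..n}).
Hypotheses (q_inj : injective q)
  (q_le : forall t, (msize ('X_[q t] : {mpoly K[n]}) <= msize P)%N)
  (cop : forall r, divides r P -> (forall t, divides r 'X_[q t]) -> ~ nonconstant r).
Hypothesis red : mreducible (to_closure (closure l.+1) P +
  \sum_(i < l.+1) lambda (closure l.+1) i *: 'X_[q i]).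

(** For several monomials, all exponents of [P] and of the monomials lie on
    the line through two of the latter; any two exponents of [P] already span
    this line. *)
Lemma site_weights w g : whomog w g P -> forall t, wt w (q t) = g.
Proof.
move=> Pg; have P0 := nonconstant_neq0 P_nonconst.
case: l q q_inj q_le cop red => [|l'] q' q_inj' q_le' cop' red' t.
  have cop2 : coprime_mpoly P 'X_[q' ord0].
    by move=> r rP rX; apply: (cop' r rP) => t'; rewrite (ord1 t').
  have [phi [psi [d [_ _ [s1 s2] [f1 f2] _]]]] :=
    one_monomial_site (closure (0 + n)) P_nonconst P_not_mono P_not_pow cop2 (q_le' ord0) red'.
  by rewrite (ord1 t); apply: (one_monomial_weight P_nonconst P_not_pow s1 s2 cop2 f1 f2).
have line w' t1 : wt w' (q' (fintype.lift ord0 t1)) = wt w' (q' ord0) ->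
    (forall e, P@_e != 0 -> wt w' e = wt w' (q' ord0)) /\ forall t, wt w' (q' t) = wt w' (q' ord0).
  exact: (site_same_weight (closure (l'.+1 + n)) (closure n)
            P_nonconst P_not_mono P_not_pow cop' q_inj' red').
set q1 := q' (fintype.lift ord0 ord0); set q0 := q' ord0.
have [e [Pe _]] := exists_other_term 0%MM P0 P_not_mono.
have [e' [Pe' ee']] := exists_other_term e P0 P_not_mono.
have weE e1 : P@_e1 != 0 -> wt w e1 = g by rewrite -mcoeff_msupp; apply: Pg.
have w10 : wt w q1 = wt w q0.
  apply: (parallel_wt ee' _ (etrans (weE _ Pe') (esym (weE _ Pe)))).
  by apply: wt_parallel => w' w'q; have [H _] := line w' ord0 w'q; rewrite !H.
have [HP Hq] := line w ord0 w10.
by rewrite (Hq t) -(HP _ Pe) weE.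
Qed.

(** By the previous lemma an exponent of the site differs from one of [P] by a
    multiple of the primitive direction of the decomposition. *)
Lemma monomial_site_segment m1 m2 d : binary_form_in 'X_[m1] 'X_[m2] d P ->
  (forall i, m1 i = 0%N \/ m2 i = 0%N) -> m1 != m2 -> primitive_vec (mdiff m1 m2) ->
  forall t, exists2 k, (k <= d)%N & q t = (m1 *+ k + m2 *+ (d - k))%MM.
Proof.
move=> Pf disj ne prim t; have P0 := nonconstant_neq0 P_nonconst.
have lP : P@_(mlead P) != 0 by rewrite mleadc_eq0.
have [k0 k0d eE] := monomial_form_supp Pf lP.
have par : forall w, wt w m1 = wt w m2 -> wt w (q t) = wt w (mlead P).
  move=> w w12; have H := monomial_form_wt Pf w12.
  by rewrite (site_weights H) (H (mlead P)) // mcoeff_msupp.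
have [i0 vi0] : exists i0, mdiff m1 m2 i0 != 0.
  apply: NNPP => /not_ex_all_not H; case/eqP: ne; apply/mnmP => i.
  by move/negP: (H i); rewrite negbK subr_eq0 eqz_nat => /eqP.
have [c cE] := proportional_primitive vi0 (wt_parallel par) prim.
pose u := k0%:Z + c.
have qE i : (q t i)%:Z = (m1 i)%:Z * u + (m2 i)%:Z * (d%:Z - u).
  have := cE i; rewrite /mdiff eE mnmDE !mulmnE PoszD !PoszM -subzn // /u.
  move/eqP; rewrite subr_eq => /eqP ->; ring.
have deg_le : (mdeg (q t) <= mdeg (mlead P))%N.
  by have := q_le t; rewrite msizeX -(mlead_deg P0) ltnS.
have degE : mdeg (mlead P) = (mdeg m1 * k0 + mdeg m2 * (d - k0))%N.
  by rewrite eE mdegD !mdegMn.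
have u0 : 0 <= u.
  apply: (segment_bound ne disj qE (d := d)); first by rewrite addrC subrK.
  move=> m10; apply: leq_trans deg_le _; rewrite degE m10 mul0n add0n mulnC.
  by rewrite leq_mul2r leq_subr orbT.
have ud : 0 <= d%:Z - u.
  have qE' i : (q t i)%:Z = (m2 i)%:Z * (d%:Z - u) + (m1 i)%:Z * u by rewrite addrC qE.
  apply: (segment_bound _ _ qE' (d := d)); rewrite ?subrK // 1?eq_sym //.
    by move=> i; case: (disj i); [right|left].
  move=> m20; apply: leq_trans deg_le _; rewrite degE m20 mul0n addn0 mulnC.
  by rewrite leq_mul2r k0d orbT.
case: (u) u0 ud qE => // k _ kd qE; exists k; first lia.
apply/mnmP => i; apply/eqP; rewrite -eqz_nat mnmDE !mulmnE PoszD !PoszM -subzn; first by rewrite qE.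
lia.
Qed.
End Site.
End MonomialSites.
(** * A single monomial and a generically irreducible pencil *)

Lemma mirreducible_unscale (F : fieldType) n c (p : {mpoly F[n]}) :
  c != 0 -> mirreducible (c *: p) -> mirreducible p.
Proof.
move=> c0 []; rewrite /nonconstant msizeZ // => pn pi; split=> // [[a [b [an bn pE]]]].
by apply: pi; exists (c *: a), b; split; rewrite ?pE ?scalerAl // /nonconstant msizeZ.
Qed.

Lemma transcendental_eval_inj (K : closedFieldType) (k : fieldType) (kap : {rmorphism K -> k}) s :
  (forall e, s != kap e) -> injective (mmap kap (fun _ : 'I_1 => s)).
Proof.
move=> sN; pose ev : {rmorphism {mpoly K[1]} -> k} := mmap kap (fun _ : 'I_1 => s).
suff ev0 p : ev p = 0 -> p = 0.
  move=> p r /eqP; rewrite -subr_eq0 => /eqP E; apply/eqP; rewrite -subr_eq0; apply/eqP.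
  by apply: ev0; rewrite (rmorphB ev).
move=> evp; apply/eqP; apply: contraT => p0.
have evE : ev p = (map_poly kap (kronecker (msize p) p)).[s].
  pose ev' : {rmorphism {mpoly K[1]} -> k} :=
    horner_eval s \o map_poly kap \o @kronecker K 1 (msize p).
  apply: (mpoly_rmorph_ext (f := ev) (g := ev')) => [c|i].
    transitivity (kap c); first exact: mmapC.
    by rewrite /= /kronecker mmapC map_polyC /horner_eval hornerC.
  transitivity s; first by rewrite /= mmapX mmap1U.
  by rewrite /= /kronecker mmapX mmap1U map_polyXn /horner_eval (ord1 i) expn0 expr1 hornerX.
have [|e sE] := closed_algebraic (i := kap) (t := s); last by have := sN e; rewrite sE eqxx.
exists (kronecker (msize p) p); last by rewrite /root -evE evp.
apply/eqP => /polyP/(_ (kronecker_exp (msize p) (mlead p))).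
rewrite kronecker_coef ?coef0 // => [/eqP|]; first by rewrite mleadc_eq0 (negPf p0).
by rewrite -(mlead_deg p0).
Qed.

(** The field [K(lambda)] embeds into [k] by sending [lambda] to the
    transcendental [s]. *)
Lemma generically_irreducible_transfer (K M : closedFieldType) (k : fieldType)
    (kap : {rmorphism K -> k}) (emb : {rmorphism k -> M}) s n (L : algClosure (ratfun K 1))
    (f g : {mpoly K[n]}) : (forall e, s != kap e) ->
  mirreducible (map_mpoly emb (map_mpoly kap f + s *: map_mpoly kap g)) ->
  generically_irreducible L f g.
Proof.
move=> sN [irr1 irr2].
have [kappa kappaE] := frac_lift (transcendental_eval_inj sN).
pose c0 : {rmorphism K -> ratfun K 1} := @tofrac _ \o @mpolyC 1 K.
pose lam : 'I_1 -> ratfun K 1 := fun i => tofrac ('X_i : {mpoly K[1]}).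
pose F0 : {mpoly (ratfun K 1)[n]} := map_mpoly c0 f + \sum_(i < 1) lam i *: map_mpoly c0 g.
have F0L : map_mpoly (closure_emb L) F0 = to_closure L f + lambda L ord0 *: to_closure L g.
  transitivity (map_mpoly (closure_emb L \o c0) f +
    \sum_(i < 1) closure_emb L (lam i) *: map_mpoly (closure_emb L \o c0) g).
    exact: map_mpoly_comb.
  by rewrite big_ord1.
have F0M : map_mpoly (emb \o kappa) F0 = map_mpoly emb (map_mpoly kap f + s *: map_mpoly kap g).
  transitivity (map_mpoly emb (map_mpoly kappa F0)); first by symmetry; apply: map_mpoly_map.
  congr (map_mpoly _ _); transitivity (map_mpoly kap f + \sum_(i < 1) s *: map_mpoly kap g).
    apply: map_mpoly_comb => [c|i]; rewrite kappaE; first exact: mmapC.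
    by apply: etrans (mmap1U (fun=> s) i); apply: mmapX.
  by rewrite big_ord1.
split; rewrite -F0L.
  by rewrite nonconstant_map -(nonconstant_map (emb \o kappa)) F0M.
move=> red; apply: irr2; rewrite -F0M.
by apply: (reducible_transfer (j := closure_emb L)) => //; apply: closure_alg.
Qed.
Section PencilPartner.
Variables (K M : closedFieldType) (k : fieldType) (n : nat) (j : {rmorphism {mpoly K[n]} -> k})
  (emb : {rmorphism k -> M}).
Local Notation lift := (generic_lift j).
Local Notation kap := (generic_const j).
Variables (phi psi : {mpoly K[n]}) (t : k).
Hypotheses (tN : forall e, t != kap e)
  (irr : mirreducible (map_mpoly emb (lift phi - t *: lift psi))).

(** Any member of a pencil is one of the two elements of a basis, the other one
    being among the original generators; the generic members of the two bases
    correspond under a homography, which preserves transcendence. *)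
Lemma pencil_partner ab : (ab.1 != 0) || (ab.2 != 0) -> exists chi,
  [/\ chi = phi \/ chi = psi,
      binary_form_in (pencil_line phi psi ab) chi 1 phi,
      binary_form_in (pencil_line phi psi ab) chi 1 psi
    & forall L : algClosure (ratfun K 1),
        generically_irreducible L chi (pencil_line phi psi ab)].
Proof.
case: ab => a b /= ab0; set A := pencil_line phi psi (a, b).
have first_form f chi : binary_form_in f chi 1 f.
  by rewrite -[X in binary_form_in _ _ _ X](addr0 f) -{2}(scale1r f) -(scale0r chi); apply: binary_form_linear.
have snd_form f chi : binary_form_in f chi 1 chi.
  by rewrite -[X in binary_form_in _ _ _ X](add0r chi) -{2}(scale1r chi) -(scale0r f); apply: binary_form_linear.
have transfer chi s c : (forall e, s != kap e) -> c != 0 ->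
    lift phi - t *: lift psi = c *: (lift chi + s *: lift A) ->
    forall L : algClosure (ratfun K 1), generically_irreducible L chi A.
  move=> sN c0 E L; apply: (generically_irreducible_transfer L sN (emb := emb)).
  apply: (@mirreducible_unscale _ _ (emb c)); first by rewrite fmorph_eq0.
  by move: irr; rewrite E map_mpolyZ.
have liftA : lift A = kap a *: lift phi + kap b *: lift psi.
  by rewrite /A /pencil_line (rmorphD lift) /= !generic_liftZ.
have [a0|a0] := eqVneq a 0.
  have b0 : b != 0 by move: ab0; rewrite a0 eqxx.
  have kb0 : kap b != 0 by rewrite fmorph_eq0.
  have AE : A = b *: psi by rewrite /A /pencil_line /= a0 scale0r add0r.
  exists phi; split; [by left | exact: snd_form | |].
    rewrite -[psi in X in binary_form_in _ _ _ X](scale1r psi) -(mulVf b0) -scalerA -AE.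
    exact: binary_formZ.
  apply: (transfer phi (- t / kap b) 1 _ (oner_neq0 _)).
    move=> e; apply/eqP => E; have /negP := tN (- (e * b)); case; apply/eqP.
    have -> : kap (- (e * b)) = - (kap e * kap b) by rewrite rmorphN rmorphM.
    by rewrite -E divfK // opprK.
  by rewrite scale1r liftA a0 rmorph0 scale0r add0r scalerA divfK // scaleNr.
have ka0 : kap a != 0 by rewrite fmorph_eq0.
exists psi; split; [by right | | exact: snd_form |].
  have -> : phi = a^-1 *: A + (- (b / a)) *: psi.
    rewrite /A /pencil_line /= scalerDr !scalerA mulVf // scale1r -addrA -scalerDl.
    by rewrite (mulrC b) subrr scale0r addr0.
  exact: binary_form_linear.
pose c := - (kap b / kap a + t).
have c0 : c != 0.
  rewrite oppr_eq0; apply/eqP => E; have /negP := tN (- (b / a)); case; apply/eqP.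
  rewrite (rmorphN kap) (fmorph_div kap); apply/eqP; rewrite -addr_eq0 addrC; exact/eqP.
apply: (transfer psi ((kap a)^-1 / c) c _ c0).
  move=> e; apply/eqP => E.
  have ke0 : kap e != 0 by rewrite -E mulf_neq0 // invr_eq0.
  have e0 : e != 0 by move: ke0; rewrite fmorph_eq0.
  have cE : c = kap (a^-1 / e).
    rewrite (fmorph_div kap) (fmorphV kap) -E invfM (invrK c) mulrA.
    by rewrite mulfV ?invr_eq0 ?mul1r.
  have /negP := tN (- (a^-1 / e) - b / a); case; apply/eqP.
  have -> : kap (- (a^-1 / e) - b / a) = - c - kap b / kap a.
    by rewrite cE -(fmorph_div kap) -(rmorphN kap) -(rmorphB kap).
  by rewrite /c opprK addrAC subrr add0r.
rewrite scalerDr scalerA mulrCA mulfV // mulr1 liftA scalerDr !scalerA mulVf // scale1r.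
rewrite addrCA -scalerDl; congr (_ + _); rewrite -scaleNr; congr (_ *: _).
by rewrite /c opprD mulrC addrAC addNr add0r.
Qed.
End PencilPartner.
(** * Sites of a polynomial not homogeneous in two monomials: one monomial *)

Lemma linear_form_dvd (K : closedFieldType) n (f g p r : {mpoly K[n]}) :
  binary_form_in f g 1 p -> divides r f -> divides r g -> divides r p.
Proof.
case/binary_form_split => c [s [s1 _ ->]] rf rg; move: s s1 => [|ab [|? ?]] // _.
by rewrite big_seq1 -mul_mpolyC; apply: dvdMl; apply: dvd_lin.
Qed.

Lemma monomial_divisor (K : fieldType) n (A : {mpoly K[n]}) m :
  divides A 'X_[m] -> exists a mA, a != 0 /\ A = a *: 'X_[mA].
Proof.
move=> [B XE]; apply: (monomial_factor (B := B) (c := 1) (m := m)); first exact: oner_neq0.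
by rewrite scale1r mulrC.
Qed.

Lemma binary_form_in_scale (K : fieldType) n (f g p : {mpoly K[n]}) a b d :
  binary_form_in (a *: f) (b *: g) d p -> binary_form_in f g d p.
Proof.
apply: binary_form_ind.
  by rewrite -[a *: f]addr0 -(scale0r g); apply: binary_form_linear.
by rewrite -[b *: g]add0r -(scale0r f); apply: binary_form_linear.
Qed.

Section SingleSite.
Variables (K : closedFieldType) (closure : forall l : nat, algClosure (ratfun K l)).
Variables (n : nat) (P : {mpoly K[n]}) (q : 'I_1 -> 'X_{1..n}).
Hypotheses (P_nonconst : nonconstant P) (P_not_mono : ~ monomial_upto_const P)
  (P_not_pow : ~ pure_power P) (P_not_hom : ~ hom_in_two_monomials P).
Hypotheses (cop : coprime_mpoly P 'X_[q ord0])
  (q_le : (msize ('X_[q ord0] : {mpoly K[n]}) <= msize P)%N).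

Lemma no_monomial_pencil phi psi m1 m2 d a1 a2 :
  coprime_mpoly phi psi -> (msize phi < msize P)%N -> (msize psi < msize P)%N ->
  a1 != 0 -> a2 != 0 -> phi = a1 *: 'X_[m1] -> psi = a2 *: 'X_[m2] ->
  ~ binary_form_in phi psi d P.
Proof.
move=> coppp s1 s2 a10 a20 E1 E2; rewrite E1 E2 => /binary_form_in_scale[h [hh PE]].
apply: P_not_hom; exists m1, m2, d, h; split=> //.
  move=> r dr; apply: coppp; rewrite ?E1 ?E2 -mul_mpolyC; apply: dvdMl; apply: dr;
    by rewrite !inE eqxx ?orbT.
by rewrite gtn_max; move: s1 s2; rewrite E1 E2 !msizeZ // => -> ->.
Qed.

(** The monomial is a form in [phi] and [psi], so that its linear factors are
    monomials. If two were independent, [P] would be a form in them. Hence the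
    monomial of the site is a power of a single member of the pencil, which is
    completed to a basis. *)
Lemma single_site :
  mreducible (to_closure (closure 1%N) P +
    \sum_(i < 1) lambda (closure 1%N) i *: 'X_[q i]) ->
  exists m d psi, [/\ q ord0 = (m *+ d)%MM, (2 <= d)%N,
    binary_form_in 'X_[m] psi d P,
    ~ monomial_upto_const psi /\ (maxn (msize ('X_[m] : {mpoly K[n]})) (msize psi) < msize P)%N
    & generically_irreducible (closure 1%N) psi 'X_[m]].
Proof.
move=> red.
have [phi [psi [d [coppp _ [s1 s2] [Pf qf] [tN irr]]]]] :=
  one_monomial_site (closure (0 + n)) P_nonconst P_not_mono P_not_pow cop q_le red.
case: (form_dichotomy qf) => [[ab1 [ab2 [det d1 d2]]]|[c [ab [ab0 qE]]]].
  set A1 := pencil_line phi psi ab1 in d1; set A2 := pencil_line phi psi ab2 in d2.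
  have [a1 [m1 [a10 E1]]] := monomial_divisor d1.
  have [a2 [m2 [a20 E2]]] := monomial_divisor d2.
  have [u1 [v1 [u2 [v2 [phiE psiE]]]]] := cramer2 phi psi det.
  have copA : coprime_mpoly A1 A2.
    by move=> r r1 r2; apply: coppp; [rewrite phiE | rewrite psiE]; apply: dvd_lin.
  have f1 : binary_form_in A1 A2 1 phi by rewrite phiE; apply: binary_form_linear.
  have f2 : binary_form_in A1 A2 1 psi by rewrite psiE; apply: binary_form_linear.
  by case: (no_monomial_pencil copA (msize_line_lt ab1 s1 s2) (msize_line_lt ab2 s1 s2) a10 a20 E1 E2
              (binary_form_ind f1 f2 Pf)).
have d2 : (2 <= d)%N.
  have [c' [s [sd _ PE]]] := binary_form_split Pf.
  have absurd A e : (msize A < msize P)%N -> P <> c' *: A ^+ e.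
    exact: not_power_of_small.
  case: s sd PE => [|ab' [|? ?]] <- // PE.
    by case: (absurd phi 0%N s1); rewrite PE big_nil expr0.
  by case: (absurd _ 1%N (msize_line_lt ab' s1 s2)); rewrite PE big_seq1 expr1.
have [a [m [a0 lineE]]] : exists a m, a != 0 /\ pencil_line phi psi ab = a *: 'X_[m].
  apply: (monomial_divisor (m := q ord0)); rewrite qE -mul_mpolyC; apply: dvdMl.
  by case: (d) d2 => // d' _; rewrite exprS; apply: dvd_mulr.
have [ab' ab'0 mE] : exists2 ab', (ab'.1 != 0) || (ab'.2 != 0) & pencil_line phi psi ab' = 'X_[m].
  exists (a^-1 * ab.1, a^-1 * ab.2).
    by rewrite /= !mulf_eq0 invr_eq0 (negPf a0).
  by rewrite /pencil_line /= -!scalerA -scalerDr -/(pencil_line _ _ ab) lineE scalerA mulVf ?scale1r.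
have [chi [chiE f1 f2 girr]] := pencil_partner tN irr ab'0; rewrite mE in f1 f2 girr.
have Pf' : binary_form_in 'X_[m] chi d P by apply: binary_form_ind Pf.
have sm : (msize ('X_[m] : {mpoly K[n]}) < msize P)%N by rewrite -mE; apply: msize_line_lt.
have sc : (msize chi < msize P)%N by case: chiE => ->.
exists m, d, chi; split=> //.
- have /mpolyP/(_ (q ord0)) := qE; rewrite lineE exprZn scalerA mpolyXn mcoeffZ !mcoeffX eqxx.
  by case: eqP => [-> //|_] /eqP; rewrite mulr0 oner_eq0.
- split; last by rewrite gtn_max sm sc.
  move=> [m2 [c2 c20 chiE2]].
  apply: (@no_monomial_pencil 'X_[m] chi m m2 d 1 c2) => //; rewrite ?oner_eq0 ?scale1r //.
  by move=> r r1 r2; apply: coppp; apply: linear_form_dvd r1 r2.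
Qed.
End SingleSite.
(** * Several monomials: the exponents fill a segment *)

Lemma primitive_direction n (v : 'I_n -> int) i0 : v i0 != 0 -> exists (u : 'I_n -> int) (g : int),
  [/\ g != 0, forall i, v i = g * u i & primitive_vec u].
Proof.
move=> v0; pose g := \big[gcdn/0%N]_(i < n) `|v i|%N.
have gd i : (g %| `|v i|)%N by apply: (dvdn_biggcdP _ _ _ (dvdnn g)).
have g0 : (0 < g)%N.
  by rewrite lt0n; apply: contraNneq v0 => g0; have := gd i0; rewrite g0 dvd0n absz_eq0.
exists (fun i => (v i %/ g%:Z)%Z), g%:Z.
have vE i : v i = g%:Z * (v i %/ g%:Z)%Z by rewrite mulrC divzK //; apply: gd.
split=> // [|d du]; first by rewrite eqz_nat -lt0n.
have : (g * d %| g)%N.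
  apply/dvdn_biggcdP => i _; rewrite {1}(vE i) abszM absz_nat.
  by apply: dvdn_mul => //; apply: du.
by rewrite -{2}(muln1 g) dvdn_pmul2l // dvdn1 => /eqP.
Qed.

Lemma segment_arith (ti bi ei x y : nat) (ui c J c0 : int) :
  (0 <= ui)%R /\ x%:Z = ui /\ y = 0%N \/ (ui < 0)%R /\ x = 0%N /\ y%:Z = - ui ->
  (0 <= c0)%R -> (c0 <= J)%R -> 0%:Z - bi%:Z = c0 * ui -> ti%:Z - bi%:Z = J * ui ->
  ei%:Z - bi%:Z = c * ui -> ei%:Z = x%:Z * c + y%:Z * (J - c).
Proof.
by move=> [[h0 [-> ->]]|[h0 [-> ->]]] h1 h2 h3 h4 h5; nia.
Qed.

Section Segment.
Import Order.TTheory Num.Theory.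
Variables (n : nat) (E : seq 'X_{1..n}) (a0 a1 : 'X_{1..n}).
Hypotheses (a0E : a0 \in E) (ne : a1 != a0).
Hypotheses (line : forall e, e \in E -> forall w, wt w a1 = wt w a0 -> wt w e = wt w a0).
Hypotheses (bottom : forall i, exists2 e, e \in E & e i = 0%N).

(** Each coordinate is a monotonic function of the position on the segment and
    vanishes for some element of [E], hence at one of the two ends. The
    exponents are therefore combinations of the positive and the negative part
    of the primitive direction. *)
Lemma line_segment : exists (m1 m2 : 'X_{1..n}) (J : nat),
  [/\ forall i, m1 i = 0%N \/ m2 i = 0%N, primitive_vec (mdiff m1 m2),
      forall e, e \in E -> exists2 k, (k <= J)%N & e = (m1 *+ k + m2 *+ (J - k))%MM
    & (m1 *+ J)%MM \in E /\ (m2 *+ J)%MM \in E].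
Proof.
have [i0 vi0] : exists i0, mdiff a1 a0 i0 != 0.
  apply: NNPP => /not_ex_all_not H; case/eqP: ne; apply/mnmP => i.
  by move/negP: (H i); rewrite negbK subr_eq0 eqz_nat => /eqP.
have [u [g [g0 vE prim]]] := primitive_direction vi0.
have ui0 : u i0 != 0 by apply: contraNneq vi0 => z; rewrite vE z mulr0.
have onE e e' : e \in E -> e' \in E -> exists c, forall i, mdiff e e' i = c * u i.
  move=> eE eE'; apply: (proportional_primitive ui0) => // i k.
  have : mdiff a1 a0 k * mdiff e e' i = mdiff a1 a0 i * mdiff e e' k.
    by apply: wt_parallel => w w10; rewrite (line eE w10) (line eE' w10).
  by rewrite !vE -!mulrA => /(mulfI g0).
(* the ends of the segment are found by extremizing one coordinate *)
pose w (i : 'I_n) : int := u i0 * (i == i0)%:Z.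
have wE e : wt w e = u i0 * (e i0)%:Z.
  rewrite /wt (bigD1 i0) //= big1 ?addr0 => [|i /negPf ii0]; first by rewrite /w eqxx mulr1.
  by rewrite /w ii0 mulr0 mul0r.
have [t tE tmax] := exists_max_wt w a0E.
have [b bE bmin] := exists_max_wt (fun i => - w i) a0E.
have posE e c e' : (forall i, mdiff e e' i = c * u i) -> wt w e' <= wt w e -> 0 <= c.
  move=> cE; rewrite !wE -subr_ge0 -mulrBr -/(mdiff e e' i0) cE mulrCA pmulr_lge0 //.
  by rewrite lt_def mulf_neq0 // -expr2 sqr_ge0.
have [J JE] := onE t b tE bE.
have J0 : 0 <= J by apply: posE JE (tmax _ bE).
have coords e : e \in E -> exists c, [/\ 0 <= c, c <= J & forall i, mdiff e b i = c * u i].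
  move=> eE; have [c cE] := onE e b eE bE; exists c; split=> //.
    by apply: posE cE _; have := bmin _ eE; rewrite !wtN lerN2.
  have cE' i : mdiff t e i = (J - c) * u i.
    by rewrite mulrBl -JE -cE /mdiff; ring.
  by rewrite -subr_ge0; apply: posE cE' (tmax _ eE).
pose pos (z : int) : nat := if z is Posz k then k else 0%N.
have pos_ge (z : int) : 0 <= z -> (pos z)%:Z = z /\ pos (- z) = 0%N by case: z => [[|k]|k].
have pos_lt (z : int) : z < 0 -> pos z = 0%N /\ (pos (- z))%:Z = - z by case: z.
pose m1 := [multinom pos (u i) | i < n]; pose m2 := [multinom pos (- u i) | i < n].
have m12 i : (0 <= u i /\ (m1 i)%:Z = u i /\ m2 i = 0%N) \/ (u i < 0 /\ m1 i = 0%N /\ (m2 i)%:Z = - u i).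
  by rewrite !mnmE; have [/pos_ge[-> ->]|/pos_lt[-> ->]] := lerP 0 (u i); [left|right].
have coordE e c i : (forall i, mdiff e b i = c * u i) ->
    (e i)%:Z = (m1 i)%:Z * c + (m2 i)%:Z * (J - c).
  move=> cE; have := cE i; have := JE i; have [e0 e0E ei0] := bottom i.
  have [c0 [c00 c0J c0E]] := coords _ e0E; have := c0E i.
  rewrite /mdiff ei0; move: (m12 i) c00 c0J.
  move: (t i) (b i) (e i) (m1 i) (m2 i) (u i) => ti bi ei x y ui.
  by move=> {posE JE tmax bmin coords c0E cE onE vE wE m12 pos_ge pos_lt}; apply: segment_arith.
exists m1, m2, `|J|%N; have JJ : `|J|%N%:Z = J by rewrite gez0_abs.
split.
- by move=> i; case: (m12 i) => [[_ []]|[_ []]]; [right|left].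
- move=> g' g'd; apply: prim => i; suff <- : mdiff m1 m2 i = u i by [].
  by rewrite /mdiff; case: (m12 i) => [[_ [-> ->]]|[_ [-> ->]]]; rewrite ?subr0 // sub0r opprK.
- move=> e eE; have [c [c0 cJ cE]] := coords _ eE; exists `|c|%N; first lia.
  apply/mnmP => i; have := coordE e c i cE; rewrite mnmDE !mulmnE.
  move: (m1 i) (m2 i) (e i) => x y z; rewrite -JJ in cJ *; nia.
split.
  suff -> : (m1 *+ `|J|)%MM = t by [].
  apply/mnmP => i; have := coordE t J i JE; rewrite mulmnE subrr mulr0 addr0.
  by move: (m1 i) (t i) => x y; rewrite -{1}JJ; lia.
suff -> : (m2 *+ `|J|)%MM = b by [].
have bb i : mdiff b b i = 0 * u i by rewrite /mdiff subrr mul0r.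
apply/mnmP => i; have := coordE b 0 i bb; rewrite mulmnE mulr0 add0r subr0.
by move: (m2 i) (b i) => x y; rewrite -{1}JJ; lia.
Qed.
End Segment.
Section Binomial.
Import Order.TTheory Num.Theory.
Variables (L : fieldType) (n : nat) (m1 m2 : 'X_{1..n}) (F : {mpoly L[n]}).
Hypotheses (disj : forall i, m1 i = 0%N \/ m2 i = 0%N) (prim : primitive_vec (mdiff m1 m2)).
Hypotheses (F1 : F@_m1 != 0) (F2 : F@_m2 != 0) (Fe : forall e, F@_e != 0 -> e = m1 \/ e = m2).

Let F0 : F != 0. Proof. by apply: contraNneq F1 => ->; rewrite mcoeff0. Qed.

Lemma binomial_factor_line A B w : F = A * B -> wt w m1 = wt w m2 -> exists a, whomog w a A.
Proof.
move=> FE w12; apply: (whomog_factor (B := B) (c := wt w m1)); rewrite -FE //.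
by move=> e; rewrite mcoeff_msupp => /Fe[] ->.
Qed.

(** A factor that is not a monomial is as wide as the binomial in every
    coordinate, because its exponents also lie on a line of primitive
    direction. *)
Lemma binomial_factor_width A B i a a' : F = A * B -> a \in msupp A -> a' \in msupp A -> a != a' ->
  (`|mdiff m1 m2 i| <= `|mdiff a a' i|)%N.
Proof.
move=> FE aA aA' ne; have [k vk] : exists k, mdiff m1 m2 k != 0.
  apply: NNPP => /not_ex_all_not H; have m12 : m1 = m2.
    by apply/mnmP => l; move/negP: (H l); rewrite negbK subr_eq0 eqz_nat => /eqP.
  have m0 : m1 = 0%MM by apply/mnmP => l; rewrite mnm0E; case: (disj l) => //; rewrite m12.
  have /prim : forall l, (2 %| `|mdiff m1 m2 l|)%N by move=> l; rewrite /mdiff m12 subrr dvdn0.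
  by [].
have [|c cE] := proportional_primitive vk (v := mdiff m1 m2) (x := mdiff a a') _ prim.
  apply: wt_parallel => w w12; have [g hg] := binomial_factor_line FE w12.
  by rewrite (hg _ aA) (hg _ aA').
rewrite cE abszM; have c0 : c != 0.
  apply: contraNneq ne => c0; apply/eqP/mnmP => l; have := cE l; rewrite c0 mul0r.
  by move/eqP; rewrite subr_eq0 eqz_nat => /eqP.
by rewrite leq_pmull // absz_gt0.
Qed.

(** A monomial that divides the binomial divides both of its terms, which are
    coprime. *)
Lemma monomial_not_factor A B : F = A * B -> nonconstant A ->
  exists a a', [/\ a \in msupp A, a' \in msupp A & a != a'].
Proof.
move=> FE An; apply: NNPP => H; have A0 := nonconstant_neq0 An.
set a := mlead A; have aA : a \in msupp A by rewrite mcoeff_msupp mleadc_eq0.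
have single m : m \in msupp A -> m = a.
  by move=> mA; apply/eqP; apply: contraT => ne; case: H; exists m, a.
have le m : F@_m != 0 -> forall i, (a i <= m i)%N.
  rewrite -mcoeff_msupp FE => /msuppM_ex[ma [mb [/single -> _ ->]]] i.
  by rewrite mnmDE leq_addr.
have a0 : a = 0%MM.
  apply/mnmP => i; rewrite mnm0E; apply/eqP; rewrite -leqn0.
  by case: (disj i) => <-; apply: le.
by move: An; rewrite /nonconstant -(mlead_deg A0) -/a a0 mdeg0.
Qed.

(** Some coordinate is not constant on the binomial, and there its width would
    be the sum of the widths of the two factors, each of which is as large. *)
Lemma binomial_irreducible : ~ mreducible F.
Proof.
move=> [A [B [An Bn FE]]].
have [a [a' [aA aA' aa']]] := monomial_not_factor FE An.
have FE' : F = B * A by rewrite mulrC.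
have [b [b' [bB bB' bb']]] := monomial_not_factor FE' Bn.
have [i vi] : exists i, mdiff m1 m2 i != 0.
  apply: NNPP => /not_ex_all_not H.
  have /prim : forall l, (2 %| `|mdiff m1 m2 l|)%N.
    by move=> l; move/negP: (H l); rewrite negbK => /eqP ->.
  by [].
pose w := fun k : 'I_n => Posz (k == i).
have A0 := nonconstant_neq0 An; have B0 := nonconstant_neq0 Bn.
have [pA [pB [p [[pA1 pA2] [pB1 pB2] [pF pE]]]]] := wt_max_mul w A0 B0.
have [rA [rB [r [[rA1 rA2] [rB1 rB2] [rF rE]]]]] := wt_max_mul (fun k => - w k) A0 B0.
have wA := binomial_factor_width i FE aA aA' aa'.
have wB := binomial_factor_width i FE' bB bB' bb'.
move: pE rE (pA2 _ aA) (pA2 _ aA') (rA2 _ aA) (rA2 _ aA').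
move: (pB2 _ bB) (pB2 _ bB') (rB2 _ bB) (rB2 _ bB').
rewrite !wtN /w !wt_coord !lerN2 => {pA2 pB2 rA2 rB2}.
have Fends e : e \in msupp (A * B) -> e i = m1 i \/ e i = m2 i.
  by rewrite -FE mcoeff_msupp => /Fe[] ->; [left|right].
move: (Fends _ pF) (Fends _ rF) wA wB vi; rewrite /mdiff.
move: (pA i) (pB i) (p i) (rA i) (rB i) (r i) (a i) (a' i) (b i) (b' i) (m1 i) (m2 i).
clear; lia.
Qed.
End Binomial.

Section SeveralSite.
Variables (K : closedFieldType) (closure : forall l : nat, algClosure (ratfun K l)).
Variables (n l : nat) (P : {mpoly K[n]}) (q : 'I_l.+2 -> 'X_{1..n}).
Hypotheses (P_nonconst : nonconstant P) (P_not_mono : ~ monomial_upto_const P)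
  (P_not_pow : ~ pure_power P).
Hypotheses (q_inj : injective q)
  (q_le : forall t, (msize ('X_[q t] : {mpoly K[n]}) <= msize P)%N)
  (cop : forall r, divides r P -> (forall t, divides r 'X_[q t]) -> ~ nonconstant r).

(** If the exponents lie on a segment of length at least two, [P] is a form in
    the monomials of its direction; on a segment of length one, the family is an
    irreducible binomial. *)
Lemma several_site :
  mreducible (to_closure (closure l.+2) P +
    \sum_(i < l.+2) lambda (closure l.+2) i *: 'X_[q i]) -> hom_in_two_monomials P.
Proof.
move=> red; have P0 := nonconstant_neq0 P_nonconst.
set q0 := q ord0; set q1 := q (fintype.lift ord0 ord0).
have q10 : q1 != q0 by rewrite (inj_eq q_inj).
pose E := msupp P ++ [seq q t | t <- enum 'I_l.+2].
have qE t : q t \in E by rewrite mem_cat map_f ?orbT // mem_enum.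
have line e : e \in E -> forall w, wt w q1 = wt w q0 -> wt w e = wt w q0.
  move=> eE w w10.
  have [HP Hq] := site_same_weight (closure (l.+1 + n)) (closure n)
    P_nonconst P_not_mono P_not_pow cop q_inj red w10.
  by move: eE; rewrite mem_cat mcoeff_msupp => /orP[/HP|/mapP[t _ ->]].
have bottom i : exists2 e, e \in E & e i = 0%N.
  apply: NNPP => H; have pos e : e \in E -> e i != 0%N by move=> eE; apply/eqP => ei; apply: H; exists e.
  case: (cop (r := 'X_i)); last by rewrite /nonconstant msizeX mdeg1.
    by apply: dvd_mpolyX => e; rewrite -mcoeff_msupp => eP; apply: pos; rewrite mem_cat eP.
  move=> t; apply: dvd_mpolyX => e; rewrite mcoeffX.
  by have [<- _|_] := eqVneq (q t) e; rewrite ?eqxx //; apply: pos.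
have [m1 [m2 [J [disj prim seg [m1E m2E]]]]] := line_segment (qE ord0) q10 line bottom.
have degE e : e \in E -> (mdeg e < msize P)%N.
  rewrite mem_cat => /orP[/msize_mdeg_lt //|/mapP[t _ ->]].
  by have := q_le t; rewrite msizeX.
have Pf : binary_form_in 'X_[m1] 'X_[m2] J P.
  rewrite [P in binary_form_in _ _ _ P]mpolyE big_seq; apply: binary_form_sum => e eP.
  have [|k kJ ->] := seg e; first by rewrite mem_cat eP.
  by apply: binary_formZ; rewrite mpolyXD -!mpolyXn -{1}(subnKC kJ); apply: binary_form_monomial.
have [J2|J2] := ltnP 1 J.
  have [h [hh PE]] := Pf; exists m1, m2, J, h; split=> //; last first.
    have small (m : 'X_{1..n}) : (m *+ J)%MM \in E -> (msize ('X_[m] : {mpoly K[n]}) < msize P)%N.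
      move=> /degE; rewrite msizeX mdegMn => mJ.
      have arith (k g f : nat) : (1 < g)%N -> (1 < f)%N -> (k * g < f)%N -> (k.+1 < f)%N.
        by case: k => [|k] //; nia.
      exact: arith J2 P_nonconst mJ.
    by rewrite gtn_max !small.
  move=> r rd rn.
  have [|a [m [a0 rE]]] := @monomial_divisor _ _ r m1; first by apply: rd; rewrite !inE eqxx.
  have rle (m' : 'X_{1..n}) : divides r 'X_[m'] -> forall i, (m i <= m' i)%N.
    move=> [c cE] i; have : m' \in msupp ('X_[m'] : {mpoly K[n]}) by rewrite msuppX inE.
    rewrite cE => /msuppM_ex[mc [mr [_ + ->]]]; rewrite rE => /msuppZ_le; rewrite msuppX inE => /eqP ->.
    by rewrite mnmDE leq_addl.
  have m0 : m = 0%MM.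
    apply/mnmP => i; rewrite mnm0E; apply/eqP; rewrite -leqn0.
    by case: (disj i) => <-; apply: rle; apply: rd; rewrite !inE eqxx ?orbT.
  by move: rn; rewrite /nonconstant rE m0 msizeZ // mpolyX0 msize1.
exfalso; have J1 : J = 1%N.
  case: (J) J2 seg => [|[|?]] // _ seg0; case/eqP: q10.
  have seg0E e : e \in E -> e = 0%MM.
    by case/seg0 => k; rewrite leqn0 => /eqP -> ->; rewrite !mulm0n addm0.
  by rewrite (seg0E q1 (qE _)) (seg0E q0 (qE _)).
rewrite J1 in seg; have ends e : e \in E -> e = m1 \/ e = m2.
  case/seg => [[|[|?]]] // _ ->; first by right; rewrite mulm0n add0m subn0 mulm1n.
  by left; rewrite subnn mulm0n addm0 mulm1n.
have PE e : P@_e != 0 -> e \in E by rewrite -mcoeff_msupp mem_cat => ->.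
have P1 : P@_m1 != 0.
  have [e [Pe /eqP em]] := exists_other_term m2 P0 P_not_mono.
  by case: (ends e (PE e Pe)) => ee; [rewrite -ee | case: em].
have P2 : P@_m2 != 0.
  have [e [Pe /eqP em]] := exists_other_term m1 P0 P_not_mono.
  by case: (ends e (PE e Pe)) => ee; [case: em | rewrite -ee].
apply: (binomial_irreducible disj prim (family_coef_neq0 _ _ P1) (family_coef_neq0 _ _ P2) _ red) => e Fe.
apply: ends; apply: contraT => eE; case/eqP: Fe.
rewrite mcoeffD mcoeff_to_closure (raddf_sum (mcoeff e)) big1 => [|t _ /=].
  have -> : P@_e = 0 by apply/eqP; apply: contraT => /PE; rewrite (negPf eE).
  by rewrite mpolyC0 !rmorph0 addr0.
rewrite mcoeffZ mcoeffX; case: eqP => [te|_]; last by rewrite mulr0.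
by move: eE; rewrite -te qE.
Qed.
End SeveralSite.
Lemma admissible_cop (K : fieldType) n (P : {mpoly K[n]}) l (Q : l.-tuple 'X_{1..n}) :
  admissible P Q -> forall r, divides r P -> (forall t, divides r 'X_[tnth Q t]) -> ~ nonconstant r.
Proof.
case=> _ _ _ _ cop r rP rX; apply: cop => p; rewrite inE => /orP[/eqP -> //|/mapP[m mQ ->]].
by have /tnthP[t ->] := mQ; apply: rX.
Qed.

Lemma admissible_inj (K : fieldType) n (P : {mpoly K[n]}) l (Q : l.-tuple 'X_{1..n}) :
  admissible P Q -> injective (tnth Q).
Proof.
case=> _ _ _ dist _ i j ij; apply/eqP; apply: contraT => /dist; case; rewrite ij.
by exists 1; rewrite ?scale1r ?oner_eq0.
Qed.

Theorem theorem3p3 (K : closedFieldType)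
  (closure : forall l : nat, algClosure (ratfun K l))
  (n : nat) (hn : (2 <= n)%N) (P : {mpoly K[n]})
  (P_nonconst : nonconstant P)
  (P_not_mono : ~ monomial_upto_const P)
  (P_not_pow : ~ pure_power P) :
  (hom_in_two_monomials P ->
     forall (m1 m2 : 'X_{1..n}) (delta : nat) (h : {mpoly K[2]}),
       maximal_hom_decomposition (closure 1%N) P 'X_[m1] 'X_[m2] delta h ->
     forall (l : nat) (Q : l.-tuple 'X_{1..n}), admissible P Q ->
       (reducibility_monomial_site (closure l) P Q <->
        forall i : 'I_l,
          exists k : nat,
            [/\ (k <= delta)%N,
                'X_[tnth Q i] = 'X_[m1] ^+ k * 'X_[m2] ^+ (delta - k)
                  :> {mpoly K[n]}
              & (msize ('X_[tnth Q i] : {mpoly K[n]}) <= msize P)%N]))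
  /\
  (~ hom_in_two_monomials P ->
     forall (l : nat) (Q : l.-tuple 'X_{1..n}),
       reducibility_monomial_site (closure l) P Q ->
       exists (m : 'X_{1..n}) (d : nat),
         [/\ [seq 'X_[q] | q <- Q] = [:: 'X_[m] ^+ d] :> seq {mpoly K[n]},
             relatively_prime [:: 'X_[m]; P],
             (2 <= d)%N
           & exists (h : {mpoly K[2]}) (psi : {mpoly K[n]}),
               [/\ h \is d.-homog,
                   P = h \mPo [tuple 'X_[m]; psi],
                   ~ monomial_upto_const psi,
                   (maxn (msize ('X_[m] : {mpoly K[n]})) (msize psi)
                      < msize P)%N
                 & generically_irreducible (closure 1%N) psi 'X_[m]]]).
Proof.
split=> [_ m1 m2 d h [[cop12 size12 hh PE] girr] l Q adm|Phom l Q [adm red]].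
  have [l0 Qle _ _ _] := adm.
  have disj := coprime_monomials cop12.
  have [ne prim] := generic_binomial_primitive disj girr.
  have Pf : binary_form_in 'X_[m1] 'X_[m2] d P by exists h.
  have monE (q : 'X_{1..n}) k : 'X_[q] = 'X_[m1] ^+ k * 'X_[m2] ^+ (d - k) :> {mpoly K[n]} <->
      q = (m1 *+ k + m2 *+ (d - k))%MM.
    rewrite !mpolyXn -mpolyXD; split=> [E|-> //].
    have := congr1 (mcoeff q) E; rewrite !mcoeffX eqxx.
    by case: eqP => [-> //|_] /eqP; rewrite oner_eq0.
  split=> [[_ red] i|Qk].
    have [k kd qE] : exists2 k, (k <= d)%N & tnth Q i = (m1 *+ k + m2 *+ (d - k))%MM.
      case: l Q i adm red l0 Qle => // l Q i adm red _ Qle.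
      exact: (monomial_site_segment P_nonconst P_not_mono P_not_pow (admissible_inj adm) Qle
                (admissible_cop adm) red Pf disj ne prim).
    by exists k; split=> //; apply/monE.
  split=> //; apply: (form_site (closure l) P_nonconst Pf size12) => i.
  by have [k [kd /monE qE _]] := Qk i; exists k.
have [l0 Qle _ _ _] := adm; have cop := admissible_cop adm; have inj := admissible_inj adm.
case: l Q adm red l0 Qle cop inj => // -[|l] Q adm red _ Qle cop inj; last first.
  by case: Phom; apply: (several_site P_nonconst P_not_mono P_not_pow inj Qle cop red).
have cop2 : coprime_mpoly P 'X_[tnth Q ord0].
  by move=> r rP rX; apply: cop rP _ => t; rewrite (ord1 t).
have [m [d [psi [qE d2 [h [hh PE]] [psiN sz] girr]]]] :=
  single_site P_nonconst P_not_mono P_not_pow Phom cop2 (Qle ord0) red.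
exists m, d; split=> //; last by exists h, psi.
  case: Q qE {adm red Qle cop inj cop2} => [[|q [|? ?]]] // sQ /=.
  by rewrite (tnth_nth q) /= => ->; rewrite mpolyXn.
move=> r rd; apply: (cop2 r); first by apply: rd; rewrite !inE eqxx orbT.
rewrite qE -mpolyXn; case: (d) d2 => // d' _; rewrite exprS.
by apply: dvdMr; apply: rd; rewrite !inE eqxx.
Qed.
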